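(* Let $R>0$ and let $\omega=(\omega_1,\omega_2)\in\mathcal H^2$ satisfy $\|\omega\|_{\mathcal H^2}=1$ and $\omega=\Theta_R\omega$. Then there exist $\phi\in[0,2\pi)$ and a solution $u=(u_1,u_2)\in C(\mathbb R;\mathcal H^2)$ to $$-i\partial_s u=\begin{pmatrix} s & G\\ G^* & -s\end{pmatrix}u+\delta F(u)u$$ such that, as $s\to+\infty$, $$u_1(s)=e^{i\delta F_1(\omega)s+i\varphi(s,GG^* )+i\phi}\omega_1+\mathcal O_R\left(\frac1s\right),\qquad u_2(s)=e^{i\delta F_2(\omega)s-i\varphi(s,G^*G)-i\phi}\omega_2+\mathcal O_R\left(\frac1s\right).$$ For a fixed $\phi$, such a function $u$ is unique. In addition, if $F_1=F_2$, then one may take $\phi=0$.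
   Context: Setting: $\mathcal H$ is a finite-dimensional complex Hilbert space, $G$ is an operator on $\mathcal H$ with adjoint $G^*$, satisfying $\chi(GG^* )G=G\chi(G^*G)$ and $\chi(G^*G)G^*=G^*\chi(GG^* )$ for every continuous $\chi:\mathbb R\to\mathbb R$ (functional calculus). $\delta\in\mathbb R$ is fixed. For $j=1,2$, $f_j\in C^2(\mathbb R^2;\mathbb R)$ has bounded Hessian, and for $u=(u_1,u_2)\in\mathcal H^2$ one sets $F_j(u)=f_j(\|u_1\|_{\mathcal H}^2,\|u_2\|_{\mathcal H}^2)\in\mathbb R$ and $F(u)=\mathrm{diag}(F_1(u),F_2(u))$, i.e. $F(u)(w_1,w_2)=(F_1(u)w_1,F_2(u)w_2)$. Each Cauchy problem $u(0)=u_0\in\mathcal H^2$ has a unique global solution in $C(\mathbb R;\mathcal H^2)$, and $\|u_1(s)\|_{\mathcal H}^2+\|u_2(s)\|_{\mathcal H}^2$ is independent of $s$; all solutions are normalized so that this quantity equals $1$. Cut-off: $\theta\in C_0^\infty(\mathbb R)$ is a fixed function with $0\le\theta\le1$, $\theta(u)=0$ for $|u|>1$, $\theta(u)=1$ for $|u|<1/2$; for $R>0$, $\Theta_R=\mathrm{diag}\left(\theta(GG^*/R^2),\theta(G^*G/R^2)\right)$. Phase: $\varphi(s,\lambda)=\frac{s^2}{2}+\frac{\lambda}{2}\ln|s|$; $\varphi(s,GG^* )$ and $\varphi(s,G^*G)$ are defined by functional calculus. Notation: an $\mathcal H$-valued function $w(s)$ is $\mathcal O_R(b(s))$ if $\|w(s)\|_{\mathcal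 H}\le C_R|b(s)|$ for a constant $C_R$ depending only on $R$ ($\mathcal H,G,\delta,f_1,f_2$ being fixed). *)

(* Defs.v *)
From HB Require Import structures.
From mathcomp Require Import all_boot all_order all_algebra.
From mathcomp Require Import sesquilinear.
From mathcomp Require Import all_classical all_reals all_analysis.
From mathcomp Require Import complex.

Set Implicit Arguments.
Unset Strict Implicit.
Unset Printing Implicit Defensive.

Import Order.TTheory GRing.Theory Num.Theory Num.Def.
Import numFieldNormedType.Exports.

Local Open Scope classical_set_scope.
Local Open Scope ring_scope.
Local Open Scope complex_scope.

Section Functions.
Variable R : realType.

Definition e1 : R * R := (1, 0).
Definition e2 : R * R := (0, 1).

Definition has_continuous_partials (g : R * R -> R) :=
  forall v, v = e1 \/ v = e2 ->
    (forall x, derivable g x v) /\ continuous ('D_v g).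

Definition C2 (f : R * R -> R) :=
  [/\ continuous f, has_continuous_partials f,
      has_continuous_partials ('D_e1 f) & has_continuous_partials ('D_e2 f)].

Definition bounded_hessian (f : R * R -> R) :=
  exists M : R, forall v w x,
    v = e1 \/ v = e2 -> w = e1 \/ w = e2 -> `|'D_w ('D_v f) x| <= M.

Definition smooth (g : R -> R) :=
  forall (n : nat) (x : R), derivable (derive1n n g) x 1.

(* The third condition also gives the compactness of the support. *)
Definition cutoff (theta : R -> R) :=
  [/\ smooth theta,
      forall x, 0 <= theta x <= 1,
      forall x, 1 < `|x| -> theta x = 0
    & forall x, `|x| < 2^-1 -> theta x = 1].

(* cis x = e^{ix} *)
Definition cis (x : R) : R[i] := cos x +i* sin x.

Definition phase (s lambda : R) : R :=
  s ^+ 2 / 2 + lambda / 2 * ln `|s|.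

End Functions.

(* A finite-dimensional Hilbert space is a vectType over R[i] with a positive
   definite Hermitian form, linear in its first argument.  Such a space has no
   canonical topology in the library, so limits are taken in its norm. *)
Section Hilbert.
Variables (R : realType) (H : vectType R[i]) (dot : {dot H for conjC}).

Definition hnorm (v : H) : R := Num.sqrt (complex.Re (dot v v)).

Definition hnorm2 (v : H * H) : R :=
  Num.sqrt (hnorm v.1 ^+ 2 + hnorm v.2 ^+ 2).

Definition is_adjoint (G Gs : 'End(H)) :=
  forall u v, dot (G u) v = dot u (Gs v).

Definition orthoproj (U : {vspace H}) : 'End(H) := daddv_pi U (orthov dot U).

(* Functional calculus of a self-adjoint operator A, as the spectral sum of
   the g(x) P_x: the spectrum is real, hence the sum over real eigenvalues.
   The sum is finite because A has finitely many eigenvalues. *)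
Definition fcalc (g : R -> R[i]) (A : 'End(H)) : 'End(H) :=
  \sum_(x \in [set x : R | passmx.leigenvalue A x%:C])
     g x *: orthoproj (passmx.leigenspace A x%:C).

Definition fcalcR (g : R -> R) (A : 'End(H)) : 'End(H) :=
  fcalc (fun x => (g x)%:C) A.

(* e^{iA} for A self-adjoint *)
Definition expi (A : 'End(H)) : 'End(H) := fcalc (@cis R) A.

Definition H2continuous (u : R -> H * H) :=
  forall s, hnorm2 (u t - u s) @[t --> s] --> (0 : R).

(* d is the derivative of u at s *)
Definition H2derivative (u : R -> H * H) (s : R) (d : H * H) :=
  hnorm2 ((h^-1)%:C *: (u (s + h) - u s) - d) @[h --> 0^'] --> (0 : R).

Variables (G Gs : 'End(H)) (delta : R) (f1 f2 : R * R -> R).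

Definition nonlin (f : R * R -> R) (u : H * H) : R :=
  f (hnorm u.1 ^+ 2, hnorm u.2 ^+ 2).

Definition rhs (s : R) (u : H * H) : H * H :=
  (s%:C *: u.1 + G u.2 + (delta * nonlin f1 u)%:C *: u.1,
   Gs u.1 - s%:C *: u.2 + (delta * nonlin f2 u)%:C *: u.2).

Definition solution (u : R -> H * H) :=
  H2continuous u /\
  forall s, exists2 d, H2derivative u s d & - ('i%C : R[i]) *: d = rhs s (u s).

Definition Theta (theta : R -> R) (r : R) (w : H * H) : H * H :=
  (fcalcR theta ((r ^- 2)%:C *: (G \o Gs)%VF) w.1,
   fcalcR theta ((r ^- 2)%:C *: (Gs \o G)%VF) w.2).

Definition bigO_by (C s0 : R) (w : R -> H) (b : R -> R) :=
  forall s, s0 <= s -> hnorm (w s) <= C * `|b s|.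

Definition asymptotics (C s0 : R) (omega : H * H) (phi : R) (u : R -> H * H) :=
  bigO_by C s0
    (fun s => (u s).1 -
       expi ((delta * nonlin f1 omega * s)%:C *: \1%VF
             + fcalcR (phase s) (G \o Gs)%VF + phi%:C *: \1%VF) omega.1)
    (fun s => 1 / s) /\
  bigO_by C s0
    (fun s => (u s).2 -
       expi ((delta * nonlin f2 omega * s)%:C *: \1%VF
             - fcalcR (phase s) (Gs \o G)%VF - phi%:C *: \1%VF) omega.2)
    (fun s => 1 / s).

End Hilbert.

(* Main.v *)
(* Regard H as a real Euclidean space.  Put n = |u1|^2, <u1, G u2> = x + i y and
   a = 2 s + delta (F1 - F2); the equation gives n' = 2 y, x' = - a y,
   y' = a x + K.  Integrating by parts twice, n + 2 x / a is within O(s^-2) of a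
   constant, so delta (F(u) - F(omega)) is the derivative of an O(s^-2) function
   up to an O(s^-2) error.  The change of unknown w1 = u1 + a^-1 G u2,
   w2 = u2 - a^-1 G^* u1 removes the off-diagonal terms up to higher order and
   produces the logarithmic phase.
   Existence: solutions prescribed to second order at time T satisfy these
   bounds uniformly on [s0, T], and a cluster point as T -> +oo is the solution
   sought; phi = 0 works for every omega.
   Uniqueness: the same estimates, applied to the difference of two solutions,
   bound it by half of any of its bounds. *)
Require Import Defs.
From HB Require Import structures.
From mathcomp Require Import all_boot all_order all_algebra.
From mathcomp Require Import sesquilinear spectral.
From mathcomp Require Import all_classical all_reals all_analysis.
From mathcomp Require Import complex.
From mathcomp Require Import ring lra.

Set Implicit Arguments.
Unset Strict Implicit.
Unset Printing Implicit Defensive.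
Import Order.TTheory GRing.Theory Num.Theory Num.Def.
Import numFieldNormedType.Exports.
Local Open Scope classical_set_scope.
Local Open Scope ring_scope.

(** * Euclidean spaces and weak derivatives *)

(** [delta F(u)] acts as a frequency, so an error of order [1/s] in it is not integrable and could
    accumulate an unbounded phase. Yet [n - |omega_1|^2] is only [O(1/s)], with leading part
    [- 2 x / a]. The way out is that [x / a] is, up to [O(s^-2)], the derivative of [y / a^2]; the
    factor [1 + q J] below carries this primitive, with [q = 2 c y / a^2] and [c] the derivative of
    the nonlinearity at the end state. No residual phase is left over, which is why [phi] may be
    prescribed freely. The same obstacle shapes the data at time [T]: the profile itself as data
    would make [n + 2 x / a - |omega_1|^2] of size [1/T], an offset which, integrated over [[s, T]],
    gives a phase error that does not become small. Hence data correct to second order. Conservation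
    of the norm makes both nonlinearities functions of [n] alone. The second component is the first
    with [G] and [G^*] exchanged, the sign of [s] reversed and the nonlinearity read at [1 - n], so
    only one component is estimated. *)

Section ScalarRules.
Variable R : realType.
Implicit Types (f g : R -> R) (x : R).

Lemma der_eq f x df df' : is_derive x 1 f df -> df = df' -> is_derive x 1 f df'.
Proof. by move=> ? <-. Qed.

Lemma der_cst (c : R) x : is_derive x 1 (fun=> c) 0.
Proof. exact: is_derive_cst. Qed.

Lemma der_id x : is_derive x 1 (fun t : R => t) 1.
Proof. exact: is_derive_id. Qed.

Lemma derD f g x df dg : is_derive x 1 f df -> is_derive x 1 g dg ->
  is_derive x 1 (fun t => f t + g t) (df + dg).
Proof. by move=> hf hg; exact: is_deriveD. Qed.

Lemma derN f x df : is_derive x 1 f df -> is_derive x 1 (fun t => - f t) (- df).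
Proof. by move=> hf; exact: is_deriveN. Qed.

Lemma derB f g x df dg : is_derive x 1 f df -> is_derive x 1 g dg ->
  is_derive x 1 (fun t => f t - g t) (df - dg).
Proof. by move=> hf hg; exact: is_deriveB. Qed.

Lemma derM f g x df dg : is_derive x 1 f df -> is_derive x 1 g dg ->
  is_derive x 1 (fun t => f t * g t) (df * g x + f x * dg).
Proof.
move=> hf hg; apply: (der_eq (is_deriveM hf hg)).
by rewrite /GRing.scale /=; ring.
Qed.

Lemma derZ (k : R) f x df : is_derive x 1 f df ->
  is_derive x 1 (fun t => k * f t) (k * df).
Proof. by move=> hf; exact: (@is_deriveZ _ _ _ f k x 1 df). Qed.

Lemma derV f x df : f x != 0 -> is_derive x 1 f df ->
  is_derive x 1 (fun t => (f t)^-1) (- (f x) ^- 2 * df).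
Proof. by move=> fx hf; exact: is_deriveV. Qed.

Lemma derX f n x df : is_derive x 1 f df ->
  is_derive x 1 (fun t => f t ^+ n) (n%:R * f x ^+ n.-1 * df).
Proof.
move=> hf; rewrite (_ : (fun t => _) = f ^+ n); first exact: is_deriveX.
by apply/funext => t; rewrite exprfctE.
Qed.

End ScalarRules.

(* A finite Parseval frame is all that is used of an orthonormal basis. *)
Record euclid (R : realType) (V : lmodType R) := Euclid {
  ip : V -> V -> R;
  ipC : forall u v, ip u v = ip v u;
  ip_linear : forall a u v w, ip (a *: u + v) w = a * ip u w + ip v w;
  frame_index : finType;
  frame : frame_index -> V;
  frame_sum : forall u, u = \sum_k ip u (frame k) *: frame k }.

Arguments ip {R V} e.
Arguments frame {R V} e.

Section EuclidTheory.
Variables (R : realType) (V : lmodType R) (E : euclid V).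
Local Notation ip := (ip E).
Implicit Types u v w e : V.

Lemma ipDl u v w : ip (u + v) w = ip u w + ip v w.
Proof. by have := ip_linear E 1 u v w; rewrite scale1r mul1r. Qed.

Lemma ip0l v : ip 0 v = 0.
Proof. by apply: (@addrI _ (ip 0 v)); rewrite -ipDl !addr0. Qed.

Lemma ipZl a u w : ip (a *: u) w = a * ip u w.
Proof. by have := ip_linear E a u 0 w; rewrite ip0l !addr0. Qed.

Lemma ipNl u w : ip (- u) w = - ip u w.
Proof. by rewrite -scaleN1r ipZl mulN1r. Qed.

Lemma ipBl u v w : ip (u - v) w = ip u w - ip v w.
Proof. by rewrite ipDl ipNl. Qed.

Lemma ipDr u v w : ip w (u + v) = ip w u + ip w v.
Proof. by rewrite !(ipC E w) ipDl. Qed.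

Lemma ip0r v : ip v 0 = 0.
Proof. by rewrite ipC ip0l. Qed.

Lemma ipZr a u w : ip w (a *: u) = a * ip w u.
Proof. by rewrite !(ipC E w) ipZl. Qed.

Lemma ipNr u w : ip w (- u) = - ip w u.
Proof. by rewrite !(ipC E w) ipNl. Qed.

Lemma ipBr u v w : ip w (u - v) = ip w u - ip w v.
Proof. by rewrite ipDr ipNr. Qed.

Lemma ip_suml (I : finType) (F : I -> V) w :
  ip (\sum_i F i) w = \sum_i ip (F i) w.
Proof.
by apply: (big_morph (fun u => ip u w)) => [u v|]; rewrite ?ipDl ?ip0l.
Qed.

Lemma ip_frame u v : ip u v = \sum_k ip u (frame E k) * ip v (frame E k).
Proof.
rewrite {1}(frame_sum E u) ip_suml; apply: eq_bigr => k _.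
by rewrite ipZl (ipC E v).
Qed.

Lemma ip_ge0 u : 0 <= ip u u.
Proof. by rewrite ip_frame sumr_ge0 // => k _; rewrite -expr2 sqr_ge0. Qed.

Lemma ip_eq0 u : ip u u = 0 -> u = 0.
Proof.
rewrite ip_frame => /psumr_eq0P u0; rewrite (frame_sum E u) big1 // => k _.
have /eqP := u0 (fun i _ => sqr_ge0 (ip u (frame E i))) k isT.
by rewrite mulf_eq0 orbb => /eqP ->; rewrite scale0r.
Qed.

Definition nrm u := Num.sqrt (ip u u).

Lemma nrm_ge0 u : 0 <= nrm u. Proof. exact: sqrtr_ge0. Qed.

Lemma sqr_nrm u : nrm u ^+ 2 = ip u u.
Proof. by rewrite sqr_sqrtr // ip_ge0. Qed.

Lemma nrm0 : nrm 0 = 0. Proof. by rewrite /nrm ip0l sqrtr0. Qed.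

Lemma nrm_eq0 u : nrm u = 0 -> u = 0.
Proof. by move=> u0; apply: ip_eq0; rewrite -sqr_nrm u0 expr0n. Qed.

Lemma nrmN u : nrm (- u) = nrm u.
Proof. by rewrite /nrm ipNl ipNr opprK. Qed.

Lemma nrmZ a u : nrm (a *: u) = `|a| * nrm u.
Proof. by rewrite /nrm ipZl ipZr mulrA -expr2 sqrtrM ?sqr_ge0 // sqrtr_sqr. Qed.

Lemma nrm_distC u v : nrm (u - v) = nrm (v - u).
Proof. by rewrite -nrmN opprB. Qed.

Lemma cauchy_schwarz u v : `|ip u v| <= nrm u * nrm v.
Proof.
rewrite -(ler_pXn2r (ltn0Sn 1)) ?nnegrE ?mulr_ge0 ?nrm_ge0 //.
rewrite exprMn !sqr_nrm real_normK ?num_real //.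
have [/ip_eq0 ->|v0] := eqVneq (ip v v) 0; first by rewrite !ip0r expr0n mulr0.
have vp : 0 < ip v v by rewrite lt0r v0 ip_ge0.
have := ip_ge0 (ip v v *: u - ip u v *: v).
rewrite ipBl !ipBr !ipZl !ipZr (ipC E v u) => le0.
have : 0 <= ip v v * (ip u u * ip v v - ip u v ^+ 2).
  by apply: le_trans le0 _; rewrite le_eqVlt; apply/orP; left; apply/eqP; ring.
by rewrite pmulr_rge0 // subr_ge0.
Qed.

Lemma ip_le u v : ip u v <= nrm u * nrm v.
Proof. exact: le_trans (ler_norm _) (cauchy_schwarz u v). Qed.

Lemma nrmD u v : nrm (u + v) <= nrm u + nrm v.
Proof.
rewrite -(ler_pXn2r (ltn0Sn 1)) ?nnegrE ?addr_ge0 ?nrm_ge0 //.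
rewrite sqr_nrm ipDl !ipDr sqrrD !sqr_nrm (ipC E v u).
by have := ip_le u v; lra.
Qed.

Lemma nrmB u v : nrm (u - v) <= nrm u + nrm v.
Proof. by rewrite -(nrmN v) nrmD. Qed.

Lemma nrm_dist u v : `|nrm u - nrm v| <= nrm (u - v).
Proof.
have := nrmD (u - v) v; have := nrmD (v - u) u; rewrite !subrK (nrm_distC v).
by move=> h1 h2; rewrite ler_norml; apply/andP; split; lra.
Qed.

Lemma nrm_sum (I : finType) (F : I -> V) : nrm (\sum_i F i) <= \sum_i nrm (F i).
Proof.
by elim/big_rec2: _ => [|i y x _ h]; rewrite ?nrm0 // (le_trans (nrmD _ _)) // lerD2l.
Qed.

Lemma nrm_le_frame u : nrm u <= \sum_k `|ip u (frame E k)| * nrm (frame E k).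
Proof.
rewrite {1}(frame_sum E u) (le_trans (nrm_sum _)) //.
by apply: ler_sum => k _; rewrite nrmZ.
Qed.

Lemma nrm_le1 v : ip v v <= 1 -> nrm v <= 1.
Proof.
by move=> v1; rewrite -(ler_pXn2r (ltn0Sn 1)) ?nnegrE ?nrm_ge0 // sqr_nrm expr1n.
Qed.

Lemma ip_inj u v : (forall e, ip u e = ip v e) -> u = v.
Proof.
move=> uv; apply/eqP; rewrite -subr_eq0; apply/eqP/ip_eq0.
by rewrite ipBl uv subrr.
Qed.

Lemma ip_sub_sqr u v : ip u u - ip v v = ip (u - v) (u + v).
Proof. by rewrite ipBl !ipDr (ipC E v u); ring. Qed.

(* Differentiability tested against fixed vectors: product rules and the mean
   value theorem then reduce to the scalar ones. *)
Definition wder (w : R -> V) (s : R) d :=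
  forall e, is_derive s 1 (fun t => ip (w t) e) (ip d e).

Lemma wder_eq (w : R -> V) s d d' : wder w s d -> d = d' -> wder w s d'.
Proof. by move=> ? <-. Qed.

Lemma wder_cst v s : wder (fun=> v) s 0.
Proof. by move=> e; rewrite ip0l; exact: is_derive_cst. Qed.

Lemma wderD (w v : R -> V) s d d' :
  wder w s d -> wder v s d' -> wder (fun t => w t + v t) s (d + d').
Proof.
move=> hw hv e; under eq_fun do rewrite ipDl.
by rewrite ipDl; apply: derD.
Qed.

Lemma wderN (w : R -> V) s d : wder w s d -> wder (fun t => - w t) s (- d).
Proof.
move=> hw e; under eq_fun do rewrite ipNl.
by rewrite ipNl; apply: derN.
Qed.

Lemma wderB (w v : R -> V) s d d' :
  wder w s d -> wder v s d' -> wder (fun t => w t - v t) s (d - d').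
Proof. by move=> hw hv; apply: wderD => //; exact: wderN. Qed.

Lemma wderZ (f : R -> R) df (w : R -> V) (s : R) d : is_derive s 1 f df -> wder w s d ->
  wder (fun t => f t *: w t) s (f s *: d + df *: w s).
Proof.
move=> hf hw e; under eq_fun do rewrite ipZl.
have := hw e => hwe.
apply: (der_eq (derM hf hwe)).
by rewrite ipDl !ipZl addrC.
Qed.

Lemma is_derive_fsum (I : finType) (h : I -> R -> R) (s : R) (dh : I -> R) :
  (forall i, is_derive s 1 (h i) (dh i)) ->
  is_derive s 1 (fun t => \sum_i h i t) (\sum_i dh i).
Proof.
move=> hd; rewrite (_ : (fun t => _) = \sum_(i < #|I|) (h (enum_val i))).
  have -> : \sum_i dh i = \sum_(i < #|I|) dh (enum_val i) by rewrite big_enum_val.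
  by apply: is_derive_sum => i.
by apply/funext => t; rewrite fct_sumE big_enum_val.
Qed.

Lemma is_derive_ip (w v : R -> V) s d d' : wder w s d -> wder v s d' ->
  is_derive s 1 (fun t => ip (w t) (v t)) (ip d (v s) + ip (w s) d').
Proof.
move=> hw hv; under eq_fun do rewrite ip_frame.
rewrite (ip_frame d) (ip_frame (w s)) -big_split /=.
apply: is_derive_fsum => k; have hwk := hw (frame E k); have hvk := hv (frame E k).
exact: derM.
Qed.

End EuclidTheory.

Section WderLinear.
Variables (R : realType) (V W : lmodType R) (E : euclid V) (F : euclid W).

(** The adjoint moves [L] onto the test vector, so weak derivatives pass through [L] with no
    continuity argument. *)
Lemma wder_adj (L : V -> W) (L' : W -> V) w s d :
  (forall u v, ip F (L u) v = ip E u (L' v)) ->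
  wder E w s d -> wder F (fun t => L (w t)) s (L d).
Proof. by move=> adj hw e; under eq_fun do rewrite adj; rewrite adj. Qed.

Lemma linear_bounded (L : {linear V -> W}) :
  exists2 C, 0 <= C & forall u, nrm F (L u) <= C * nrm E u.
Proof.
exists (\sum_k nrm E (frame E k) * nrm F (L (frame E k))).
  by apply: sumr_ge0 => k _; rewrite mulr_ge0 ?nrm_ge0.
move=> u; rewrite {1}(frame_sum E u) linear_sum (le_trans (nrm_sum _ _)) //.
rewrite mulr_suml; apply: ler_sum => k _; rewrite linearZ nrmZ mulrC.
by rewrite mulrAC [leRHS]mulrC ler_wpM2l ?nrm_ge0 // mulrC cauchy_schwarz.
Qed.

End WderLinear.

(** * Mean value inequalities and a Gronwall bound for skew equations *)

Section MeanValue.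
Variable R : realType.
Implicit Types f g : R -> R.

Lemma mvt_le0 f f' (a b : R) : a <= b ->
  (forall x, a <= x <= b -> is_derive x 1 f (f' x)) ->
  (forall x, a <= x <= b -> 0 <= f' x) -> f a <= f b.
Proof.
move=> ab hf hf'.
have [||c cab] := @MVT_segment R f f' a b ab.
- move=> x; rewrite in_itv /= => /andP[/ltW ax /ltW xb]; apply: hf; exact/andP.
- apply: derivable_within_continuous => x; rewrite in_itv /= => xab.
  by have [] := hf x xab.
move/eqP; rewrite subr_eq => /eqP ->; rewrite lerDr mulr_ge0 ?subr_ge0 //.
by apply: hf'; move: cab; rewrite in_itv.
Qed.

Lemma mvt_le f f' g g' (a b : R) : a <= b ->
  (forall x, a <= x <= b -> is_derive x 1 f (f' x)) ->
  (forall x, a <= x <= b -> is_derive x 1 g (g' x)) ->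
  (forall x, a <= x <= b -> `|f' x| <= g' x) ->
  `|f b - f a| <= g b - g a.
Proof.
move=> ab hf hg fg; have hD : g a + f a <= g b + f b.
  apply: (@mvt_le0 (fun x => g x + f x) (fun x => g' x + f' x) a b ab) => x xab.
    by apply: derD; [exact: hg|exact: hf].
  by have := fg x xab; rewrite ler_norml => /andP[]; lra.
have hB : g a - f a <= g b - f b.
  apply: (@mvt_le0 (fun x => g x - f x) (fun x => g' x - f' x) a b ab) => x xab.
    by apply: derB; [exact: hg|exact: hf].
  by have := fg x xab; rewrite ler_norml => /andP[]; lra.
by rewrite ler_norml; apply/andP; split; lra.
Qed.

Variables (V : lmodType R) (E : euclid V).

(** Testing against the increment [e] reduces to the scalar [mvt_le] multiplied by the norm of [e],
    which is then divided out. When [e = 0] only the monotonicity of [g] is left, and [g'] is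
    nonnegative because it bounds a norm. *)
Lemma mvt_nrm (w w' : R -> V) g g' (a b : R) : a <= b ->
  (forall x, a <= x <= b -> wder E w x (w' x)) ->
  (forall x, a <= x <= b -> is_derive x 1 g (g' x)) ->
  (forall x, a <= x <= b -> nrm E (w' x) <= g' x) ->
  nrm E (w b - w a) <= g b - g a.
Proof.
move=> ab hw hg wg; set e := w b - w a.
have : `|ip E (w b) e - ip E (w a) e| <= nrm E e * g b - nrm E e * g a.
  apply: (@mvt_le (fun t => ip E (w t) e) (fun t => ip E (w' t) e)
    (fun t => nrm E e * g t) (fun t => nrm E e * g' t)) => // x xab.
  - exact: hw.
  - by apply: derZ; exact: hg.
  - by rewrite (le_trans (cauchy_schwarz _ _ _)) // mulrC ler_wpM2l ?nrm_ge0 ?wg.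
rewrite -ipBl -/e -mulrBr -sqr_nrm ger0_norm ?sqr_ge0 //.
have [e0|e0] := eqVneq (nrm E e) 0.
  rewrite e0 => _; rewrite subr_ge0; apply: (@mvt_le0 g g') => // x xab.
  exact: le_trans (nrm_ge0 _ _) (wg x xab).
by rewrite expr2 ler_pM2l // lt0r e0 nrm_ge0.
Qed.

(* At a maximum point of |w| the bound D^2 <= |w b|^2 + 2 D (g b - g a) can be
   divided by D. *)
Lemma skew_gronwall (S : R -> V -> V) (w r : R -> V) g g' (a b : R) : a <= b ->
  (forall x, a <= x <= b -> wder E w x (S x (w x) + r x)) ->
  (forall x, ip E (w x) (S x (w x)) = 0) ->
  (forall x, a <= x <= b -> is_derive x 1 g (g' x)) ->
  (forall x, a <= x <= b -> nrm E (r x) <= g' x) ->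
  forall x, a <= x <= b -> nrm E (w x) <= nrm E (w b) + 2 * (g b - g a).
Proof.
move=> ab hw skew hg rg.
(* Skewness removes [S] from the derivative of the squared norm; only the source [r] is left. *)
have dq x : a <= x <= b ->
    is_derive x 1 (fun t => ip E (w t) (w t)) (2 * ip E (w x) (r x)).
  move=> xab; apply: (der_eq (is_derive_ip (hw x xab) (hw x xab))).
  by rewrite ipDl !ipDr (ipC E _ (w x)) skew (ipC E (r x)); ring.
have [|c cab cmax] := @EVT_max R (fun t => ip E (w t) (w t)) a b ab.
  apply: derivable_within_continuous => x; rewrite in_itv /= => xab.
  by have [] := dq x xab.
rewrite in_itv /= in cab; have [ac cb] := andP cab.
have cmax' x : a <= x <= b -> nrm E (w x) <= nrm E (w c).
  by move=> xab; rewrite ler_wsqrtr // cmax // in_itv.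
have gm x y : a <= x -> x <= y -> y <= b -> g x <= g y.
  move=> ax xy yb; apply: (@mvt_le0 g g') => // t /andP[xt ty].
    by apply: hg; rewrite (le_trans ax xt) (le_trans ty yb).
  have tab : a <= t <= b by rewrite (le_trans ax xt) (le_trans ty yb).
  exact: le_trans (nrm_ge0 _ _) (rg t tab).
suff hc : nrm E (w c) <= nrm E (w b) + 2 * (g b - g a).
  by move=> x xab; exact: le_trans (cmax' x xab) hc.
set D := nrm E (w c).
have : `|ip E (w b) (w b) - ip E (w c) (w c)| <= 2 * D * g b - 2 * D * g c.
  apply: (@mvt_le (fun t => ip E (w t) (w t)) (fun t => 2 * ip E (w t) (r t))
     (fun t => 2 * D * g t) (fun t => 2 * D * g' t) c b) => // x /andP[cx xb];
   have xab : a <= x <= b by rewrite (le_trans ac cx).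
  - exact: dq.
  - by apply: derZ; exact: hg.
  rewrite normrM ger0_norm // -mulrA ler_wpM2l //.
  rewrite (le_trans (cauchy_schwarz _ _ _)) // ler_pM ?nrm_ge0 //.
    exact: cmax'.
  exact: rg.
rewrite -!sqr_nrm -/D ler_norml => /andP[h _].
have gac := gm a c (lexx a) ac cb; have gcb := gm c b ac cb (lexx b).
have D0 : 0 <= D := nrm_ge0 _ _; have q0 := nrm_ge0 E (w b).
rewrite leNgt; apply/negP => lt; nra.
Qed.

End MeanValue.

(** * Antiderivatives and ordinary differential equations *)

Section Antiderivative.
Variables (R : realType) (g : R -> R) (cg : continuous g).

Let primitive (a x : R) : R := (\int[lebesgue_measure]_(t in `[a, x]) g t)%R.

Let primitive_der (a x : R) : a < x -> is_derive x 1 (primitive a) (g x).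
Proof.
move=> ax.
have xu : x < x + 1 by rewrite ltrDl.
have ig : (@lebesgue_measure R).-integrable `[a, x + 1] (EFin \o g).
  apply: continuous_compact_integrable; first exact: segment_compact.
  by apply: continuous_subspaceT => t; exact: cg.
have [dF F'] := continuous_FTC1_closed xu ig ax (@cg x).
by split; [exact: dF|rewrite -F' derive1E].
Qed.

(** An integral from [a] is an antiderivative only to the right of [a]. Normalized at 0, two such
    integrals agree to the right of both base points, so the base point may move left with [y] and
    can be frozen near each point. *)
Lemma antiderivative : exists F : R -> R, forall x : R, is_derive x 1 F (g x).
Proof.
pose G (a y : R) := primitive a y - primitive a 0.
have dG (a y : R) : a < y -> is_derive y 1 (G a) (g y).
  move=> ay; exact: (der_eq (derB (primitive_der ay) (der_cst _ _)) (subr0 _)).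
have GG (a b y : R) : a < y -> b < y -> a < 0 -> b < 0 -> G a y = G b y.
  move=> ay bY a0 b0; apply/eqP; rewrite -subr_eq0.
  have d (t : R) : a < t -> b < t -> is_derive t 1 (fun u => G a u - G b u) 0.
    by move=> at_ bt; rewrite -(subrr (g t)); apply: derB; apply: dG.
  have d0 (t : R) : is_derive t 1 (cst 0 : R -> R) 0 by exact: der_cst.
  have G0 c : G c 0 = 0 by rewrite /G subrr.
  have [y0|y0] := leP 0 y.
    have := @mvt_le R (fun u => G a u - G b u) (cst 0) (cst 0) (cst 0) 0 y y0.
    rewrite !G0 !subr0 normr_le0; apply => //= t /andP[t0 _].
      by apply: d; [exact: lt_le_trans t0|exact: lt_le_trans t0].
    by rewrite normr0.
  have := @mvt_le R (fun u => G a u - G b u) (cst 0) (cst 0) (cst 0) y 0 (ltW y0).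
  rewrite !G0 !subr0 sub0r normrN normr_le0; apply => //= t /andP[t0 _].
    by apply: d; [exact: lt_le_trans t0|exact: lt_le_trans t0].
  by rewrite normr0.
exists (fun y => G (- (`|y| + 1)) y) => x.
have lo (y : R) : - (`|y| + 1) < y.
  by have := ler_norm (- y); rewrite normrN; lra.
have neg (y : R) : - (`|y| + 1) < 0 by have := normr_ge0 y; lra.
have xx : - (`|x| + 2) < x by have := lo x; lra.
apply: near_eq_is_derive (dG _ x xx).
near=> y; apply: GG => //; near: y; exact: lt_nbhsr.
Unshelve. all: by end_near. Qed.

End Antiderivative.

Section RealSequences.
Variable R : realType.

(** The intervals of radius [2 C 2^-k] around [x k] are nested, since a step of [C 2^-k] is exactly
    the loss of radius; the supremum of their left ends lies in all of them. *)
Lemma geometric_limit (x : nat -> R) (C : R) :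
  (forall k, `|x k.+1 - x k| <= C * 2 ^- k) ->
  exists l, forall k, `|l - x k| <= 2 * C * 2 ^- k.
Proof.
move=> xC.
have C0 : 0 <= C by have := xC 0%N; rewrite expr0 invr1 mulr1; apply: le_trans.
pose a k := x k - 2 * C * 2 ^- k; pose b k := x k + 2 * C * 2 ^- k.
have half k : 2 ^- k.+1 = 2 ^- k / 2 :> R.
  by rewrite exprS invfM mulrC.
have aS k : a k <= a k.+1.
  by have := xC k; rewrite ler_norml /a half => /andP[]; lra.
have bS k : b k.+1 <= b k.
  by have := xC k; rewrite ler_norml /b half => /andP[]; lra.
have a_mono : {homo a : m n / (m <= n)%N >-> m <= n} by apply: homo_leq => // ? ? ?; exact: le_trans.
have b_mono m n : (m <= n)%N -> b n <= b m.
  elim: n => [|n IH]; first by rewrite leqn0 => /eqP ->.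
  rewrite leq_eqVlt => /orP[/eqP -> //|]; rewrite ltnS => /IH; exact: le_trans.
have ab m n : a m <= b n.
  apply: (le_trans (a_mono _ _ (leq_maxl m n))).
  apply: le_trans (b_mono _ _ (leq_maxr m n)).
  have : 0 <= 2 * C * 2 ^- maxn m n by rewrite !mulr_ge0 // invr_ge0 exprn_ge0.
  by rewrite /a /b; lra.
have supA : has_sup (range a).
  split; first by exists (a 0%N), 0%N.
  by exists (b 0%N) => _ [m _ <-]; exact: ab.
exists (sup (range a)) => k; rewrite ler_distl; apply/andP; split.
  by apply: ub_le_sup; [exact: supA.2|exists k].
by apply: ge_sup => [|_ [m _ <-]]; [exact: supA.1|exact: ab].
Qed.

Lemma le_half_pow (x C : R) : (forall k, x <= C * 2 ^- k) -> x <= 0.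
Proof.
move=> xC; rewrite leNgt; apply/negP => x0.
have C0 : 0 <= C.
  by have := xC 0%N; rewrite expr0 invr1 mulr1; apply/le_trans/ltW.
have [k kC] : exists k : nat, C / x < k%:R.
  by exists (Num.truncn (C / x)).+1; rewrite truncnS_gt.
have := xC k; apply/negP; rewrite -ltNge ltr_pdivrMr ?exprn_gt0 //.
move: kC; rewrite ltr_pdivrMr // mulrC => /lt_le_trans; apply.
apply: ler_wpM2l; first exact: ltW.
by rewrite -natrX ler_nat; exact/ltnW/ltn_expl.
Qed.

End RealSequences.

Section Picard.
Variables (R : realType) (V : lmodType R) (E : euclid V).

Definition wcont (w : R -> V) := forall e, continuous (fun t => ip E (w t) e).

Lemma wder_cont (w w' : R -> V) : (forall t, wder E w t (w' t)) -> wcont w.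
Proof.
move=> hw e t; apply: differentiable_continuous.
by apply/derivable1_diffP; have [] := hw t e.
Qed.

Lemma vector_antiderivative (w : R -> V) t0 u0 : wcont w ->
  exists W : R -> V, (forall t, wder E W t (w t)) /\ W t0 = u0.
Proof.
move=> cw.
have hF k := antiderivative (cw (frame E k)).
have [F dF] : exists F : frame_index E -> R -> R,
    forall k t, is_derive (t : R) 1 (F k) (ip E (w t) (frame E k)).
  exists (fun k => projT1 (cid (hF k))) => k; exact: (projT2 (cid (hF k))).
exists (fun t => u0 + \sum_k (F k t - F k t0) *: frame E k); split; last first.
  by rewrite big1 ?addr0 // => k _; rewrite subrr scale0r.
move=> t; apply: wder_eq (add0r _); apply: wderD; first exact: wder_cst.
move=> e; under eq_fun do rewrite ip_suml.
rewrite ip_frame; apply: is_derive_fsum => k; under eq_fun do rewrite ipZl.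
apply: (der_eq (derM (derB (dF k t) (der_cst _ _)) (der_cst _ _))).
by rewrite subr0 mulr0 addr0 (ipC E e).
Qed.

Variables (f : R -> V -> V) (t0 : R) (u0 : V) (l l' : R -> R) (K : R).
Hypothesis dl : forall t : R, is_derive t 1 l (l' t).
Hypothesis l0 : l t0 = 0.
Hypothesis l'0 : forall t, 0 <= l' t.
Hypothesis f_lip : forall t u v,
  nrm E (f t u - f t v) <= l' t * nrm E (u - v).
Hypothesis f_bnd : forall t, nrm E (f t u0) <= K * l' t.
Hypothesis f_cont : forall w, wcont w -> wcont (fun t => f t (w t)).
Hypothesis K0 : 0 <= K.

(** A Bielecki weight: in the supremum norm divided by it the Picard map contracts with ratio 1/2 on
    the whole line, so no local solutions have to be glued. The sum of two exponentials is a smooth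
    substitute for [exp (2 |l t|)]. *)
Let wt t := expR (2 * l t) + expR (- (2 * l t)).

Let wt1 t : 1 <= wt t.
Proof.
have := expR_ge1Dx (2 * l t); have := expR_ge1Dx (- (2 * l t)).
have := expR_ge0 (2 * l t); have := expR_ge0 (- (2 * l t)); rewrite /wt.
by have [?|?] := leP 0 (2 * l t); lra.
Qed.

(* The weight [wt] dominates its own primitive on both sides of [t0]. *)
Let increment (w w' : R -> V) (c t : R) : 0 <= c -> w t0 = 0 ->
  (forall s, wder E w s (w' s)) ->
  (forall s, nrm E (w' s) <= c * (l' s * wt s)) -> nrm E (w t) <= c / 2 * wt t.
Proof.
move=> c0 w0 dw wc.
pose g s := c / 2 * (expR (2 * l s) - expR (- (2 * l s))).
have dg (s : R) : is_derive s 1 g (c * (l' s * wt s)).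
  have d2 : is_derive s 1 (fun s => 2 * l s) (2 * l' s) by exact: derZ.
  apply: (der_eq (derZ (c / 2) (derB (is_derive1_comp (is_derive_expR _) d2)
           (is_derive1_comp (is_derive_expR _) (derN d2))))).
  by rewrite /wt /=; field.
have g0 : g t0 = 0 by rewrite /g l0 mulr0 oppr0 subrr mulr0.
have e1 := expR_ge0 (2 * l t); have e2 := expR_ge0 (- (2 * l t)).
have [tt|/ltW tt] := leP t0 t.
  have := mvt_nrm tt (fun s _ => dw s) (fun s _ => dg s) (fun s _ => wc s).
  by rewrite w0 g0 !subr0 => /le_trans; apply; rewrite ler_wpM2l ?divr_ge0 // /wt; lra.
have := mvt_nrm tt (fun s _ => dw s) (fun s _ => dg s) (fun s _ => wc s).
rewrite w0 g0 !sub0r nrmN -mulrN => /le_trans; apply.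
by rewrite ler_wpM2l ?divr_ge0 // /wt; lra.
Qed.

Lemma picard_lindelof :
  exists u : R -> V, (forall t, wder E u t (f t (u t))) /\ u t0 = u0.
Proof.
(* [anti] is total: on a function that is not weakly continuous its value is arbitrary. *)
have [anti antiP] : exists anti : (R -> V) -> R -> V, forall w, wcont w ->
    (forall t, wder E (anti w) t (w t)) /\ anti w t0 = u0.
  have h (w : R -> V) : exists W : R -> V,
      wcont w -> (forall t, wder E W t (w t)) /\ W t0 = u0.
    have [cw|ncw] := pselect (wcont w); last by exists w.
    by have [W hW] := vector_antiderivative t0 u0 cw; exists W.
  by exists (fun w => projT1 (cid (h w))) => w; exact: (projT2 (cid (h w))).
pose it := fix it k := if k is k'.+1 then anti (fun t => f t (it k' t)) else fun=> u0.
have it_cont k : wcont (it k).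
  elim: k => [|k IH] /=; first by move=> e t; exact: cvg_cst.
  by have [d _] := antiP _ (f_cont IH); exact: wder_cont d.
have it_der k t : wder E (it k.+1) t (f t (it k t)).
  by have [] := antiP _ (f_cont (it_cont k)).
have it0 k : it k t0 = u0.
  by case: k => [//|k]; have [] := antiP _ (f_cont (it_cont k)).
have step k t : nrm E (it k.+1 t - it k t) <= K * 2 ^- k * wt t.
  elim: k t => [|k IH] t.
    have := @increment (fun t => it 1%N t - it 0%N t) (fun t => f t (it 0%N t) - 0) K t K0.
    rewrite (it0 1%N) (it0 0%N) subrr => /(_ erefl) h.
    apply: (le_trans (h _ _)).
    - by move=> s; apply: wderB; [exact: it_der|exact: wder_cst].
    - move=> s; rewrite subr0 (le_trans (f_bnd s)) // ler_wpM2l //.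
      by rewrite ler_peMr.
    - rewrite expr0 invr1 mulr1 ler_wpM2r ?ler_pdivrMr ?ler_peMr //; last lra.
      exact: le_trans (wt1 t).
  have c0 : 0 <= K * 2 ^- k by rewrite mulr_ge0.
  have := @increment (fun t => it k.+2 t - it k.+1 t)
     (fun t => f t (it k.+1 t) - f t (it k t)) (K * 2 ^- k) t c0.
  rewrite (it0 k.+2) (it0 k.+1) subrr exprSr invfM mulrA; apply=> // s.
    by apply: wderB; exact: it_der.
  rewrite (le_trans (f_lip _ _ _)) // mulrCA ler_wpM2l //; exact: IH.
(* Each frame coordinate of the iterates converges geometrically; [K'] sums the errors over the
   frame. *)
pose K' := \sum_k (2 * (K * nrm E (frame E k))) * nrm E (frame E k).
have K'0 : 0 <= K' by apply: sumr_ge0 => k _; rewrite !mulr_ge0 ?nrm_ge0.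
have [u uP] : exists u : R -> V, forall t k, nrm E (u t - it k t) <= K' * 2 ^- k * wt t.
  have h t j : exists x, forall k,
      `|x - ip E (it k t) (frame E j)| <= 2 * (K * nrm E (frame E j) * wt t) * 2 ^- k.
    apply: geometric_limit => k; rewrite -ipBl (le_trans (cauchy_schwarz _ _ _)) //.
    rewrite (le_trans (ler_wpM2r (nrm_ge0 _ _) (step k t))) //.
    by rewrite le_eqVlt; apply/orP; left; apply/eqP; ring.
  pose x t j := projT1 (cid (h t j)).
  have xP t j := projT2 (cid (h t j)).
  exists (fun t => \sum_j x t j *: frame E j) => t k.
  rewrite [X in _ - X](frame_sum E) -sumrB (le_trans (nrm_sum _ _)) //.
  rewrite /K' !mulr_suml; apply: ler_sum => j _.
  rewrite -scalerBl nrmZ (le_trans (ler_wpM2r (nrm_ge0 _ _) (xP t j k))) //.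
  by rewrite le_eqVlt; apply/orP; left; apply/eqP; ring.
have cwt : continuous wt.
  move=> t; apply: differentiable_continuous; apply/derivable1_diffP.
  have d2 : is_derive t 1 (fun s => 2 * l s) (2 * l' t) by exact: derZ.
  by have [] := derD (is_derive1_comp (is_derive_expR _) d2)
           (is_derive1_comp (is_derive_expR _) (derN d2)).
have u_cont : wcont u.
  move=> e s; apply/cvgrPdist_le => /= eps eps0.
  have [k hk] : exists k : nat, K' * 2 ^- k * (2 * wt s + 1) * nrm E e <= eps / 2.
    apply: contrapT => /forallNP h.
    have : eps / 2 <= 0.
      apply: (@le_half_pow R _ (K' * (2 * wt s + 1) * nrm E e)) => k.
      have /negP := h k; rewrite -ltNge => /ltW /le_trans; apply.
      by rewrite le_eqVlt; apply/orP; left; apply/eqP; ring.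
    by apply/negP; rewrite -ltNge divr_gt0.
  have eps2 : 0 < eps / 2 by rewrite divr_gt0.
  near=> t.
  have h1 : `|ip E (it k s) e - ip E (it k t) e| <= eps / 2.
    by near: t; have /cvgrPdist_le := it_cont k e s; apply.
  have h2 : wt t <= wt s + 1.
    have : `|wt s - wt t| <= 1 by near: t; have /cvgrPdist_le := cwt s; apply.
    by rewrite ler_norml => /andP[]; lra.
  have -> : ip E (u s) e - ip E (u t) e = (ip E (it k s) e - ip E (it k t) e)
     + ip E ((u s - it k s) - (u t - it k t)) e by rewrite !ipBl; ring.
  rewrite (le_trans (ler_normD _ _)) // [leRHS]splitr lerD //.
  apply: le_trans hk; rewrite (le_trans (cauchy_schwarz _ _ _)) //.
  rewrite ler_wpM2r ?nrm_ge0 // (le_trans (nrmB _ _ _)) //.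
  rewrite (le_trans (lerD (uP s k) (uP t k))) // -mulrDr ler_wpM2l ?mulr_ge0 //; lra.
(* [v] is the Picard image of the limit [u]. Both stay within a multiple of [2^-k] of the iterate
   [k.+1], so they coincide and [v] solves the equation. *)
have [du ut0] := antiP _ (f_cont u_cont).
set v := anti _ in du ut0; exists v.
suff vu t : v t = u t by split=> // t; rewrite vu.
apply/eqP; rewrite -subr_eq0; apply/eqP/(@nrm_eq0 _ _ E)/eqP.
rewrite eq_le nrm_ge0 andbT; apply: (@le_half_pow R _ (K' * wt t)) => k.
have h : nrm E (v t - it k.+1 t) <= K' * 2 ^- k / 2 * wt t.
  apply: (@increment (fun t => v t - it k.+1 t)
     (fun t => f t (u t) - f t (it k t)) (K' * 2 ^- k) t).
  - by rewrite mulr_ge0.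
  - by rewrite ut0 it0 subrr.
  - by move=> s; apply: wderB; [exact: du|exact: it_der].
  - move=> s; rewrite (le_trans (f_lip _ _ _)) // mulrCA ler_wpM2l //; exact: uP.
have -> : v t - u t = (v t - it k.+1 t) - (u t - it k.+1 t) by rewrite opprB addrA subrK.
rewrite (le_trans (nrmB _ _ _)) // (le_trans (lerD h (uP t k.+1))) //.
by rewrite exprSr invfM le_eqVlt; apply/orP; left; apply/eqP; field.
Unshelve. all: by end_near. Qed.

End Picard.

(** * Symbols in 1/s *)

Section Symbols.
Variables (R : realType) (I : Type) (dom : I -> R -> Prop) (D : I -> R).
Hypothesis dom_ge1 : forall i s, dom i s -> 1 <= s.
Hypothesis D_ge0 : forall i, 0 <= D i.

(* In [f i b s] the boolean [b] selects one of two solutions.  A symbol carries an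
   [O(s ^- k)] bound for each solution and an [O(D i * s ^- k)] bound for their
   difference, so that existence (two equal solutions) and uniqueness (two
   solutions at distance [D i]) rest on the same estimates. *)
Definition symbol (X : zmodType) (N : X -> R) (k : nat) (f : I -> bool -> R -> X) :=
  exists2 C : R, 0 <= C & forall i s, dom i s ->
    (forall b, N (f i b s) <= C * s ^- k) /\
    N (f i true s - f i false s) <= C * D i * s ^- k.

(* The same bounds, up to [eps], at points arbitrarily far in the domain: the
   right endpoint of a bounded domain, or [s --> +oo]. *)
Definition terminal (X : zmodType) (N : X -> R) (k : nat) (f : I -> bool -> R -> X) :=
  exists2 C : R, 0 <= C & forall i s, dom i s -> forall eps : R, 0 < eps ->
    exists2 T : R, s <= T /\ dom i T &
    (forall b, N (f i b T) <= C * T ^- k + eps) /\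
    N (f i true T - f i false T) <= C * D i * T ^- k + eps.

Lemma dom_gt0 i s : dom i s -> 0 < s.
Proof. by move/dom_ge1; apply: lt_le_trans. Qed.

Lemma dom_inv_ge0 i s k : dom i s -> 0 <= s ^- k.
Proof. by move=> /dom_gt0 s0; rewrite invr_ge0 exprn_ge0 ?ltW. Qed.

Lemma dom_inv_le i s j k : dom i s -> (j <= k)%N -> s ^- k <= s ^- j.
Proof.
move=> h jk; have s0 := dom_gt0 h.
by rewrite lef_pV2 ?posrE ?exprn_gt0 // ler_weXn2l // (dom_ge1 h).
Qed.

Lemma inv_pow_anti k (s t : R) : 0 < s -> s <= t -> t ^- k <= s ^- k.
Proof.
move=> s0 st; have t0 := lt_le_trans s0 st.
by rewrite lef_pV2 ?posrE ?exprn_gt0 // lerXn2r // nnegrE ltW.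
Qed.

Section Norm.
Variables (X : zmodType) (N : X -> R).
Hypothesis ND : forall u v, N (u + v) <= N u + N v.

Lemma symbol_ext k f g : (forall i b s, dom i s -> f i b s = g i b s) ->
  symbol N k f -> symbol N k g.
Proof.
move=> fg [C C0 hC]; exists C => // i s h; have [h1 h2] := hC i s h.
by rewrite -!fg //; split=> // b; rewrite -fg.
Qed.

Lemma terminal_ext k f g : (forall i b s, dom i s -> f i b s = g i b s) ->
  terminal N k f -> terminal N k g.
Proof.
move=> fg [C C0 hC]; exists C => // i s h eps eps0.
have [T [sT hT] [h1 h2]] := hC i s h eps eps0; exists T => //.
by rewrite -!fg //; split=> // b; rewrite -fg.
Qed.

Lemma symbol_weak j k f : (j <= k)%N -> symbol N k f -> symbol N j f.
Proof.
move=> jk [C C0 hC]; exists C => // i s h; have [h1 h2] := hC i s h.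
have le := dom_inv_le h jk.
split=> [b|]; first by rewrite (le_trans (h1 b)) // ler_wpM2l.
by rewrite (le_trans h2) // ler_wpM2l // mulr_ge0.
Qed.

Lemma terminal_weak j k f : (j <= k)%N -> terminal N k f -> terminal N j f.
Proof.
move=> jk [C C0 hC]; exists C => // i s h eps eps0.
have [T [sT hT] [h1 h2]] := hC i s h eps eps0; exists T => //.
have le := dom_inv_le hT jk.
split=> [b|]; first by rewrite (le_trans (h1 b)) // lerD2r ler_wpM2l.
by rewrite (le_trans h2) // lerD2r ler_wpM2l // mulr_ge0.
Qed.

Lemma symbolD k f g : symbol N k f -> symbol N k g ->
  symbol N k (fun i b s => f i b s + g i b s).
Proof.
move=> [C C0 hC] [C' C'0 hC']; exists (C + C') => [|i s h]; first exact: addr_ge0.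
have [h1 h2] := hC i s h; have [h1' h2'] := hC' i s h.
split=> [b|]; first by rewrite (le_trans (ND _ _)) // mulrDl lerD.
by rewrite opprD addrACA (le_trans (ND _ _)) // !mulrDl lerD.
Qed.

Lemma terminalD k f g : terminal N k f -> symbol N k g ->
  terminal N k (fun i b s => f i b s + g i b s).
Proof.
move=> [C C0 hC] [C' C'0 hC']; exists (C + C') => [|i s h eps eps0]; first exact: addr_ge0.
have [T [sT hT] [h1 h2]] := hC i s h eps eps0; have [h1' h2'] := hC' i T hT.
exists T => //; split=> [b|].
  by rewrite (le_trans (ND _ _)) // mulrDl addrAC lerD.
by rewrite opprD addrACA (le_trans (ND _ _)) // !mulrDl addrAC lerD.
Qed.

Hypothesis NN : forall u, N (- u) = N u.

Lemma symbolN k f : symbol N k f -> symbol N k (fun i b s => - f i b s).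
Proof.
move=> [C C0 hC]; exists C => // i s h; have [h1 h2] := hC i s h.
by split=> [b|]; rewrite -?opprD NN.
Qed.

Lemma symbolB k f g : symbol N k f -> symbol N k g ->
  symbol N k (fun i b s => f i b s - g i b s).
Proof. by move=> hf /symbolN; exact: symbolD. Qed.

End Norm.

Section Bilinear.
Variables (X Y Z : zmodType) (NX : X -> R) (NY : Y -> R) (NZ : Z -> R).
Variable m : X -> Y -> Z.
Hypothesis NX0 : forall x, 0 <= NX x.
Hypothesis NY0 : forall x, 0 <= NY x.
Hypothesis ND : forall u v, NZ (u + v) <= NZ u + NZ v.
Hypothesis Nm : forall x y, NZ (m x y) <= NX x * NY y.
Hypothesis mD : forall x x' y y', m x y - m x' y' = m (x - x') y + m x' (y - y').

(** [mD] is a discrete Leibniz rule: a difference of products is a sum of two terms, each with one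
    factor carrying [D i]. This is the 2 in the constant. *)
Lemma symbol_bilinear j k f g : symbol NX j f -> symbol NY k g ->
  symbol NZ (j + k) (fun i b s => m (f i b s) (g i b s)).
Proof.
move=> [C C0 hC] [C' C'0 hC']; exists (2 * (C * C')) => [|i s h].
  by rewrite !mulr_ge0.
have [h1 h2] := hC i s h; have [h1' h2'] := hC' i s h.
have sj := dom_inv_ge0 j h; have sk := dom_inv_ge0 k h; rewrite exprD invfM.
split=> [b|].
  rewrite (le_trans (Nm _ _)) // (le_trans (ler_pM _ _ (h1 b) (h1' b))) //.
  by rewrite mulrACA ler_wpM2r ?mulr_ge0 // ler_peMl ?mulr_ge0 //; lra.
rewrite mD (le_trans (ND _ _)) // (le_trans (lerD (Nm _ _) (Nm _ _))) //.
rewrite (le_trans (lerD (ler_pM _ _ h2 (h1' true)) (ler_pM _ _ (h1 false) h2'))) //.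
by rewrite le_eqVlt; apply/orP; left; apply/eqP; ring.
Qed.

End Bilinear.

Lemma symbolM j k (f g : I -> bool -> R -> R) :
  symbol normr j f -> symbol normr k g ->
  symbol normr (j + k) (fun i b s => f i b s * g i b s).
Proof.
apply: symbol_bilinear => //; first exact: ler_normD.
  by move=> x y; rewrite normrM.
by move=> x x' y y'; ring.
Qed.

Lemma symbolX j k (f : I -> bool -> R -> R) :
  symbol normr j f -> symbol normr (k * j) (fun i b s => f i b s ^+ k).
Proof.
move=> hf; elim: k => [|k IH].
  exists 1 => // i s h; rewrite mul0n !expr0 subrr normr0 invr1 !mulr1 mul1r.
  by split=> // b; rewrite expr0 normr1.
rewrite mulSn; apply: symbol_ext (symbolM hf IH) => i b s _; by rewrite exprS.
Qed.

Lemma symbol_cst (f : I -> R) C : (forall i, `|f i| <= C) ->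
  symbol normr 0 (fun i b s => f i).
Proof.
move=> hf; exists `|C| => // i s h.
rewrite expr0 subrr normr0 invr1 !mulr1 mulr_ge0 //; split=> // b.
exact: le_trans (hf i) (ler_norm _).
Qed.

Lemma symbol_inv : symbol normr 1 (fun i b s => s^-1).
Proof.
exists 1 => // i s h; have := dom_inv_ge0 1 h; rewrite expr1 !mul1r => s0.
by rewrite subrr normr0 mulr_ge0 // ger0_norm.
Qed.

Section Vector.
Variables (V : lmodType R) (E : euclid V).

Lemma symbol_scale j k f (w : I -> bool -> R -> V) :
  symbol normr j f -> symbol (nrm E) k w ->
  symbol (nrm E) (j + k) (fun i b s => f i b s *: w i b s).
Proof.
apply: symbol_bilinear => //; first exact: nrm_ge0.
- exact: nrmD.
- by move=> x y; rewrite nrmZ.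
- by move=> x x' y y'; rewrite scalerBl scalerBr addrA subrK.
Qed.

Lemma symbol_ip j k (v w : I -> bool -> R -> V) :
  symbol (nrm E) j v -> symbol (nrm E) k w ->
  symbol normr (j + k) (fun i b s => ip E (v i b s) (w i b s)).
Proof.
apply: symbol_bilinear; [exact: nrm_ge0|exact: nrm_ge0|exact: ler_normD| |].
  exact: cauchy_schwarz.
by move=> x x' y y'; rewrite ipBl ipBr; ring.
Qed.

Lemma symbol_linear k (L : {linear V -> V}) (w : I -> bool -> R -> V) :
  symbol (nrm E) k w -> symbol (nrm E) k (fun i b s => L (w i b s)).
Proof.
have [K K0 hK] := linear_bounded E E L.
move=> [C C0 hC]; exists (K * C) => [|i s h]; first exact: mulr_ge0.
have [h1 h2] := hC i s h; split=> [b|]; first by rewrite (le_trans (hK _)) // -mulrA ler_wpM2l.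
by rewrite -raddfB (le_trans (hK _)) // -!mulrA ler_wpM2l // mulrA.
Qed.

End Vector.

Section Integration.
Hypothesis dom_conv : forall i s t x, dom i s -> dom i t -> s <= x <= t -> dom i x.

(** The primitive that vanishes at infinity; the exponent [k.+2] makes the integrand integrable up
    to [+oo]. *)
Let der_pow k (C s : R) : 0 < s ->
  is_derive s 1 (fun t => - (C / k.+1%:R) * t ^- k.+1) (C * s ^- k.+2).
Proof.
move=> s0; apply: (der_eq (derZ _ (derV _ (derX k.+1 (der_id s))))).
  by rewrite expf_neq0 // gt_eqF.
rewrite /= mulr1 !exprS.
have : (k.+1%:R : R) != 0 by rewrite pnatr_eq0.
have : s != 0 by rewrite gt_eqF.
by move=> s1 k1; field; rewrite expf_neq0 // s1 addrC natr1.
Qed.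

Let eps_le (x y : R) : (forall eps : R, 0 < eps -> x <= y + eps) -> x <= y.
Proof. by move=> h; apply/ler_addgt0Pr. Qed.

(** Integration backwards from the far end of the domain costs one power of [s]. The terminal bound
    controls the constant of integration, and its slack [eps] is arbitrary, so the far end may be
    [+oo]. *)
Lemma symbol_integral k (f f' : I -> bool -> R -> R) : terminal normr k.+1 f ->
  (forall i b (s : R), dom i s -> is_derive s 1 (f i b) (f' i b s)) ->
  symbol normr k.+2 f' -> symbol normr k.+1 f.
Proof.
move=> [C C0 hC] df [C' C'0 hC'].
(* One statement for both halves of [symbol]: a single solution with constants [C], [C'], and the
   difference of two with [C * D i], [C' * D i]. *)
have key i (s T : R) (g g' : R -> R) (K K' eps : R) : dom i s -> dom i T -> s <= T -> 0 <= K -> 0 <= K' ->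
    (forall x : R, dom i x -> is_derive x 1 g (g' x)) ->
    (forall x, dom i x -> `|g' x| <= K' * x ^- k.+2) ->
    `|g T| <= K * T ^- k.+1 + eps -> `|g s| <= (K + K') * s ^- k.+1 + eps.
  move=> hs hT sT K0 K'0 dg bg gT.
  have dm x : s <= x <= T -> dom i x by exact: dom_conv.
  have := mvt_le sT (fun x h => dg x (dm x h))
    (fun x h => der_pow k K' (dom_gt0 (dm x h))) (fun x h => bg x (dm x h)).
  have sk := dom_inv_ge0 k.+1 hs; have Tk := dom_inv_ge0 k.+1 hT.
  have Ts := inv_pow_anti k.+1 (dom_gt0 hs) sT.
  have K1 : K' / k.+1%:R <= K' by rewrite ler_pdivrMr // ler_peMr // ler1n.
  have K2 : 0 <= K' / k.+1%:R by rewrite divr_ge0.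
  have h1 : K' / k.+1%:R * s ^- k.+1 <= K' * s ^- k.+1 by rewrite ler_wpM2r.
  have h2 : K * T ^- k.+1 <= K * s ^- k.+1 by rewrite ler_wpM2l.
  have h3 : 0 <= K' / k.+1%:R * T ^- k.+1 by rewrite mulr_ge0.
  have h0 : `|g s| <= `|g T| + `|g T - g s| by rewrite -{1}(subKr (g T) (g s)) ler_normB.
  move: sk Tk Ts K1 K2 h1 h2 h3; rewrite !mulNr mulrDl.
  move: (K' / _) (s ^- k.+1) (T ^- k.+1) gT => c p q gT *; lra.
exists (C + C') => [|i s h]; first exact: addr_ge0.
split=> [b|]; apply: eps_le => eps eps0; have [T [sT hT] [h1 h2]] := hC i s h eps eps0.
  apply: (key i s T _ _ C C' eps h hT sT C0 C'0 (fun x hx => df i b x hx)) => //.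
  by move=> x /(hC' i) [].
have -> : (C + C') * D i = C * D i + C' * D i by rewrite mulrDl.
apply: (key i s T (fun s => f i true s - f i false s) (fun s => f' i true s - f' i false s))
  => //; rewrite ?mulr_ge0 //.
  by move=> x hx; apply: derB; exact: df.
by move=> x /(hC' i) [].
Qed.

Variables (V : lmodType R) (E : euclid V) (S : I -> R -> V -> V).
Hypothesis skew : forall i s v, ip E v (S i s v) = 0.
Hypothesis S_sub : forall i s v w, S i s (v - w) = S i s v - S i s w.

(** The same integration with a rotating principal part. [S] does not depend on the boolean, so the
    difference of the two solutions obeys the same equation with the difference of the sources; the
    factor 2 comes from [skew_gronwall]. *)
Lemma symbol_skew k (w r : I -> bool -> R -> V) : terminal (nrm E) k.+1 w ->
  (forall i b s, dom i s -> wder E (w i b) s (S i s (w i b s) + r i b s)) ->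
  symbol (nrm E) k.+2 r -> symbol (nrm E) k.+1 w.
Proof.
move=> [C C0 hC] dw [C' C'0 hC'].
have key i (s T : R) (v q : R -> V) (K K' eps : R) : dom i s -> dom i T -> s <= T -> 0 <= K -> 0 <= K' ->
    (forall x, dom i x -> wder E v x (S i x (v x) + q x)) ->
    (forall x, dom i x -> nrm E (q x) <= K' * x ^- k.+2) ->
    nrm E (v T) <= K * T ^- k.+1 + eps -> nrm E (v s) <= (K + 2 * K') * s ^- k.+1 + eps.
  move=> hs hT sT K0 K'0 dv bq vT.
  have dm x : s <= x <= T -> dom i x by exact: dom_conv.
  have := skew_gronwall sT (fun x h => dv x (dm x h)) (fun x => skew i x (v x))
    (fun x h => der_pow k K' (dom_gt0 (dm x h))) (fun x h => bq x (dm x h)).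
  move=> /(_ s); rewrite lexx sT => /(_ isT).
  have sk := dom_inv_ge0 k.+1 hs; have Tk := dom_inv_ge0 k.+1 hT.
  have Ts := inv_pow_anti k.+1 (dom_gt0 hs) sT.
  have K1 : K' / k.+1%:R <= K' by rewrite ler_pdivrMr // ler_peMr // ler1n.
  have K2 : 0 <= K' / k.+1%:R by rewrite divr_ge0.
  have h1 : K' / k.+1%:R * s ^- k.+1 <= K' * s ^- k.+1 by rewrite ler_wpM2r.
  have h2 : K * T ^- k.+1 <= K * s ^- k.+1 by rewrite ler_wpM2l.
  have h3 : 0 <= K' / k.+1%:R * T ^- k.+1 by rewrite mulr_ge0.
  move: sk Tk Ts K1 K2 h1 h2 h3; rewrite !mulNr mulrDl.
  move: (K' / _) (s ^- k.+1) (T ^- k.+1) vT => c p p' vT *; lra.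
exists (C + 2 * C') => [|i s h]; first by rewrite addr_ge0 ?mulr_ge0.
split=> [b|]; apply: eps_le => eps eps0; have [T [sT hT] [h1 h2]] := hC i s h eps eps0.
  apply: (key i s T _ _ C C' eps h hT sT C0 C'0 (fun x hx => dw i b x hx)) => //.
  by move=> x /(hC' i) [].
have -> : (C + 2 * C') * D i = C * D i + 2 * (C' * D i) by ring.
apply: (key i s T (fun s => w i true s - w i false s) (fun s => r i true s - r i false s))
  => //; rewrite ?mulr_ge0 //.
  move=> x hx; apply: (wder_eq (wderB (dw i true x hx) (dw i false x hx))).
  by rewrite S_sub opprD addrACA.
by move=> x /(hC' i) [].
Qed.

End Integration.

End Symbols.

(** * One component of the system *)

(** Quantitative [C^{1,1}] regularity. The bounds on [F], on [dF] and on the increments of [F] are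
    asked only on [[0, 1]], where [n] takes its values, since globally [dF] may grow linearly; the
    Lipschitz bound on [dF] and the Taylor bound are global. *)
Definition c11 (R : realType) (K : R) (F dF : R -> R) :=
  [/\ forall x : R, is_derive x 1 F (dF x),
      forall x, 0 <= x <= 1 -> `|F x| <= K /\ `|dF x| <= K,
      forall x y, `|dF x - dF y| <= K * `|x - y|,
      forall x y, `|F x - F y - dF y * (x - y)| <= K * (x - y) ^+ 2
    & forall x y, 0 <= x <= 1 -> 0 <= y <= 1 -> `|F x - F y| <= K * `|x - y|].

Lemma c11_ge0 (R : realType) (K : R) F dF : c11 K F dF -> 0 <= K.
Proof.
move=> [_ h _ _ _]; have [|h0 _] := h 0; first by rewrite lexx ler01.
exact: le_trans h0.
Qed.

(* One of the two components, [A], coupled to the other one, [B]; [eps = 1] for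
   the first component and [eps = -1] for the second.  Time derivatives are
   expressed through [n = |A|^2] and the real and imaginary parts [x], [y] of
   [<A, G B>], which rotate with angular velocity [a]. *)
Section Component.
Variables (R : realType) (V : lmodType R) (E : euclid V).
Variables J G Gs : {linear V -> V}.
Hypothesis J_skew : forall u v, ip E (J u) v = - ip E u (J v).
Hypothesis J_sq : forall u, J (J u) = - u.
Hypothesis GJ : forall u, G (J u) = J (G u).
Hypothesis GsJ : forall u, Gs (J u) = J (Gs u).
Hypothesis G_adj : forall u v, ip E (G u) v = ip E u (Gs v).
Variables (eps : R) (FA FB dFA dFB : R -> R) (K : R).
Hypothesis eps2 : eps * eps = 1.
Hypothesis cFA : c11 K FA dFA.
Hypothesis cFB : c11 K FB dFB.

Local Notation ip := (ip E).

Let JD u v : J (u + v) = J u + J v. Proof. exact: linearD. Qed.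
Let JZ c u : J (c *: u) = c *: J u. Proof. exact: linearZ. Qed.
Let GD u v : G (u + v) = G u + G v. Proof. exact: linearD. Qed.
Let GZ c u : G (c *: u) = c *: G u. Proof. exact: linearZ. Qed.
Let GsD u v : Gs (u + v) = Gs u + Gs v. Proof. exact: linearD. Qed.
Let GsZ c u : Gs (c *: u) = c *: Gs u. Proof. exact: linearZ. Qed.
Let JN u : J (- u) = - J u. Proof. exact: linearN. Qed.
Let GN u : G (- u) = - G u. Proof. exact: linearN. Qed.
Let GsN u : Gs (- u) = - Gs u. Proof. exact: linearN. Qed.
Let linE := (JD, JZ, JN, GD, GZ, GN, GsD, GsZ, GsN).
Let ipE := (ipDl, ipDr, ipBl, ipBr, ipZl, ipZr, ipNl, ipNr).

Lemma ip_J u : ip u (J u) = 0.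
Proof. by have := J_skew u u; rewrite (ipC E (J u)) => h; lra. Qed.

(** Since [J] commutes with [G] and [Gs], this is the vanishing of [<v, J v>] at [v = Gs u]. It
    makes [free_flow] skew. *)
Lemma ip_JGGs u : ip u (J (G (Gs u))) = 0.
Proof. by rewrite -GJ ipC G_adj ipC -GsJ GsJ ip_J. Qed.

Lemma Gs_adj u v : ip (Gs u) v = ip u (G v).
Proof. by rewrite ipC -G_adj ipC. Qed.

Section OneSolution.
Variables (A B : R -> V).
Let n s := ip (A s) (A s).
Let x s := ip (A s) (G (B s)).
Let y s := ip (A s) (J (G (B s))).
Let k s := ip (G (B s)) (G (B s)) - ip (Gs (A s)) (Gs (A s)).
Let a s := 2 * eps * s + (FA (n s) - FB (n s)).
Let a' s := 2 * eps + (dFA (n s) - dFB (n s)) * (2 * y s).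
Variable s : R.
Hypothesis dA : wder E A s (J ((eps * s + FA (n s)) *: A s + G (B s))).
Hypothesis dB : wder E B s (J ((FB (n s) - eps * s) *: B s + Gs (A s))).

Lemma der_n : is_derive s 1 n (2 * y s).
Proof.
apply: (der_eq (is_derive_ip dA dA)).
rewrite (ipC E _ (A s)) !linE !ipE ip_J.
by rewrite /y; ring.
Qed.

Lemma der_x : is_derive s 1 x (- a s * y s).
Proof.
have dGB : wder E (fun t => G (B t)) s _ := wder_adj G_adj dB.
apply: (der_eq (is_derive_ip dA dGB)).
(* [<G B, J (G B)>] and [<A, J (G (Gs A))>] vanish; the two rotation rates remain, and their
   difference is [a]. *)
rewrite GJ !J_skew !linE !ipE ip_J ip_JGGs.
by rewrite /a /y; ring.
Qed.

Lemma der_y : is_derive s 1 y (a s * x s + k s).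
Proof.
have J_adj u v : ip (J u) v = ip u (- J v) by rewrite J_skew ipNr.
have dGB : wder E (fun t => J (G (B t))) s _ := wder_adj J_adj (wder_adj G_adj dB).
apply: (der_eq (is_derive_ip dA dGB)).
rewrite GJ !J_skew !J_sq !linE !ipE opprK -(Gs_adj _ (Gs _)).
by rewrite /a /x /k; ring.
Qed.

Lemma der_a : is_derive s 1 a (a' s).
Proof.
have [dA' _ _ _ _] := cFA; have [dB' _ _ _ _] := cFB.
apply: (der_eq (derD (derZ (2 * eps) (der_id s))
  (derB (is_derive1_comp (dA' (n s)) der_n) (is_derive1_comp (dB' (n s)) der_n)))).
by rewrite /a' mulr1 mulrBl.
Qed.

Hypothesis a0 : a s != 0.

Lemma der_ia : is_derive s 1 (fun t => (a t)^-1) (- (a s) ^- 2 * a' s).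
Proof. exact: derV der_a. Qed.

(* Integration by parts of [n' = 2 y] against [x' = - a y]. *)
Lemma der_M nw : is_derive s 1 (fun t => n t - nw + 2 * (x t * (a t)^-1))
  (- 2 * (x s * a' s * (a s)^-1 ^+ 2)).
Proof.
apply: (der_eq (derD (derB der_n (der_cst nw _)) (derZ 2 (derM der_x der_ia)))).
by field.
Qed.

(* A second integration by parts, with [kap] frozen at the end state: what
   remains is of third order, or second order times the drift of [n]. *)
Lemma der_Q nw kap : is_derive s 1
  (fun t => n t - nw + 2 * (x t * (a t)^-1) + (4 * (eps * (y t * (a t)^-1 ^+ 3))
     - 2 * (kap * (x t ^+ 2 * (a t)^-1 ^+ 3))))
  (4 * (eps * (k s * (a s)^-1 ^+ 3)) - 12 * (eps * (y s * a' s * (a s)^-1 ^+ 4))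
   + 6 * (kap * (x s ^+ 2 * a' s * (a s)^-1 ^+ 4))
   - 4 * ((dFA (n s) - dFB (n s) - kap) * (x s * y s * (a s)^-1 ^+ 2))).
Proof.
apply: (der_eq (derD (der_M nw)
   (derB (derZ 4 (derZ eps (derM der_y (derX 3 der_ia))))
   (derZ 2 (derZ kap (derM (derX 2 der_x) (derX 3 der_ia))))))).
by rewrite /= /a'; field.
Qed.

(* [A + a^-1 G B] diagonalizes the system at first order; the correction
   [a^-1 G Gs] of the diagonal is the source of the logarithmic phase. *)
Lemma der_w : wder E (fun t => A t + (a t)^-1 *: G (B t)) s
  (J ((eps * s + FA (n s)) *: (A s + (a s)^-1 *: G (B s)) + (a s)^-1 *: G (Gs (A s)))
   - (a' s * (a s)^-1 ^+ 2) *: G (B s)).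
Proof.
apply: (wder_eq (wderD dA (wderZ der_ia (wder_adj G_adj dB)))).
apply: (@ip_inj _ _ E) => e.
rewrite GJ !linE !ipE.
(* The definition of [a] read backwards: [G B] rotates at the rate [FB - eps s = eps s + FA - a],
   and this [- a] times the factor [a^-1] cancels the coupling [J (G B)]. *)
have -> : FB (n s) = 2 * eps * s + FA (n s) - a s by rewrite /a; ring.
by field.
Qed.

Hypothesis s0 : s != 0.
Variables (nw c : R).

(* The equation satisfied by the asymptotic profile. *)
Definition free_flow (t : R) (v : V) :=
  J ((eps * t + FA nw) *: v + (eps / 2 * t^-1) *: G (Gs v)).

Let w t := A t + (a t)^-1 *: G (B t).
Let q t := 2 * (c * (y t * (a t)^-1 ^+ 2)).
(** Three errors of second order: replacing [a^-1] by [eps / (2 s)], replacing [A] by [w] in the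
    correction [a^-1 G Gs A], and differentiating the coefficient [a^-1]. *)
Let e := (- (eps / 2) * (s^-1 * ((FA (n s) - FB (n s)) * (a s)^-1))) *: J (G (Gs (w s)))
  - ((a s)^-1 ^+ 2) *: J (G (Gs (G (B s))))
  - (a' s * (a s)^-1 ^+ 2) *: G (B s).

(* The factor [1 + q J] absorbs the oscillating part [- 2 c x / a] of
   [FA n - FA nw], where [c] stands for the derivative of [FA] at [nw]. *)
Lemma der_W : wder E (fun t => w t + q t *: J (w t)) s
  (free_flow s (w s + q s *: J (w s)) +
   ((FA (n s) - FA nw + c * (2 * (x s * (a s)^-1))
     + 2 * (c * (k s * (a s)^-1 ^+ 2)) - 4 * (c * (y s * a' s * (a s)^-1 ^+ 3))) *: J (w s)
    + e - (q s * (FA (n s) - FA nw)) *: w s + q s *: J e)).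
Proof.
have J_adj u v : ip (J u) v = ip u (- J v) by rewrite J_skew ipNr.
(* By [y' = a x + k] the leading part of [q'] is [2 c x / a], the oscillation to be removed. *)
have dq : is_derive s 1 q (2 * (c * (x s * (a s)^-1 + k s * (a s)^-1 ^+ 2
                           - 2 * (y s * a' s * (a s)^-1 ^+ 3)))).
  apply: (der_eq (derZ 2 (derZ c (derM der_y (derX 2 der_ia))))).
  by rewrite /=; field.
apply: (wder_eq (wderD der_w (wderZ dq (wder_adj J_adj der_w)))).
apply: (@ip_inj _ _ E) => f.
(* The gap between [a^-1] and its leading part [eps / (2 s)]; [eps^2 = 1] lets [eps] stand for its
   own inverse. *)
have fe : - (eps / 2) * (s^-1 * ((FA (n s) - FB (n s)) * (a s)^-1))
    = (a s)^-1 - eps / 2 * s^-1.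
  transitivity (eps * eps * (a s)^-1 - eps / 2 * s^-1); last by rewrite eps2 mul1r.
  have -> : FA (n s) - FB (n s) = a s - 2 * eps * s by rewrite /a; ring.
  by field; rewrite a0 s0.
rewrite /free_flow /e fe /w !(linE, GJ, GsJ, J_sq) !ipE.
by field; rewrite a0 s0.
Qed.

End OneSolution.

(** * Uniform estimates for one component *)

Section Families.
Variables (I : Type) (dom : I -> R -> Prop) (D : I -> R).
Hypothesis dom_ge1 : forall i s, dom i s -> 1 <= s.
Hypothesis dom_K : forall i s, dom i s -> 2 * K <= s.
Hypothesis D_ge0 : forall i, 0 <= D i.
Hypothesis dom_conv : forall i s t x, dom i s -> dom i t -> s <= x <= t -> dom i x.
Variables (A B : I -> bool -> R -> V) (z : I -> R -> V) (nw : I -> R).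
Local Notation symbol := (symbol dom D).
Local Notation terminal := (terminal dom D).

Let n i b s := ip (A i b s) (A i b s).
Let x i b s := ip (A i b s) (G (B i b s)).
Let y i b s := ip (A i b s) (J (G (B i b s))).
Let k i b s := ip (G (B i b s)) (G (B i b s)) - ip (Gs (A i b s)) (Gs (A i b s)).
Let a i b s := 2 * eps * s + (FA (n i b s) - FB (n i b s)).
Let a' i b s := 2 * eps + (dFA (n i b s) - dFB (n i b s)) * (2 * y i b s).
Let M i b s := n i b s - nw i + 2 * (x i b s * (a i b s)^-1).
Let w i b s := A i b s + (a i b s)^-1 *: G (B i b s).
Let q i b s := 2 * (dFA (nw i) * (y i b s * (a i b s)^-1 ^+ 2)).
Let W i b s := w i b s + q i b s *: J (w i b s).

Hypothesis nw01 : forall i, 0 <= nw i <= 1.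
Hypothesis nA1 : forall i b s, dom i s -> ip (A i b s) (A i b s) <= 1.
Hypothesis nB1 : forall i b s, dom i s -> ip (B i b s) (B i b s) <= 1.
Hypothesis diffA : forall i s, dom i s -> nrm E (A i true s - A i false s) <= D i.
Hypothesis diffB : forall i s, dom i s -> nrm E (B i true s - B i false s) <= D i.
Hypothesis dA : forall i b s, dom i s ->
  wder E (A i b) s (J ((eps * s + FA (n i b s)) *: A i b s + G (B i b s))).
Hypothesis dB : forall i b s, dom i s ->
  wder E (B i b) s (J ((FB (n i b s) - eps * s) *: B i b s + Gs (A i b s))).
Hypothesis dz : forall i s, dom i s -> wder E (z i) s (free_flow (nw i) s (z i s)).

Let unit_symbol (v : I -> bool -> R -> V) :
  (forall i b s, dom i s -> ip (v i b s) (v i b s) <= 1) ->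
  (forall i s, dom i s -> nrm E (v i true s - v i false s) <= D i) ->
  symbol (nrm E) 0 v.
Proof.
move=> v1 vD; exists 1 => // i s h; rewrite expr0 invr1 !mulr1 mul1r.
by split=> [b|]; [exact/nrm_le1/v1|exact: vD].
Qed.

Let sA : symbol (nrm E) 0 A. Proof. exact: unit_symbol. Qed.
Let sB : symbol (nrm E) 0 B. Proof. exact: unit_symbol. Qed.
Let sGB := symbol_linear G sB.
Let sJGB := symbol_linear J sGB.
Let sn : symbol normr 0 n := symbol_ip dom_ge1 sA sA.
Let sx : symbol normr 0 x := symbol_ip dom_ge1 sA sGB.
Let sy : symbol normr 0 y := symbol_ip dom_ge1 sA sJGB.
Let sk : symbol normr 0 k.
Proof.
have sGsA := symbol_linear Gs sA.
exact: (symbolB (@ler_normD _ _) (@normrN _ _) (symbol_ip dom_ge1 sGB sGB)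
  (symbol_ip dom_ge1 sGsA sGsA)).
Qed.

Let n01 i b s : dom i s -> 0 <= n i b s <= 1.
Proof. by move=> h; rewrite ip_ge0 nA1. Qed.

Let K_ge0 : 0 <= K := c11_ge0 cFA.

Let symbol_lip (F : R -> R) : (forall u, 0 <= u <= 1 -> `|F u| <= K) ->
  (forall u v, 0 <= u <= 1 -> 0 <= v <= 1 -> `|F u - F v| <= K * `|u - v|) ->
  symbol normr 0 (fun i b s => F (n i b s)).
Proof.
move=> FK Fl; have [C C0 hC] := sn; exists (K + K * C) => [|i s h].
  by rewrite addr_ge0 // mulr_ge0.
have [_] := hC i s h; rewrite expr0 invr1 !mulr1 => hD.
have KC : 0 <= K * C by rewrite mulr_ge0.
split=> [b|]; first by rewrite (le_trans (FK _ _)) ?n01 // lerDl.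
rewrite (le_trans (Fl _ _ _ _)) ?n01 // (le_trans (ler_wpM2l K_ge0 hD)) //.
by rewrite mulrDl mulrA lerDr mulr_ge0.
Qed.

Let sFA : symbol normr 0 (fun i b s => FA (n i b s)).
Proof. by have [_ h _ _ l] := cFA; apply: symbol_lip => // u /h []. Qed.

Let sFB : symbol normr 0 (fun i b s => FB (n i b s)).
Proof. by have [_ h _ _ l] := cFB; apply: symbol_lip => // u /h []. Qed.

Let sdFA : symbol normr 0 (fun i b s => dFA (n i b s)).
Proof. by have [_ h l _ _] := cFA; apply: symbol_lip => // u /h []. Qed.

Let sdFB : symbol normr 0 (fun i b s => dFB (n i b s)).
Proof. by have [_ h l _ _] := cFB; apply: symbol_lip => // u /h []. Qed.

Local Notation sD := (symbolD (@ler_normD _ _)).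
Local Notation sS := (symbolB (@ler_normD _ _) (@normrN _ _)).
Local Notation vD := (symbolD (@nrmD _ _ E)).
Local Notation vS := (symbolB (@nrmD _ _ E) (@nrmN _ _ E)).
Local Notation sM := (symbolM dom_ge1).
Local Notation sW := (symbol_weak dom_ge1 D_ge0).

Let scst c : symbol normr 0 (fun i b s => c) :=
  symbol_cst dom D_ge0 (fun=> lexx `|c|).

Let sa' : symbol normr 0 a'.
Proof. exact: (sD (scst (2 * eps)) (sM (sS sdFA sdFB) (sM (scst 2) sy))). Qed.

Let eps_norm : `|eps| = 1.
Proof.
apply/eqP; rewrite -(@eqrXn2 _ 2) ?expr1n //.
by rewrite real_normK ?num_real // expr2 eps2.
Qed.

(** [|a| >= 2 s - 2 K], and [dom_K] gives [2 K <= s]: from there on the oscillation is never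
    stationary. *)
Let a_ge i b s : dom i s -> s <= `|a i b s|.
Proof.
move=> h; have [_ hA _ _ _] := cFA; have [_ hB _ _ _] := cFB.
have [fa _] := hA _ (n01 b h); have [fb _] := hB _ (n01 b h).
have s0 := dom_gt0 dom_ge1 h; have sK := dom_K h.
have : `|2 * eps * s| = 2 * s.
  by rewrite !normrM eps_norm mulr1 (gtr0_norm s0) ger0_norm.
have := ler_normB (a i b s) (FA (n i b s) - FB (n i b s)).
rewrite {1}/a addrK => h1 h2.
have := ler_normB (FA (n i b s)) (FB (n i b s)); lra.
Qed.

Let a0 i b s : dom i s -> a i b s != 0.
Proof.
by move=> h; rewrite -normr_gt0 (lt_le_trans _ (a_ge b h)) // (dom_gt0 dom_ge1 h).
Qed.

Let ia_le i b s : dom i s -> `|(a i b s)^-1| <= s^-1.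
Proof.
move=> h; have s0 := dom_gt0 dom_ge1 h.
by rewrite normfV lef_pV2 ?posrE ?normr_gt0 ?a0 ?a_ge.
Qed.

Let sia : symbol normr 1 (fun i b s => (a i b s)^-1).
Proof.
have [C C0 hC] := sS sFA sFB; exists (1 + C) => [|i s h]; first exact: addr_ge0.
have s0 := dom_gt0 dom_ge1 h; have s1 := dom_ge1 h.
have is0 : 0 <= s^-1 by rewrite invr_ge0 ltW.
have [_] := hC i s h; rewrite expr0 invr1 mulr1 expr1 => hD.
split=> [b|].
  by rewrite (le_trans (ia_le b h)) // ler_peMl // lerDl.
have -> : (a i true s)^-1 - (a i false s)^-1 = - ((FA (n i true s) - FB (n i true s))
   - (FA (n i false s) - FB (n i false s))) * ((a i true s)^-1 * (a i false s)^-1).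
  transitivity ((a i false s - a i true s) * ((a i true s)^-1 * (a i false s)^-1)).
    by field; rewrite !a0.
  by congr (_ * _); rewrite /a; ring.
rewrite !normrM normrN.
rewrite (le_trans (ler_pM _ _ hD (ler_pM _ _ (ia_le true h) (ia_le false h)))) //.
rewrite mulrA ler_wpM2r // mulrDl mul1r.
have DC : 0 <= C * D i by rewrite mulr_ge0.
rewrite (@le_trans _ _ (C * D i)) ?lerDr //.
by rewrite ler_piMr // invf_le1.
Qed.

Let sia2 := symbolX dom_ge1 D_ge0 2 sia.
Let sia3 := symbolX dom_ge1 D_ge0 3 sia.
Let sia4 := symbolX dom_ge1 D_ge0 4 sia.

(** Meant for domains reaching [+oo]: convergence to the profile is a terminal bound with constant
    0, the slack doing all the work. For [M], the norm of [A] tends to that of [z], and [x / a]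
    tends to 0. *)
Lemma terminal_of_limit : (forall i s, dom i s -> ip (z i s) (z i s) = nw i) ->
  (forall i s eps', dom i s -> 0 < eps' -> exists2 T, s <= T /\ dom i T &
     T^-1 <= eps' /\ forall b, nrm E (A i b T - z i T) <= eps') ->
  terminal (nrm E) 1 (fun i b s => A i b s - z i s) /\ terminal normr 2 M.
Proof.
move=> znw lim; split.
  exists 0 => // i s h e e0; have e2 : 0 < e / 2 by rewrite divr_gt0.
  have [T [sT hT] [Te hA]] := lim i s _ h e2; exists T => //.
  rewrite !mul0r add0r; split=> [b|]; first by apply: le_trans (hA b) _; lra.
  by rewrite (le_trans (nrmB _ _ _)) // (le_trans (lerD (hA _) (hA _))) // -splitr.
have [C C0 hC] := sM (scst 2) (sM sx sia).
(* [e'] is chosen so that [2 e'], spent on [n - nw], and [C e'], spent on [2 x / a], add up to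
   [e / 2]. *)
exists 0 => // i s h e e0; pose e' := e / (2 * (2 + C)).
have c0 : 0 < 2 * (2 + C) by rewrite mulr_gt0 // ltr_wpDr.
have e'0 : 0 < e' by rewrite divr_gt0.
have [T [sT hT] [Te hA]] := lim i s _ h e'0; exists T => //.
have hM b : `|M i b T| <= e / 2.
  have -> : e / 2 = 2 * e' + C * e' by rewrite /e'; field; rewrite gt_eqF // ltr_wpDr.
  rewrite (le_trans (ler_normD _ _)) // lerD //; last first.
    have [h1 _] := hC i T hT; rewrite (le_trans (h1 b)) // expr1.
    by rewrite ler_wpM2l.
  rewrite /n -(znw i T hT) ip_sub_sqr (le_trans (cauchy_schwarz _ _ _)) // mulrC.
  rewrite ler_pM ?nrm_ge0 // (le_trans (nrmD _ _ _)) //.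
  have := nw01 i; rewrite -(znw i T hT) => /andP[_ z1].
  by have := nrm_le1 z1; have := nrm_le1 (nA1 b hT); lra.
rewrite !mul0r add0r; split=> [b|]; first by apply: le_trans (hM b) _; lra.
by rewrite (le_trans (ler_normB _ _)) // (le_trans (lerD (hM _) (hM _))) // -splitr.
Qed.

Hypothesis end_A : terminal (nrm E) 1 (fun i b s => A i b s - z i s).
Hypothesis end_M : terminal normr 2 M.

(** First pass: the derivative of [M] is so far only of second order, so a single power results. It
    yields [n - nw = O(1/s)], which feeds the second pass. *)
Let sM1 : symbol normr 1 M.
Proof.
have sM' : symbol normr 2 (fun i b s => - 2 * (x i b s * a' i b s * (a i b s)^-1 ^+ 2)).
  exact: (sM (scst (- 2)) (sM (sM sx sa') sia2)).
apply: (symbol_integral dom_ge1 D_ge0 dom_conv _ _ sM').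
  exact (terminal_weak dom_ge1 D_ge0 (isT : (1 <= 2)%N) end_M).
by move=> i b s h; exact: (der_M (dA b h) (dB b h) (a0 b h) (nw i)).
Qed.

Let sm : symbol normr 1 (fun i b s => n i b s - nw i).
Proof.
apply: symbol_ext (sS sM1 (sM (scst 2) (sM sx sia))) => i b s _.
by rewrite /M addrK.
Qed.

Let sgap (dF : R -> R) : (forall u v, `|dF u - dF v| <= K * `|u - v|) ->
  symbol normr 1 (fun i b s => dF (n i b s) - dF (nw i)).
Proof.
move=> dFl; have [C C0 hC] := sm; exists (K * C) => [|i s h]; first exact: mulr_ge0.
have [h1 h2] := hC i s h; split=> [b|].
  by rewrite (le_trans (dFl _ _)) // -mulrA ler_wpM2l.
rewrite opprB addrA subrK (le_trans (dFl _ _)) // -!mulrA ler_wpM2l // mulrA.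
by apply: le_trans h2; rewrite opprB addrA subrK.
Qed.

Let snw (F : R -> R) : (forall u, 0 <= u <= 1 -> `|F u| <= K) ->
  symbol normr 0 (fun i b s => F (nw i)).
Proof. by move=> FK; apply: (symbol_cst dom D_ge0 (C := K)) => i; exact: FK. Qed.

Let sc : symbol normr 0 (fun i b s => dFA (nw i)).
Proof. by apply: snw => u; have [_ h _ _ _] := cFA; move=> /h []. Qed.

Let skap : symbol normr 0 (fun i b s => dFA (nw i) - dFB (nw i)).
Proof.
apply: (sS sc); apply: snw => u; have [_ h _ _ _] := cFB; by move=> /h [].
Qed.

(** Second pass: [gap], the drift of [dFA - dFB] from its end value, is [O(1/s)] by the first pass,
    so every term of [Q'] is of third order and [M] gains a power. *)
Let sM2 : symbol normr 2 M.
Proof.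
pose kap i := dFA (nw i) - dFB (nw i).
pose f i b s := 4 * (eps * (y i b s * (a i b s)^-1 ^+ 3))
     - 2 * (kap i * (x i b s ^+ 2 * (a i b s)^-1 ^+ 3)).
have sf : symbol normr 3 f.
  exact: (sS (sM (scst 4) (sM (scst eps) (sM sy sia3)))
             (sM (scst 2) (sM skap (sM (symbolX dom_ge1 D_ge0 2 sx) sia3)))).
have sf2 : symbol normr 2 f by exact: (sW (isT : (2 <= 3)%N) sf).
pose gap i b s := dFA (n i b s) - dFB (n i b s) - kap i.
have sgap1 : symbol normr 1 gap.
  have [_ _ lA _ _] := cFA; have [_ _ lB _ _] := cFB.
  apply: symbol_ext (sS (sgap lA) (sgap lB)) => i b s _.
  by rewrite /gap /kap; ring.
suff sQ : symbol normr 2 (fun i b s => M i b s + f i b s).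
  by apply: symbol_ext (sS sQ sf2) => i b s _; rewrite addrK.
pose Q' i b s := 4 * (eps * (k i b s * (a i b s)^-1 ^+ 3))
   - 12 * (eps * (y i b s * a' i b s * (a i b s)^-1 ^+ 4))
   + 6 * (kap i * (x i b s ^+ 2 * a' i b s * (a i b s)^-1 ^+ 4))
   - 4 * (gap i b s * (x i b s * y i b s * (a i b s)^-1 ^+ 2)).
have sQ' : symbol normr 3 Q'.
  have t1 : symbol normr 3 _ := sM (scst 4) (sM (scst eps) (sM sk sia3)).
  have t2 : symbol normr 4 _ := sM (scst 12) (sM (scst eps) (sM (sM sy sa') sia4)).
  have t3 : symbol normr 4 _ :=
    sM (scst 6) (sM skap (sM (sM (symbolX dom_ge1 D_ge0 2 sx) sa') sia4)).
  have t4 : symbol normr 3 _ := sM (scst 4) (sM sgap1 (sM (sM sx sy) sia2)).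
  have t2' := sW (isT : (3 <= 4)%N) t2; have t3' := sW (isT : (3 <= 4)%N) t3.
  exact: (sS (sD (sS t1 t2') t3') t4).
apply: (symbol_integral dom_ge1 D_ge0 dom_conv (f' := Q') _ _ sQ').
  by apply: terminalD end_M sf2; exact: ler_normD.
move=> i b s h; exact (der_Q (dA b h) (dB b h) (a0 b h) (nw i) (kap i)).
Qed.

(** The Taylor remainder at [nw] is quadratic in [n - nw = O(1/s)], and its linear term is
    [- 2 dFA(nw) x / a] up to [dFA(nw) * M], which is of second order. *)
Let srem : symbol normr 2
  (fun i b s => FA (n i b s) - FA (nw i) + dFA (nw i) * (2 * (x i b s * (a i b s)^-1))).
Proof.
suff h : symbol normr 2
    (fun i b s => FA (n i b s) - FA (nw i) - dFA (nw i) * (n i b s - nw i)).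
  apply: symbol_ext (sD h (sM sc sM2)) => i b s _.
  by rewrite /M; ring.
have [_ _ dFl Ft _] := cFA.
have [C C0 hC] := sm; exists (3 * K * C ^+ 2) => [|i s h]; first by rewrite !mulr_ge0.
have [h1 h2] := hC i s h; have s2 := dom_inv_ge0 dom_ge1 1 h.
rewrite expr1 in h1 h2 s2; rewrite -exprVn.
split=> [b|].
  have := Ft (n i b s) (nw i); set m := n i b s - nw i => /le_trans; apply.
  have := h1 b; rewrite -/m => mC.
  have : m ^+ 2 <= (C * s^-1) ^+ 2.
    by rewrite -real_normK ?num_real // lerXn2r ?nnegrE // mulr_ge0.
  rewrite exprMn => /(ler_wpM2l K_ge0) /le_trans; apply.
  rewrite mulrA ler_wpM2r ?exprn_ge0 // ler_wpM2r ?sqr_ge0 //; have := K_ge0; lra.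
set u := n i true s in h1 h2 *; set v := n i false s in h1 h2 *.
(* With no second derivative at hand, the difference of the two remainders is a Taylor remainder at
   [v] plus a variation of [dFA]. They cost [2 K C^2] and [K C^2], whence the 3. *)
have -> : FA u - FA (nw i) - dFA (nw i) * (u - nw i) -
   (FA v - FA (nw i) - dFA (nw i) * (v - nw i)) =
   (FA u - FA v - dFA v * (u - v)) + (dFA v - dFA (nw i)) * (u - v) by ring.
rewrite opprB addrA subrK in h2.
have hu := h1 true; have hv := h1 false; rewrite -/u in hu; rewrite -/v in hv.
have huv : `|u - v| <= 2 * (C * s^-1).
  have -> : u - v = (u - nw i) - (v - nw i) by ring.
  by rewrite (le_trans (ler_normB _ _)) //; lra.
have t1 : `|FA u - FA v - dFA v * (u - v)| <= K * (2 * (C * s^-1) * (C * D i * s^-1)).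
  rewrite (le_trans (Ft _ _)) // ler_wpM2l // -real_normK ?num_real // expr2.
  by rewrite ler_pM.
have t2 : `|(dFA v - dFA (nw i)) * (u - v)| <= K * (C * s^-1) * (C * D i * s^-1).
  rewrite normrM ler_pM // (le_trans (dFl _ _)) //.
  by rewrite ler_wpM2l.
rewrite (le_trans (ler_normD _ _)) // (le_trans (lerD t1 t2)) //.
by rewrite le_eqVlt; apply/orP; left; apply/eqP; ring.
Qed.

(** [W - z] obeys the skew equation of the profile with an [O(s^-2)] source, so integrating from the
    far end bounds it by [O(1/s)]; [A] and [W] differ by [O(1/s)] as well. *)
Lemma component_asymptotics : symbol (nrm E) 1 (fun i b s => A i b s - z i s).
Proof.
have sGBia : symbol (nrm E) 1 (fun i b s => (a i b s)^-1 *: G (B i b s)).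
  exact: (symbol_scale dom_ge1 sia sGB).
have sw : symbol (nrm E) 0 w by exact: (vD sA (sW (isT : (0 <= 1)%N) sGBia)).
have sJw := symbol_linear J sw.
have sq : symbol normr 2 q by exact: (sM (scst 2) (sM sc (sM sy sia2))).
have sqJw : symbol (nrm E) 2 (fun i b s => q i b s *: J (w i b s)).
  exact: (symbol_scale dom_ge1 sq sJw).
pose e i b s := (- (eps / 2) * (s^-1 * ((FA (n i b s) - FB (n i b s)) * (a i b s)^-1)))
    *: J (G (Gs (w i b s)))
  - ((a i b s)^-1 ^+ 2) *: J (G (Gs (G (B i b s))))
  - (a' i b s * (a i b s)^-1 ^+ 2) *: G (B i b s).
have se : symbol (nrm E) 2 e.
  apply: (vS (vS _ _) _).
  - apply: (symbol_scale dom_ge1 (j := 2) (k := 0)); last exact/symbol_linear/symbol_linear/symbol_linear.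
    exact: (sM (scst (- (eps / 2))) (sM (symbol_inv dom_ge1 D_ge0) (sM (sS sFA sFB) sia))).
  - apply: (symbol_scale dom_ge1 (j := 2) (k := 0)) => //.
    exact/symbol_linear/symbol_linear/symbol_linear.
  - apply: (symbol_scale dom_ge1 (j := 2) (k := 0)) => //; exact: (sM sa' sia2).
pose r i b s := (FA (n i b s) - FA (nw i) + dFA (nw i) * (2 * (x i b s * (a i b s)^-1))
     + 2 * (dFA (nw i) * (k i b s * (a i b s)^-1 ^+ 2))
     - 4 * (dFA (nw i) * (y i b s * a' i b s * (a i b s)^-1 ^+ 3))) *: J (w i b s)
    + e i b s - (q i b s * (FA (n i b s) - FA (nw i))) *: w i b s + q i b s *: J (e i b s).
have sr : symbol (nrm E) 2 r.
  apply: (vD (vS (vD _ se) _) _).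
  - apply: (symbol_scale dom_ge1 (j := 2) (k := 0)) => //.
    have t2 : symbol normr 2 _ := sM (scst 2) (sM sc (sM sk sia2)).
    have t3 : symbol normr 3 _ := sM (scst 4) (sM sc (sM (sM sy sa') sia3)).
    exact: (sS (sD srem t2) (sW (isT : (2 <= 3)%N) t3)).
  - apply: (symbol_scale dom_ge1 (j := 2) (k := 0)) => //.
    have [_ hF _ _ _] := cFA; apply: (sM (j := 2) (k := 0) sq (sS sFA (snw _))).
    by move=> u /hF [].
  - have t := symbol_scale dom_ge1 sq (symbol_linear J se).
    exact: (sW (isT : (2 <= 4)%N) t).
have end_W : terminal (nrm E) 1 (fun i b s => W i b s - z i s).
  apply: terminal_ext (terminalD (@nrmD _ _ E) end_A
    (vD sGBia (sW (isT : (1 <= 2)%N) sqJw))) => i b s _.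
  by apply: (@ip_inj _ _ E) => f; rewrite /W /w !ipE; ring.
have sWz : symbol (nrm E) 1 (fun i b s => W i b s - z i s).
  apply: (symbol_skew dom_ge1 D_ge0 dom_conv (S := fun i => free_flow (nw i)) _ _ (r := r) end_W _ sr).
  - by move=> i s v; rewrite /free_flow !linE !ipE ip_J ip_JGGs; ring.
  - move=> i s u v; apply: (@ip_inj _ _ E) => f.
    by rewrite /free_flow !linE !ipE; ring.
  move=> i b s h; have s0 : s != 0 by rewrite gt_eqF // (dom_gt0 dom_ge1 h).
  have hW := der_W (dA b h) (dB b h) (a0 b h) s0 (nw i) (dFA (nw i)).
  apply: (wder_eq (wderB hW (dz h))).
  apply: (@ip_inj _ _ E) => f.
  rewrite -/(n i b s) -/(x i b s) -/(y i b s) -/(k i b s) -/(a i b s) -/(a' i b s).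
  rewrite -/(w i b s) -/(q i b s) -/(W i b s) -/(e i b s) -/(r i b s).
  by rewrite /free_flow !linE !ipE; ring.
apply: symbol_ext (vS (vS sWz sGBia) (sW (isT : (1 <= 2)%N) sqJw)) => i b s _.
by apply: (@ip_inj _ _ E) => f; rewrite /W /w !ipE; ring.
Qed.

End Families.
End Component.

(** * The flow *)

Section ProductEuclid.
Variables (R : realType) (V : lmodType R) (E : euclid V).

Definition prod_ip (u v : V * V) : R := ip E u.1 v.1 + ip E u.2 v.2.

Definition prod_frame (p : bool * frame_index E) : V * V :=
  if p.1 then (frame E p.2, 0) else (0, frame E p.2).

Lemma prod_ipC u v : prod_ip u v = prod_ip v u.
Proof. by rewrite /prod_ip (ipC E u.1) (ipC E u.2). Qed.

Lemma prod_ip_linear a u v w : prod_ip (a *: u + v) w = a * prod_ip u w + prod_ip v w.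
Proof. by rewrite /prod_ip !ipDl !ipZl; ring. Qed.

Lemma prod_frame_sum u : u = \sum_p prod_ip u (prod_frame p) *: prod_frame p.
Proof.
rewrite -(pair_bigA _ (fun b k => prod_ip u (prod_frame (b, k)) *: prod_frame (b, k))) /=.
rewrite big_bool /= /prod_ip /prod_frame /=.
under eq_bigr do rewrite ip0r addr0; under [X in _ + X]eq_bigr do rewrite ip0r add0r.
rewrite [LHS]surjective_pairing {1}(frame_sum E u.1) {1}(frame_sum E u.2).
have -> (a b : V) : (a, b) = (a, 0) + (0, b) by congr (_, _); rewrite /= ?addr0 ?add0r.
have sum1 (F : frame_index E -> V) : (\sum_k F k, 0) = \sum_k (F k, 0) :> (V * V)%type.
  apply: (big_morph (fun v : V => (v, 0) : (V * V)%type)) => // v w.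
  by congr (_, _); rewrite /= addr0.
have sum2 (F : frame_index E -> V) : (0, \sum_k F k) = \sum_k (0, F k) :> (V * V)%type.
  apply: (big_morph (fun v : V => (0, v) : (V * V)%type)) => // v w.
  by congr (_, _); rewrite /= addr0.
rewrite sum1 sum2; congr (_ + _); apply: eq_bigr => k _.
  by congr (_, _); rewrite /= scaler0.
by congr (_, _); rewrite /= scaler0.
Qed.

Definition prod_euclid : euclid (V * V)%type :=
  Euclid prod_ipC prod_ip_linear prod_frame_sum.

Lemma nrm_fst u : nrm E u.1 <= nrm prod_euclid u.
Proof. by rewrite ler_wsqrtr //= lerDl ip_ge0. Qed.

Lemma nrm_snd u : nrm E u.2 <= nrm prod_euclid u.
Proof. by rewrite ler_wsqrtr //= lerDr ip_ge0. Qed.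

Lemma nrm_pair u : nrm prod_euclid u <= nrm E u.1 + nrm E u.2.
Proof.
rewrite -(ler_pXn2r (ltn0Sn 1)) ?nnegrE ?addr_ge0 ?nrm_ge0 //.
rewrite sqr_nrm /= /prod_ip -!sqr_nrm.
by have := nrm_ge0 E u.1; have := nrm_ge0 E u.2; nra.
Qed.

Lemma wder_pair (u : R -> V * V) s d : wder E (fun t => (u t).1) s d.1 ->
  wder E (fun t => (u t).2) s d.2 -> wder prod_euclid u s d.
Proof. by move=> h1 h2 e; apply: derD; [exact: h1|exact: h2]. Qed.

Lemma wder_fst (u : R -> V * V) s d :
  wder prod_euclid u s d -> wder E (fun t => (u t).1) s d.1.
Proof.
move=> h e; have := h (e, 0); rewrite /= /prod_ip /=.
by under eq_fun do rewrite ip0r addr0; rewrite ip0r addr0.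
Qed.

Lemma wder_snd (u : R -> V * V) s d :
  wder prod_euclid u s d -> wder E (fun t => (u t).2) s d.2.
Proof.
move=> h e; have := h (0, e); rewrite /= /prod_ip /=.
by under eq_fun do rewrite ip0r add0r; rewrite ip0r add0r.
Qed.

Lemma wcont_pair (u : R -> V * V) : wcont E (fun t => (u t).1) ->
  wcont E (fun t => (u t).2) -> wcont prod_euclid u.
Proof. by move=> h1 h2 e t; apply: cvgD; [exact: h1|exact: h2]. Qed.

Lemma wcont_fst (u : R -> V * V) : wcont prod_euclid u -> wcont E (fun t => (u t).1).
Proof.
move=> h e; have := h (e, 0); rewrite /= /prod_ip /=.
by under eq_fun do rewrite ip0r addr0.
Qed.

Lemma wcont_snd (u : R -> V * V) : wcont prod_euclid u -> wcont E (fun t => (u t).2).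
Proof.
move=> h e; have := h (0, e); rewrite /= /prod_ip /=.
by under eq_fun do rewrite ip0r add0r.
Qed.

End ProductEuclid.

Section Gronwall.
Variables (R : realType) (V : lmodType R) (E : euclid V).

(** Two-sided in time: [|w|^2 exp (- 2 L x)] is nonincreasing and [|w|^2 exp (2 L x)] nondecreasing.
    With [L = 0] this is conservation of the norm. *)
Lemma gronwall (w w' : R -> V) (L s t : R) : (forall x, wder E w x (w' x)) ->
  (forall x, `|ip E (w x) (w' x)| <= L * ip E (w x) (w x)) ->
  ip E (w t) (w t) <= ip E (w s) (w s) * expR (2 * L * `|t - s|).
Proof.
move=> dw hL; pose Q x := ip E (w x) (w x).
have dQ (x : R) : is_derive x 1 Q (2 * ip E (w x) (w' x)).
  by apply: (der_eq (is_derive_ip (dw x) (dw x))); rewrite (ipC E (w' x)); ring.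
have dexp (c x : R) : is_derive x 1 (fun x => expR (c * x)) (expR (c * x) * c).
  have := is_derive1_comp (is_derive_expR (c * x)) (derZ c (der_id x)).
  by rewrite mulr1.
have mono c (x : R) : is_derive x 1 (fun x => Q x * expR (c * x))
    ((2 * ip E (w x) (w' x) + c * Q x) * expR (c * x)).
  by apply: (der_eq (derM (dQ x) (dexp c x))); ring.
have hle x : - (L * Q x) <= ip E (w x) (w' x) <= L * Q x by rewrite -ler_norml hL.
have cancel (c x y : R) : expR (c * x) = expR (c * (x - y)) * expR (c * y).
  by rewrite -expRD; congr expR; ring.
have [st|/ltW ts] := leP s t.
  rewrite ger0_norm ?subr_ge0 //.
  have := @mvt_le0 R (fun x => - (Q x * expR (- (2 * L) * x)))
    (fun x => - ((2 * ip E (w x) (w' x) + - (2 * L) * Q x) * expR (- (2 * L) * x))) s t st.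
  rewrite lerN2 => h.
  have {h} : Q t * expR (- (2 * L) * t) <= Q s * expR (- (2 * L) * s).
    apply: (h (fun x _ => derN (mono _ x))) => x _.
    rewrite oppr_ge0 pmulr_lle0 ?expR_gt0 //; have /andP[_] := hle x; lra.
  rewrite (cancel _ s t) mulrA ler_pM2r ?expR_gt0 //.
  by congr (_ <= _ * expR _); ring.
rewrite distrC ger0_norm ?subr_ge0 //.
have {}mono : Q t * expR (2 * L * t) <= Q s * expR (2 * L * s).
  apply: (@mvt_le0 R _ _ t s ts (fun x _ => mono (2 * L) x)) => x _.
  rewrite pmulr_lge0 ?expR_gt0 //; have /andP[] := hle x; lra.
by move: mono; rewrite (cancel _ s t) mulrA ler_pM2r ?expR_gt0.
Qed.

Lemma ip_sub_le v w : ip E v v <= 1 -> ip E w w <= 1 ->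
  `|ip E v v - ip E w w| <= 2 * nrm E (v - w).
Proof.
move=> v1 w1; rewrite ip_sub_sqr (le_trans (cauchy_schwarz _ _ _)) // mulrC.
rewrite ler_wpM2r ?nrm_ge0 // (le_trans (nrmD _ _ _)) //.
by have := nrm_le1 v1; have := nrm_le1 w1; lra.
Qed.

(** The radial retraction onto the closed unit ball. *)
Definition retract (u : V) : V := (Num.max 1 (nrm E u))^-1 *: u.

Lemma retract_gt0 u : 0 < Num.max 1 (nrm E u).
Proof. by rewrite lt_max ltr01. Qed.

Lemma retract_le1 u : nrm E (retract u) <= 1.
Proof.
have m0 := retract_gt0 u.
rewrite /retract nrmZ gtr0_norm ?invr_gt0 // mulrC ler_pdivrMr // mul1r.
by rewrite le_max lexx orbT.
Qed.

Lemma retract_id u : nrm E u <= 1 -> retract u = u.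
Proof. by move=> u1; rewrite /retract max_l // invr1 scale1r. Qed.

(** The sharp constant is 1. Treating the change of the vector and the change of the scaling factor
    separately costs [nrm E (u - v)] twice, which is enough here. *)
Lemma retract_lip u v : nrm E (retract u - retract v) <= 2 * nrm E (u - v).
Proof.
rewrite /retract; set a := Num.max 1 _; set b := Num.max 1 _.
have a0 : 0 < a := retract_gt0 u; have b0 : 0 < b := retract_gt0 v.
have a1 : 1 <= a by rewrite le_max lexx.
have -> : a^-1 *: u - b^-1 *: v = a^-1 *: (u - v) + ((b - a) * a^-1 * b^-1) *: v.
  rewrite scalerBr -addrA; congr (_ + _); rewrite -!scaleNr -scalerDl; congr (_ *: _).
  by field; rewrite !gt_eqF.
have ab : `|b - a| <= nrm E (u - v).
  have := nrm_dist E u v; have := nrm_dist E v u; rewrite (nrm_distC E v).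
  have := nrm_ge0 E (u - v); rewrite /a /b !maxEle !ler_norml.
  by case: ifP => h1; case: ifP => h2 h3 /andP[h4 h5] /andP[h6 h7];
    apply/andP; split; move: h1 h2; rewrite -?ltNge; lra.
rewrite (le_trans (nrmD _ _ _)) // mulr_natl mulr2n lerD //.
  by rewrite nrmZ gtr0_norm ?invr_gt0 // ler_piMl ?nrm_ge0 // invf_le1.
have ia0 : 0 < a^-1 by rewrite invr_gt0.
have ib0 : 0 < b^-1 by rewrite invr_gt0.
rewrite nrmZ !normrM (gtr0_norm ia0) (gtr0_norm ib0).
have vb : b^-1 * nrm E v <= 1.
  by rewrite mulrC ler_pdivrMr // mul1r /b le_max lexx orbT.
apply: (@le_trans _ _ (`|b - a| * a^-1)).
  by rewrite -(mulrA _ b^-1) ler_piMr // mulr_ge0 // ltW.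
by apply: le_trans ab; rewrite ler_piMr // invf_le1.
Qed.

End Gronwall.

Section System.
Variables (R : realType) (V : lmodType R) (E : euclid V).
Variables J G Gs : {linear V -> V}.
Hypothesis J_skew : forall u v, ip E (J u) v = - ip E u (J v).
Hypothesis J_sq : forall u, J (J u) = - u.
Hypothesis GJ : forall u, G (J u) = J (G u).
Hypothesis GsJ : forall u, Gs (J u) = J (Gs u).
Hypothesis G_adj : forall u v, ip E (G u) v = ip E u (Gs v).
Variables (F1 F2 dF1 dF2 : R -> R) (K : R).
Hypothesis cF1 : c11 K F1 dF1.
Hypothesis cF2 : c11 K F2 dF2.

Local Notation ip := (ip E).
Local Notation PE := (prod_euclid E).

Let JD u v : J (u + v) = J u + J v. Proof. exact: linearD. Qed.
Let JZ c u : J (c *: u) = c *: J u. Proof. exact: linearZ. Qed.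
Let JN u : J (- u) = - J u. Proof. exact: linearN. Qed.
Let GD u v : G (u + v) = G u + G v. Proof. exact: linearD. Qed.
Let GN u : G (- u) = - G u. Proof. exact: linearN. Qed.
Let GsD u v : Gs (u + v) = Gs u + Gs v. Proof. exact: linearD. Qed.
Let GsN u : Gs (- u) = - Gs u. Proof. exact: linearN. Qed.
Let linE := (JD, JZ, JN, GD, GN, GsD, GsN).
Let ipE := (ipDl, ipDr, ipBl, ipBr, ipZl, ipZr, ipNl, ipNr).

Definition flow (u : R -> V * V) := forall s,
  wder E (fun t => (u t).1) s
    (J ((s + F1 (ip (u s).1 (u s).1)) *: (u s).1 + G (u s).2)) /\
  wder E (fun t => (u t).2) s
    (J ((F2 (ip (u s).1 (u s).1) - s) *: (u s).2 + Gs (u s).1)).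

(* Truncating the nonlinearity outside the unit ball makes it globally
   Lipschitz without affecting the conservation of the norm. *)
Let field (t : R) (u : V * V) : V * V :=
  let v := retract PE u in let n := ip v.1 v.1 in
  (J (t *: u.1 + G u.2 + F1 n *: v.1), J (Gs u.1 - t *: u.2 + F2 n *: v.2)).

Let K_ge0 : 0 <= K := c11_ge0 cF1.

Let nrmJ u : nrm E (J u) = nrm E u.
Proof. by rewrite /nrm J_skew J_sq ipNr opprK. Qed.

Let ball_fst (p : V * V) : nrm PE p <= 1 -> ip p.1 p.1 <= 1.
Proof.
move=> p1; rewrite -sqr_nrm -(expr1n _ 2) lerXn2r ?nnegrE ?nrm_ge0 //.
exact: le_trans (nrm_fst E p) p1.
Qed.

Let nonlinear_lip F dF p q (v w : V) : c11 K F dF ->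
  nrm PE p <= 1 -> nrm PE q <= 1 -> nrm E (v - w) <= nrm PE (p - q) ->
  nrm E w <= 1 ->
  nrm E (F (ip p.1 p.1) *: v - F (ip q.1 q.1) *: w) <= 3 * K * nrm PE (p - q).
Proof.
move=> [_ hb _ _ hl] p1 q1 vw w1; set a := ip p.1 p.1; set b := ip q.1 q.1.
have a01 : 0 <= a <= 1 by rewrite ip_ge0 ball_fst.
have b01 : 0 <= b <= 1 by rewrite ip_ge0 ball_fst.
have -> : F a *: v - F b *: w = F a *: (v - w) + (F a - F b) *: w.
  by rewrite scalerBr scalerBl addrA subrK.
have [Fa _] := hb a a01.
have ab : `|a - b| <= 2 * nrm PE (p - q).
  rewrite (le_trans (ip_sub_le _ _)) ?ball_fst // ler_wpM2l //.
  exact: (nrm_fst E (p - q)).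
have h0 := nrm_ge0 PE (p - q).
have t1 : nrm E (F a *: (v - w)) <= K * nrm PE (p - q).
  by rewrite nrmZ ler_pM ?nrm_ge0.
have t2 : nrm E ((F a - F b) *: w) <= K * (2 * nrm PE (p - q)).
  rewrite nrmZ -[leRHS]mulr1 ler_pM ?nrm_ge0 // (le_trans (hl _ _ a01 b01)) //.
  by rewrite ler_wpM2l.
by rewrite (le_trans (nrmD _ _ _)) // (le_trans (lerD t1 t2)) //; lra.
Qed.

(** The weight [1 + t^2] dominates [|t|] and has an explicit polynomial primitive, which
    [picard_lindelof] takes as its [l]. *)
Let field_lip : exists2 c, 0 <= c & forall t u v,
  nrm PE (field t u - field t v) <= c * (1 + t ^+ 2) * nrm PE (u - v).
Proof.
have [g g0 hg] := linear_bounded E E G; have [g' g'0 hg'] := linear_bounded E E Gs.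
exists (2 + g + g' + 12 * K) => [|t u v].
  by rewrite !addr_ge0 // mulr_ge0.
set d := nrm PE (u - v); have d0 : 0 <= d := nrm_ge0 _ _.
set p := retract PE u; set q := retract PE v.
have pq : nrm PE (p - q) <= 2 * d by exact: retract_lip.
have p1 : nrm PE p <= 1 by exact: retract_le1.
have q1 : nrm PE q <= 1 by exact: retract_le1.
have d1 : nrm E (u.1 - v.1) <= d := nrm_fst E (u - v).
have d2 : nrm E (u.2 - v.2) <= d := nrm_snd E (u - v).
have t1 : `|t| <= 1 + t ^+ 2.
  have := sqr_ge0 (`|t| - 1); rewrite sqrrB real_normK ?num_real // expr1n mulr1.
  by have := normr_ge0 t; rewrite mulr2n; lra.
have N1 := nonlinear_lip cF1 p1 q1 (nrm_fst E (p - q)) (le_trans (nrm_fst E q) q1).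
have N2 := nonlinear_lip cF2 p1 q1 (nrm_snd E (p - q)) (le_trans (nrm_snd E q) q1).
have Kpq : 3 * K * nrm PE (p - q) <= 6 * K * d.
  have : 3 * K * nrm PE (p - q) <= 3 * K * (2 * d) by rewrite ler_wpM2l // mulr_ge0.
  by lra.
have T (x : V) : nrm E x <= d -> nrm E (t *: x) <= (1 + t ^+ 2) * d.
  by move=> xd; rewrite nrmZ ler_pM ?nrm_ge0.
have c1 : nrm E (field t u - field t v).1 <= ((1 + t ^+ 2) + g + 6 * K) * d.
  rewrite /field /= -/p -/q -JN -JD nrmJ.
  have -> : t *: u.1 + G u.2 + F1 (ip p.1 p.1) *: p.1 -
      (t *: v.1 + G v.2 + F1 (ip q.1 q.1) *: q.1) =
      t *: (u.1 - v.1) + G (u.2 - v.2) +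
      (F1 (ip p.1 p.1) *: p.1 - F1 (ip q.1 q.1) *: q.1).
    by apply: (@ip_inj _ _ E) => e; rewrite GD GN !ipE; ring.
  have k1 := T _ d1; have k2 := le_trans (hg (u.2 - v.2)) (ler_wpM2l g0 d2).
  apply: (le_trans (nrmD _ _ _)); move: N1 (nrmD E (t *: (u.1 - v.1)) (G (u.2 - v.2))).
  by lra.
have c2 : nrm E (field t u - field t v).2 <= ((1 + t ^+ 2) + g' + 6 * K) * d.
  rewrite /field /= -/p -/q -JN -JD nrmJ.
  have -> : Gs u.1 - t *: u.2 + F2 (ip p.1 p.1) *: p.2 -
      (Gs v.1 - t *: v.2 + F2 (ip q.1 q.1) *: q.2) =
      - (t *: (u.2 - v.2)) + Gs (u.1 - v.1) +
      (F2 (ip p.1 p.1) *: p.2 - F2 (ip q.1 q.1) *: q.2).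
    by apply: (@ip_inj _ _ E) => e; rewrite GsD GsN !ipE; ring.
  have k1 := T _ d2; have k2 := le_trans (hg' (u.1 - v.1)) (ler_wpM2l g'0 d1).
  apply: (le_trans (nrmD _ _ _)); rewrite -(nrmN E (t *: (u.2 - v.2))) in k1.
  by move: N2 (nrmD E (- (t *: (u.2 - v.2))) (Gs (u.1 - v.1))); lra.
rewrite (le_trans (nrm_pair _ _)) // (le_trans (lerD c1 c2)) //.
rewrite -mulrDl ler_wpM2r //.
have t2 := sqr_ge0 t; have : 0 <= (g + g' + 12 * K) * t ^+ 2.
  by rewrite mulr_ge0 // !addr_ge0 // mulr_ge0.
by lra.
Qed.

Lemma wcont_ip (v w : R -> V) : wcont E v -> wcont E w ->
  continuous (fun t => ip (v t) (w t)).
Proof.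
move=> cv cw; under eq_fun do rewrite ip_frame.
apply: continuous_big; first exact: add_continuous.
by move=> k _ t; apply: cvgM; [exact: cv|exact: cw].
Qed.

Let wcont_linear (L L' : V -> V) (w : R -> V) :
  (forall u v, ip (L u) v = ip u (L' v)) -> wcont E w -> wcont E (fun t => L (w t)).
Proof. by move=> adj cw e; under eq_fun do rewrite adj; exact: cw. Qed.

Let wcontD (v w : R -> V) : wcont E v -> wcont E w -> wcont E (fun t => v t + w t).
Proof.
move=> cv cw e; under eq_fun do rewrite ipDl.
by move=> t; apply: cvgD; [exact: cv|exact: cw].
Qed.

Let wcontB (v w : R -> V) : wcont E v -> wcont E w -> wcont E (fun t => v t - w t).
Proof.
move=> cv cw e; under eq_fun do rewrite ipBl.
by move=> t; apply: cvgB; [exact: cv|exact: cw].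
Qed.

Let wcontZ (f : R -> R) (w : R -> V) : continuous f -> wcont E w ->
  wcont E (fun t => f t *: w t).
Proof.
move=> cf cw e; under eq_fun do rewrite ipZl.
by move=> t; apply: cvgM; [exact: cf|exact: cw].
Qed.

Let J_adj u v : ip (J u) v = ip u (- J v).
Proof. by rewrite J_skew ipNr. Qed.

Let field_cont w : wcont PE w -> wcont PE (fun t => field t (w t)).
Proof.
move=> cw; have c1 := wcont_fst cw; have c2 := wcont_snd cw.
pose beta t := (Num.max 1 (nrm PE (w t)))^-1.
have cb : continuous beta.
  move=> t; apply: cvgV; first by rewrite gt_eqF // retract_gt0.
  apply: (@continuous_max _ _ (fun=> 1 : R) (fun t => nrm PE (w t))); first exact: cvg_cst.
  apply: (@continuous_comp _ _ _ (fun t => prod_ip E (w t) (w t)) (@Num.sqrt R)).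
    by apply: cvgD; exact: wcont_ip.
  exact: sqrt_continuous.
have cv1 : wcont E (fun t => (retract PE (w t)).1) by exact: wcontZ.
have cv2 : wcont E (fun t => (retract PE (w t)).2) by exact: wcontZ.
have cF (F dF : R -> R) : c11 K F dF ->
    continuous (fun t => F (ip (retract PE (w t)).1 (retract PE (w t)).1)).
  move=> [dF' _ _ _ _] t.
  apply: (@continuous_comp _ _ _ (fun t => ip (retract PE (w t)).1 (retract PE (w t)).1) F).
    exact: wcont_ip.
  by apply/differentiable_continuous/derivable1_diffP; have [] := dF' (ip (retract PE (w t)).1 (retract PE (w t)).1).
have cid : continuous (fun t : R => t) by move=> t; exact: cvg_id.
apply: wcont_pair; apply: wcont_linear J_adj _.
  by apply/wcontD; [apply/wcontD; [exact: wcontZ|exact: wcont_linear G_adj _]|apply: wcontZ => //; exact: cF cF1].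
apply/wcontD; last by apply: wcontZ => //; exact: cF cF2.
by apply/wcontB; [exact: wcont_linear (Gs_adj G_adj) _|exact: wcontZ].
Qed.

Let ip_J u : ip u (J u) = 0. Proof. exact: ip_J. Qed.

(** The off-diagonal coupling is skew on the product space; conservation of the norm and continuous
    dependence both rest on this. *)
Let ip_cross u v : ip u (J (G v)) + ip v (J (Gs u)) = 0.
Proof.
by rewrite -GsJ -G_adj (ipC E (G v)) J_skew subrr.
Qed.

(** The truncated field is orthogonal to the solution, so the norm stays 1, where the retraction is
    the identity: the truncated solution is a true one. *)
Lemma global_flow (t0 : R) (u0 : V * V) : nrm PE u0 = 1 ->
  exists u, [/\ flow u, u t0 = u0 & forall s, nrm PE (u s) = 1].
Proof.
move=> u01; have [c c0 hc] := field_lip.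
pose l (t : R) := c * (t + 3^-1 * t ^+ 3 - (t0 + 3^-1 * t0 ^+ 3)).
pose l' (t : R) := c * (1 + t ^+ 2).
have dl (t : R) : is_derive t 1 l (l' t).
  apply: (der_eq (derZ c (derB (derD (der_id t) (derZ 3^-1 (derX 3 (der_id t)))) (der_cst _ _)))).
  by rewrite /l' /= mulr1 subr0; field.
have l0 : l t0 = 0 by rewrite /l subrr mulr0.
have l'0 t : 0 <= l' t by rewrite mulr_ge0 // addr_ge0 // sqr_ge0.
have field0 t : field t 0 = 0.
  have z1 : (0 : V * V).1 = 0 by []. have z2 : (0 : V * V).2 = 0 by [].
  have J0 : J 0 = 0 := linear0 J; have G0 : G 0 = 0 := linear0 G.
  have Gs0 : Gs 0 = 0 := linear0 Gs.
  by rewrite /field /retract scaler0 z1 z2 !scaler0 G0 Gs0 !addr0 subrr J0.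
(* The truncated field vanishes at 0, so its Lipschitz bound between [u0] and 0, at distance 1,
   provides the constant 1. *)
have hb t : nrm PE (field t u0) <= 1 * l' t.
  by have := hc t u0 0; rewrite field0 !subr0 u01 mulr1 mul1r.
have [u [du u0E]] := picard_lindelof dl l0 l'0 hc hb field_cont ler01.
have orth t : prod_ip E (u t) (field t (u t)) = 0.
  rewrite /prod_ip /field /= !linE !ipE !ip_J.
  by have := ip_cross (u t).1 (u t).2; rewrite !mulr0; lra.
have cons s t : prod_ip E (u t) (u t) <= prod_ip E (u s) (u s).
  have := @gronwall _ _ PE u _ 0 s t du.
  rewrite mulr0 mul0r expR0 mulr1; apply => x.
  by rewrite /= orth normr0 mul0r.
have u1 s : nrm PE (u s) = 1.
  by rewrite -u01 -u0E /nrm; congr Num.sqrt; apply/eqP; rewrite eq_le !cons.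
exists u; split=> // s; have hs := du s; have h1 := wder_fst hs; have h2 := wder_snd hs.
have rid : retract PE (u s) = u s by rewrite retract_id // u1.
rewrite /field rid /= in h1 h2.
split; [apply: (wder_eq h1)|apply: (wder_eq h2)]; congr (J _);
  apply: (@ip_inj _ _ E) => e; rewrite !ipE; ring.
Qed.

(** Arbitrary real coefficients [a] and [b] admit a nonlinearity still written in both norms, as for
    a solution whose norm is not yet known to be 1. *)
Lemma norm_conserved (u : R -> V * V) (a b : R -> R) s t :
  (forall x, wder E (fun t => (u t).1) x (J (a x *: (u x).1 + G (u x).2))) ->
  (forall x, wder E (fun t => (u t).2) x (J (b x *: (u x).2 + Gs (u x).1))) ->
  nrm PE (u s) = nrm PE (u t).
Proof.
move=> h1 h2; rewrite /nrm; congr Num.sqrt; apply/eqP; rewrite eq_le.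
pose d x := (J (a x *: (u x).1 + G (u x).2), J (b x *: (u x).2 + Gs (u x).1)).
have du x : wder PE u x (d x) by exact: wder_pair.
have orth x : prod_ip E (u x) (d x) = 0.
  rewrite /prod_ip /d /= !linE !ipE !ip_J.
  by have := ip_cross (u x).1 (u x).2; rewrite !mulr0; lra.
have le x y : prod_ip E (u y) (u y) <= prod_ip E (u x) (u x).
  have := @gronwall _ _ PE u _ 0 x y du.
  by rewrite mulr0 mul0r expR0 mulr1; apply => z; rewrite /= orth normr0 mul0r.
by rewrite !le.
Qed.

(** The skew linear part and the common rotation drop out of the difference. What remains are the
    differences of the frequencies, at most [2 K] times the distance of the first components. *)
Lemma flow_dependence u v s t : flow u -> flow v ->
  (forall x, nrm PE (u x) = 1) -> (forall x, nrm PE (v x) = 1) ->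
  prod_ip E (u t - v t) (u t - v t) <=
  prod_ip E (u s - v s) (u s - v s) * expR (2 * (4 * K) * `|t - s|).
Proof.
move=> fu fv u1 v1.
pose d (u : R -> V * V) x := (J ((x + F1 (ip (u x).1 (u x).1)) *: (u x).1 + G (u x).2),
             J ((F2 (ip (u x).1 (u x).1) - x) *: (u x).2 + Gs (u x).1)).
have du x : wder PE u x (d u x) by have [h1 h2] := fu x; exact: wder_pair.
have dv x : wder PE v x (d v x) by have [h1 h2] := fv x; exact: wder_pair.
apply: (@gronwall _ _ PE (fun x => u x - v x) (fun x => d u x - d v x)) => x.
  exact: wderB.
set a1 := (u x).1; set a2 := (u x).2; set b1 := (v x).1; set b2 := (v x).2.
have na1 : ip a1 a1 <= 1 by apply: ball_fst; rewrite u1.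
have nb1 : ip b1 b1 <= 1 by apply: ball_fst; rewrite v1.
have nb2 : nrm E b2 <= 1 by rewrite (le_trans (nrm_snd E (v x))) // v1.
set n := ip a1 a1; set m := ip b1 b1.
have E1 : prod_ip E (u x - v x) (d u x - d v x) =
   (F1 n - F1 m) * ip (a1 - b1) (J b1) + (F2 n - F2 m) * ip (a2 - b2) (J b2).
  have -> : d u x - d v x =
    (J ((x + F1 n) *: (a1 - b1) + (F1 n - F1 m) *: b1 + G (a2 - b2)),
     J ((F2 n - x) *: (a2 - b2) + (F2 n - F2 m) *: b2 + Gs (a1 - b1))).
    congr (_, _); apply: (@ip_inj _ _ E) => e;
      by rewrite /= -/a1 -/a2 -/b1 -/b2 -/n -/m !linE !ipE; ring.
  rewrite /prod_ip /= -/a1 -/a2 -/b1 -/b2.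
  have := ip_cross (a1 - b1) (a2 - b2).
  move: (ip_J (a1 - b1)) (ip_J (a2 - b2)).
  move: (a1 - b1) (a2 - b2) => p q hp hq hpq.
  by rewrite !(JD, JZ) !ipDr !ipZr hp hq; lra.
rewrite /= E1.
set p := nrm E (a1 - b1); set q := nrm E (a2 - b2).
have p0 : 0 <= p := nrm_ge0 _ _; have q0 : 0 <= q := nrm_ge0 _ _.
have nm : `|n - m| <= 2 * p by exact: ip_sub_le.
have n01 : 0 <= n <= 1 by rewrite ip_ge0.
have m01 : 0 <= m <= 1 by rewrite ip_ge0.
have Fd F dF : c11 K F dF -> `|F n - F m| <= K * (2 * p).
  by move=> [_ _ _ _ h]; rewrite (le_trans (h _ _ n01 m01)) // ler_wpM2l.
have t1 : `|(F1 n - F1 m) * ip (a1 - b1) (J b1)| <= K * (2 * p) * (p * 1).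
  rewrite normrM ler_pM ?(Fd _ _ cF1) // (le_trans (cauchy_schwarz _ _ _)) //.
  by rewrite ler_wpM2l // nrmJ nrm_le1.
have t2 : `|(F2 n - F2 m) * ip (a2 - b2) (J b2)| <= K * (2 * p) * (q * 1).
  rewrite normrM ler_pM ?(Fd _ _ cF2) // (le_trans (cauchy_schwarz _ _ _)) //.
  by rewrite ler_wpM2l // nrmJ.
rewrite (le_trans (ler_normD _ _)) // (le_trans (lerD t1 t2)) //.
rewrite /prod_ip /= -!sqr_nrm -/p -/q.
(* The excess of [4 K (p^2 + q^2)] over [2 K p^2 + 2 K p q]. *)
have : 0 <= K * (2 * p ^+ 2 + 4 * q ^+ 2 - 2 * p * q).
  rewrite mulr_ge0 //.
  by have := sqr_ge0 (p - q); have := sqr_ge0 q; have := sqr_ge0 p; nra.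
by nra.
Qed.

End System.

(** * Solutions at infinity *)

Section Compactness.
Variables (R : realType) (W : lmodType R) (E : euclid W).

(** Compactness of a box of frame coordinates. A redundant frame is harmless: the argument only
    rebuilds vectors from coordinates. *)
Lemma unit_cluster (a : nat -> W) : (forall n, nrm E (a n) <= 1) ->
  exists p, forall eps N, 0 < eps -> exists2 n, (N <= n)%N & nrm E (a n - p) <= eps.
Proof.
move=> a1; pose d := #|frame_index E|.
pose b (j : 'I_d) := frame E (enum_val j).
pose c n : 'rV[R]_d := \row_j ip E (a n) (b j).
have cpt := @rV_compact R d (fun j => `[- nrm E (b j), nrm E (b j)]%classic)
  (fun j => @segment_compact R _ _).
have cin n : forall j, `[- nrm E (b j), nrm E (b j)]%classic (c n ord0 j).
  move=> j; rewrite /c mxE /= in_itv /= -ler_norml.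
  rewrite (le_trans (cauchy_schwarz _ _ _)) // ler_piMl ?nrm_ge0 //.
have [|q [_ qcl]] := cpt (c @ \oo) _; first by exists 0%N => // n _; exact: cin.
pose S := \sum_j nrm E (b j).
have S0 : 0 <= S by apply: sumr_ge0 => j _; exact: nrm_ge0.
exists (\sum_j q ord0 j *: b j) => eps N eps0.
have e0 : 0 < eps / (1 + S) by rewrite divr_gt0 // ltr_pwDl.
have [_ [[n Nn <-] [_ /(_ ord0)]]] : [set c n | n in [set n | (N <= n)%N]] `&` ball q (eps / (1 + S)) !=set0.
  apply: qcl; last exact: nbhsx_ballx.
  by exists N => // n /= Nn; exists n.
move=> hb; exists n => //.
have -> : a n = \sum_j c n ord0 j *: b j.
  rewrite {1}(frame_sum E (a n)).
  rewrite (reindex (enum_val : 'I_d -> frame_index E)) /=; last exact/onW_bij/enum_val_bij.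
  by apply: eq_bigr => j _; rewrite /c mxE.
rewrite -sumrB (le_trans (nrm_sum _ _)) //.
rewrite (@le_trans _ _ (\sum_j (eps / (1 + S)) * nrm E (b j))) //.
  apply: ler_sum => j _; rewrite -scalerBl nrmZ ler_wpM2r ?nrm_ge0 //.
  by have := hb j; rewrite /ball /= distrC => /ltW.
rewrite -mulr_sumr -/S mulrAC ler_pdivrMr ?ltr_pwDl //.
by apply: ler_wpM2l; [exact: ltW|rewrite lerDr].
Qed.

End Compactness.

Lemma dist_max_ge0 (R : realDomainType) (x y : R) : 0 <= x -> 0 <= y ->
  `|x - y| <= Num.max x y.
Proof.
move=> x0 y0; rewrite ler_norml; apply/andP; split.
  by rewrite lerNl opprB lerBlDr (le_trans (_ : y <= Num.max x y)) ?lerDl ?le_max ?lexx ?orbT.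
by rewrite lerBlDr (le_trans (_ : x <= Num.max x y)) ?lerDl ?le_max ?lexx.
Qed.

Section InitialData.
Variables (R : realType) (V : lmodType R) (E : euclid V).
Variables G Gs : {linear V -> V}.
Hypothesis G_adj : forall u v, ip E (G u) v = ip E u (Gs v).

Local Notation ip := (ip E).

(* At time [T = (2 h)^-1] the vector [(z1 - h G z2, z2 + h Gs z1)] cancels the
   first-order oscillation; normalizing it costs only [O(h ^+ 2)]. *)
Lemma initial_data (K : R) : 0 <= K -> exists2 C, 0 <= C &
  forall (nw h : R) (z1 z2 : V), 0 <= nw <= 1 -> 0 < h <= 1 ->
    ip z1 z1 = nw -> ip z2 z2 = 1 - nw ->
  exists u : V * V, [/\ nrm (prod_euclid E) u = 1, nrm E (u.1 - z1) <= C * h,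
     nrm E (u.2 - z2) <= C * h
   & forall ia, `|ia| <= 2 * h -> `|ia - h| <= K * h ^+ 2 ->
       `|ip u.1 u.1 - nw + 2 * (ip u.1 (G u.2) * ia)| <= C * h ^+ 2].
Proof.
move=> K0; have [g1 g10 hg1] := linear_bounded E E G.
have [g2 g20 hg2] := linear_bounded E E Gs.
pose g := g1 + g2.
have g0 : 0 <= g by rewrite addr_ge0.
have hg v : nrm E (G v) <= g * nrm E v.
  by rewrite (le_trans (hg1 v)) // ler_wpM2r ?nrm_ge0 // lerDl.
have hgs v : nrm E (Gs v) <= g * nrm E v.
  by rewrite (le_trans (hg2 v)) // ler_wpM2r ?nrm_ge0 // lerDr.
(* In order: normalization, the displacement by [h G z2] or [h Gs z1], the error of [ia] against
   [h], the square of the displacement, and the second-order part of [<u1, G u2>] times [ia]. *)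
pose C := 2 * g ^+ 2 + g + 2 * g * K + g ^+ 2 + 4 * (g ^+ 2 + g ^+ 3).
have C0 : 0 <= C by rewrite !addr_ge0 ?mulr_ge0 ?exprn_ge0 // !addr_ge0 ?exprn_ge0.
exists C => // nw h z1 z2 /andP[nw0 nw1] /andP[h0 h1] z1E z2E.
have z11 : nrm E z1 <= 1 by apply: nrm_le1; rewrite z1E.
have z21 : nrm E z2 <= 1 by apply: nrm_le1; rewrite z2E gerBl.
have Gz2 : nrm E (G z2) <= g by rewrite (le_trans (hg _)) // ler_piMr.
have Gz1 : nrm E (Gs z1) <= g by rewrite (le_trans (hgs _)) // ler_piMr.
pose k1 := ip (G z2) (G z2); pose k2 := ip (Gs z1) (Gs z1).
pose p := ip z1 (G z2); pose rho := ip (G z2) (G (Gs z1)).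
have k10 : 0 <= k1 by exact: ip_ge0.
have k20 : 0 <= k2 by exact: ip_ge0.
have k1g : k1 <= g ^+ 2 by rewrite /k1 -sqr_nrm lerXn2r ?nnegrE ?nrm_ge0.
have k2g : k2 <= g ^+ 2 by rewrite /k2 -sqr_nrm lerXn2r ?nnegrE ?nrm_ge0.
have pg : `|p| <= g.
  rewrite (le_trans (cauchy_schwarz _ _ _)) // -[leRHS]mul1r.
  by rewrite ler_pM ?nrm_ge0.
have rhog : `|rho| <= g ^+ 3.
  rewrite (le_trans (cauchy_schwarz _ _ _)) // exprS expr2 ler_pM ?nrm_ge0 //.
  by rewrite (le_trans (hg _)) // ler_wpM2l.
pose y1 := z1 - h *: G z2; pose y2 := z2 + h *: Gs z1.
have y11 : ip y1 y1 = nw - 2 * h * p + h ^+ 2 * k1.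
  by rewrite /y1 !(ipBl, ipBr, ipZl, ipZr) z1E (ipC E (G z2) z1) /p /k1; ring.
have y22 : ip y2 y2 = 1 - nw + 2 * h * p + h ^+ 2 * k2.
  rewrite /y2 !(ipDl, ipDr, ipZl, ipZr) z2E (ipC E (Gs z1) z2) -G_adj (ipC E (G z2)).
  by rewrite /p /k2; ring.
have y12 : ip y1 (G y2) = p + h * (k2 - k1) - h ^+ 2 * rho.
  have Gy2 : G y2 = G z2 + h *: G (Gs z1) by rewrite /y2 linearD linearZ.
  rewrite Gy2 /y1 !(ipBl, ipBr, ipDl, ipDr, ipZl, ipZr).
  rewrite -(ipC E (G (Gs z1))) G_adj -/k1 -/p -/rho -/k2; ring.
(* The first-order terms [- 2 h p] and [+ 2 h p] of the two squared norms cancel by adjointness, so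
   normalizing acts only at second order. *)
pose N := 1 + h ^+ 2 * (k1 + k2).
have N1 : 1 <= N by rewrite lerDl mulr_ge0 ?sqr_ge0 ?addr_ge0.
have N0 : 0 < N by exact: lt_le_trans N1.
have NE : prod_ip E (y1, y2) (y1, y2) = N.
  by rewrite /prod_ip /= y11 y22 /N; ring.
pose nu := Num.sqrt N.
have nu1 : 1 <= nu by rewrite -sqrtr1 ler_wsqrtr.
have nu0 : 0 < nu by exact: lt_le_trans nu1.
have nu2 : nu ^+ 2 = N by rewrite sqr_sqrtr // ltW.
have iN : `|N^-1 - 1| <= h ^+ 2 * (2 * g ^+ 2).
  rewrite distrC ger0_norm ?subr_ge0 ?invf_le1 //.
  have -> : 1 - N^-1 = N^-1 * (h ^+ 2 * (k1 + k2)) by rewrite /N; field; rewrite gt_eqF.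
  rewrite (@le_trans _ _ (h ^+ 2 * (k1 + k2))) //.
    by rewrite ler_piMl ?invf_le1 // mulr_ge0 ?sqr_ge0 ?addr_ge0.
  by rewrite ler_wpM2l ?sqr_ge0 //; lra.
have inu : `|nu^-1 - 1| <= h ^+ 2 * (2 * g ^+ 2).
  apply: le_trans iN; rewrite distrC [leRHS]distrC.
  rewrite !ger0_norm ?subr_ge0 ?invf_le1 // lerD2l lerN2 lef_pV2 ?posrE //.
  by rewrite -nu2 expr2 ler_peMl // ltW.
have inu1 : 0 < nu^-1 <= 1 by rewrite invr_gt0 nu0 invf_le1.
have close z k : nrm E z <= 1 -> nrm E k <= g ->
    nrm E (nu^-1 *: (z + h *: k) - z) <= C * h.
  move=> hz hk.
  have -> : nu^-1 *: (z + h *: k) - z = (nu^-1 - 1) *: z + (nu^-1 * h) *: k.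
    by apply: (@ip_inj _ _ E) => e; rewrite !(ipBl, ipDl, ipZl); ring.
  rewrite (le_trans (nrmD _ _ _)) // !nrmZ normrM.
  have /andP[inup inule] := inu1.
  rewrite (gtr0_norm inup) (gtr0_norm h0).
  have t1 : `|nu^-1 - 1| * nrm E z <= h ^+ 2 * (2 * g ^+ 2) * 1 by rewrite ler_pM ?nrm_ge0.
  have t2 : nu^-1 * h * nrm E k <= 1 * h * g.
    by rewrite ler_pM ?nrm_ge0 // ?mulr_ge0 ?(ltW h0) ?(ltW inup) // ler_wpM2r // ltW.
  rewrite (le_trans (lerD t1 t2)) // /C.
  have hh : h ^+ 2 <= h by rewrite expr2 ler_piMl // ltW.
  have : h ^+ 2 * (2 * g ^+ 2) <= h * (2 * g ^+ 2) by rewrite ler_wpM2r // mulr_ge0 // exprn_ge0.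
  have : 0 <= (2 * g * K + g ^+ 2 + 4 * (g ^+ 2 + g ^+ 3)) * h.
    by rewrite mulr_ge0 ?(ltW h0) // !addr_ge0 ?mulr_ge0 ?exprn_ge0 // addr_ge0 ?exprn_ge0.
  by lra.
exists (nu^-1 *: (y1, y2)); split.
- rewrite nrmZ gtr0_norm ?invr_gt0 // /nrm /= NE -/nu mulVf // gt_eqF //.
- by have := close z1 (- G z2) z11; rewrite nrmN scalerN; apply.
- exact: close.
move=> ia iah iah2 /=.
have -> : ip (nu^-1 *: y1) (nu^-1 *: y1) = N^-1 * (nw - 2 * h * p + h ^+ 2 * k1).
  by rewrite ipZl ipZr mulrA -expr2 exprVn nu2 y11.
have -> : ip (nu^-1 *: y1) (G (nu^-1 *: y2)) = N^-1 * (p + h * (k2 - k1) - h ^+ 2 * rho).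
  by rewrite linearZ /= ipZl ipZr mulrA -expr2 exprVn nu2 y12.
(* The first-order terms combine into [2 p (ia - h)], which is of second order by the assumption on
   [ia]. *)
have -> : N^-1 * (nw - 2 * h * p + h ^+ 2 * k1) - nw +
   2 * (N^-1 * (p + h * (k2 - k1) - h ^+ 2 * rho) * ia) =
   (N^-1 - 1) * nw + N^-1 * (2 * p * (ia - h) + h ^+ 2 * k1
     + 2 * (h * ((k2 - k1) - h * rho)) * ia) by ring.
have iN1 : 0 < N^-1 <= 1 by rewrite invr_gt0 N0 invf_le1.
have /andP[iNp iNle] := iN1.
have n2 : `|2 : R| = 2 by rewrite ger0_norm.
have t1 : `|(N^-1 - 1) * nw| <= h ^+ 2 * (2 * g ^+ 2) * 1.
  by rewrite normrM ler_pM // ger0_norm.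
have t2 : `|2 * p * (ia - h)| <= 2 * g * (K * h ^+ 2).
  by rewrite !normrM n2 ler_pM ?mulr_ge0 // ler_wpM2l.
have t3 : `|h ^+ 2 * k1| <= h ^+ 2 * g ^+ 2.
  by have h2 := sqr_ge0 h; rewrite ger0_norm; [exact: ler_wpM2l|exact: mulr_ge0].
have t4 : `|2 * (h * ((k2 - k1) - h * rho)) * ia| <= 2 * (h * (g ^+ 2 + g ^+ 3)) * (2 * h).
  rewrite !normrM n2 (gtr0_norm h0) ler_pM ?mulr_ge0 ?(ltW h0) //.
  rewrite ler_wpM2l // ler_wpM2l ?(ltW h0) // (le_trans (ler_normB _ _)) // lerD //.
    by rewrite (le_trans (dist_max_ge0 k20 k10)) // ge_max k2g k1g.
  rewrite normrM (gtr0_norm h0) (le_trans _ rhog) // ler_piMl //.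
apply: le_trans (ler_normD _ _) _.
have t5 : `|N^-1 * (2 * p * (ia - h) + h ^+ 2 * k1 + 2 * (h * ((k2 - k1) - h * rho)) * ia)|
   <= 2 * g * (K * h ^+ 2) + h ^+ 2 * g ^+ 2 + 2 * (h * (g ^+ 2 + g ^+ 3)) * (2 * h).
  rewrite normrM (gtr0_norm iNp) (le_trans (ler_piMl _ iNle)) //.
  by rewrite (le_trans (ler_normD _ _)) // lerD // (le_trans (ler_normD _ _)) // lerD.
rewrite (le_trans (lerD t1 t5)) // /C.
have gh : 0 <= g * h ^+ 2 by rewrite mulr_ge0 // sqr_ge0.
by clear -gh; lra.
Qed.

End InitialData.

Section Infinity.
Variables (R : realType) (V : lmodType R) (E : euclid V).
Variables J G Gs : {linear V -> V}.
Hypothesis J_skew : forall u v, ip E (J u) v = - ip E u (J v).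
Hypothesis J_sq : forall u, J (J u) = - u.
Hypothesis GJ : forall u, G (J u) = J (G u).
Hypothesis GsJ : forall u, Gs (J u) = J (Gs u).
Hypothesis G_adj : forall u v, ip E (G u) v = ip E u (Gs v).
Variables (F1 F2 dF1 dF2 : R -> R) (K : R).
Hypothesis cF1 : c11 K F1 dF1.
Hypothesis cF2 : c11 K F2 dF2.

Local Notation ip := (ip E).
Local Notation PE := (prod_euclid E).

(** Reads a function of [|u1|^2] as one of [|u2|^2 = 1 - |u1|^2], so that the second component
    becomes an instance of the first. *)
Lemma c11_reflect (F dF : R -> R) : c11 K F dF ->
  c11 K (fun x => F (1 - x)) (fun x => - dF (1 - x)).
Proof.
move=> [h1 h2 h3 h4 h5]; split.
- move=> x; have d := derB (der_cst 1 x) (der_id x).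
  by apply: (der_eq (@is_derive1_comp R F (fun t => 1 - t) x _ _ (h1 (1 - x)) d)); ring.
- move=> x /andP[x0 x1]; rewrite normrN; apply: h2; apply/andP; split; lra.
- move=> x y; rewrite opprK addrC distrC; apply: le_trans (h3 _ _) _.
  by rewrite le_eqVlt; apply/orP; left; rewrite distrC; apply/eqP; congr (_ * `|_|); ring.
- move=> x y; have := h4 (1 - x) (1 - y).
  have -> : 1 - x - (1 - y) = - (x - y) by ring.
  by rewrite sqrrN mulrN mulNr.
- move=> x y /andP[x0 x1] /andP[y0 y1].
  rewrite (le_trans (h5 _ _ _ _)) //; try by apply/andP; split; lra.
  have -> : 1 - x - (1 - y) = - (x - y) by ring.
  by rewrite normrN.
Qed.

Local Notation F1' := (fun x => F1 (1 - x)).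
Local Notation F2' := (fun x => F2 (1 - x)).

(** All that the analysis at infinity needs from the explicit exponentials: each component follows
    its free flow with constant norm. For the second one [G] and [Gs] trade places and
    [eps = -1]. *)
Definition profile (nw : R) (z : R -> V * V) := forall s, 0 < s ->
  [/\ wder E (fun t => (z t).1) s (free_flow J G Gs 1 F1 nw s (z s).1),
      wder E (fun t => (z t).2) s (free_flow J Gs G (-1) F2' (1 - nw) s (z s).2),
      ip (z s).1 (z s).1 = nw & ip (z s).2 (z s).2 = 1 - nw].

Let K_ge0 : 0 <= K := c11_ge0 cF1.

Let norm_split (u : V * V) : nrm PE u = 1 -> ip u.2 u.2 = 1 - ip u.1 u.1.
Proof.
move=> u1; have := sqr_nrm PE u; rewrite u1 expr1n /= /prod_ip => ->; ring.
Qed.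

Let norm1_fst (u : V * V) : nrm PE u = 1 -> ip u.1 u.1 <= 1.
Proof. by move=> u1; rewrite -subr_ge0 -(norm_split u1) ip_ge0. Qed.

Let norm1_snd (u : V * V) : nrm PE u = 1 -> ip u.2 u.2 <= 1.
Proof. by move=> u1; rewrite (norm_split u1) gerBl ip_ge0. Qed.

Section Families.
Variables (I : Type) (dom : I -> R -> Prop) (D : I -> R).
Hypothesis dom_ge1 : forall i s, dom i s -> 1 <= s.
Hypothesis dom_K : forall i s, dom i s -> 2 * K <= s.
Hypothesis D_ge0 : forall i, 0 <= D i.
Hypothesis dom_conv : forall i s t x, dom i s -> dom i t -> s <= x <= t -> dom i x.
Variables (u : I -> bool -> R -> V * V) (z : I -> R -> V * V) (nw : I -> R).
Hypothesis nw01 : forall i, 0 <= nw i <= 1.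
Hypothesis pz : forall i, profile (nw i) (z i).
Hypothesis fu : forall i b, flow E J G Gs F1 F2 (u i b).
Hypothesis u1 : forall i b s, nrm PE (u i b s) = 1.
Hypothesis diff : forall i s, dom i s -> nrm PE (u i true s - u i false s) <= D i.

Let M i b s := ip (u i b s).1 (u i b s).1 - nw i + 2 * (ip (u i b s).1 (G (u i b s).2)
  * (2 * 1 * s + (F1 (ip (u i b s).1 (u i b s).1) - F2 (ip (u i b s).1 (u i b s).1)))^-1).

Hypothesis end_M : terminal dom D normr 2 M.
Hypothesis end_1 : terminal dom D (nrm E) 1 (fun i b s => (u i b s).1 - (z i s).1).
Hypothesis end_2 : terminal dom D (nrm E) 1 (fun i b s => (u i b s).2 - (z i s).2).

Lemma flow_asymptotics :
  symbol dom D (nrm E) 1 (fun i b s => (u i b s).1 - (z i s).1) /\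
  symbol dom D (nrm E) 1 (fun i b s => (u i b s).2 - (z i s).2).
Proof.
have sgt0 i s : dom i s -> 0 < s by move=> /dom_ge1; exact: lt_le_trans.
split.
  apply: (component_asymptotics J_skew J_sq GJ GsJ G_adj (mul1r 1) cF1 cF2 dom_ge1 dom_K
    D_ge0 dom_conv (B := fun i b s => (u i b s).2) (nw := nw)) => //.
  - by move=> i b s _; exact: norm1_fst.
  - by move=> i b s _; exact: norm1_snd.
  - by move=> i s h; rewrite (le_trans (nrm_fst E (u i true s - u i false s))) ?diff.
  - by move=> i s h; rewrite (le_trans (nrm_snd E (u i true s - u i false s))) ?diff.
  - by move=> i b s h; have [h1 _] := fu i b s; rewrite mul1r.
  - by move=> i b s h; have [_ h2] := fu i b s; rewrite mul1r.
  - by move=> i s /sgt0 h; have [] := pz i h.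
have eps2 : -1 * -1 = 1 :> R by rewrite mulrNN mulr1.
apply: (component_asymptotics J_skew J_sq GsJ GJ (Gs_adj G_adj) eps2 (c11_reflect cF2)
  (c11_reflect cF1) dom_ge1 dom_K
  D_ge0 dom_conv (B := fun i b s => (u i b s).1) (nw := fun i => 1 - nw i)) => //.
- by move=> i; have /andP[h0 h1] := nw01 i; apply/andP; split; lra.
- by move=> i b s _; exact: norm1_snd.
- by move=> i b s _; exact: norm1_fst.
- by move=> i s h; rewrite (le_trans (nrm_snd E (u i true s - u i false s))) ?diff.
- by move=> i s h; rewrite (le_trans (nrm_fst E (u i true s - u i false s))) ?diff.
- move=> i b s h; have [_ h2] := fu i b s; rewrite (norm_split (u1 i b s)) subKr.
  by rewrite mulN1r [- s + _]addrC.
- move=> i b s h; have [h1 _] := fu i b s; rewrite (norm_split (u1 i b s)) subKr.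
  by rewrite mulN1r opprK [_ + s]addrC.
- by move=> i s /sgt0 h; have [] := pz i h.
have [C C0 hC] := end_M; exists C => // i s h e e0.
have [T sT [h1 h2]] := hC i s h e e0; exists T => //.
(* The [M] of the second component is minus that of the first: [n - nw] and [a] change sign while
   [x] is unchanged. Hence one terminal hypothesis serves both. *)
have key b : ip (u i b T).2 (u i b T).2 - (1 - nw i) +
    2 * (ip (u i b T).2 (Gs (u i b T).1) * (2 * -1 * T +
      (F2 (1 - ip (u i b T).2 (u i b T).2) - F1 (1 - ip (u i b T).2 (u i b T).2)))^-1)
    = - M i b T.
  rewrite /M (norm_split (u1 i b T)) subKr.
  have -> : 2 * -1 * T + (F2 (ip (u i b T).1 (u i b T).1) - F1 (ip (u i b T).1 (u i b T).1))
    = - (2 * 1 * T + (F1 (ip (u i b T).1 (u i b T).1) - F2 (ip (u i b T).1 (u i b T).1))) by ring.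
  by rewrite invrN -G_adj (ipC E (G _)); ring.
split=> [b|]; rewrite !key ?normrN //.
by rewrite -opprD normrN.
Qed.

End Families.

Definition tends_to (u z : R -> V * V) := forall eps, 0 < eps ->
  exists T0, forall T, T0 <= T -> nrm PE (u T - z T) <= eps.

(** The constant in front of [D i / s] is independent of the bound [D i], so far enough out any
    bound on the difference can be halved indefinitely. The two solutions agree there, hence
    everywhere by continuous dependence. *)
Theorem flow_unique_at_infinity nw z u v : 0 <= nw <= 1 -> profile nw z ->
  flow E J G Gs F1 F2 u -> flow E J G Gs F1 F2 v ->
  (forall s, nrm PE (u s) = 1) -> (forall s, nrm PE (v s) = 1) ->
  tends_to u z -> tends_to v z -> forall s, u s = v s.
Proof.
move=> nw01 pz fu fv u1 v1 uz vz; pose s0 := Num.max 1 (2 * K).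
(* The index ranges over all pairs of a bound on the difference and a half-line where it holds,
   which makes the constants uniform in the bound. *)
pose I := {p : R * R | [/\ 0 <= p.1, s0 <= p.2 &
  forall s, p.2 <= s -> nrm PE (u s - v s) <= p.1]}.
pose dom (i : I) (s : R) := (sval i).2 <= s.
pose D (i : I) := (sval i).1.
pose w (i : I) (b : bool) := if b then u else v.
have dom_s0 (i : I) s : dom i s -> s0 <= s.
  by have [_ hp _] := svalP i; exact: le_trans.
have dom_ge1 i s : dom i s -> 1 <= s.
  by move=> /dom_s0; apply: le_trans; rewrite le_max lexx.
have dom_K i s : dom i s -> 2 * K <= s.
  by move=> /dom_s0; apply: le_trans; rewrite le_max lexx orbT.
have D_ge0 i : 0 <= D i by have [] := svalP i.
have dom_conv i s t x : dom i s -> dom i t -> s <= x <= t -> dom i x.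
  by move=> hs _ /andP[sx _]; exact: le_trans hs sx.
have fw i b : flow E J G Gs F1 F2 (w i b) by case: b.
have w1 i b s : nrm PE (w i b s) = 1 by case: b => /=.
have diff i s : dom i s -> nrm PE (w i true s - w i false s) <= D i.
  by move=> hs; have [_ _ h] := svalP i; exact: h.
have lim i s e : dom i s -> 0 < e -> exists2 T, s <= T /\ dom i T &
    T^-1 <= e /\ forall b, nrm PE (w i b T - z T) <= e.
  move=> hs e0; have [T1 h1] := uz e e0; have [T2 h2] := vz e e0.
  exists (Num.max (Num.max s e^-1) (Num.max T1 T2)).
    have sT : s <= Num.max (Num.max s e^-1) (Num.max T1 T2) by rewrite !le_max lexx.
    by split=> //; exact: le_trans hs sT.
  split.
    rewrite invf_ple ?posrE // ?le_max ?lexx ?orbT //.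
    by rewrite lt_max lt_max invr_gt0 e0 orbT.
  by case; [apply: h1|apply: h2]; rewrite !le_max lexx !orbT.
have [end_1 end_M] := @terminal_of_limit _ _ E G 1 F1 F2 dF1 dF2 K (mul1r 1) cF1 cF2
  I dom D dom_ge1 dom_K D_ge0 (fun i b s => (w i b s).1) (fun i b s => (w i b s).2)
  (fun i s => (z s).1) (fun=> nw) (fun=> nw01)
  (fun i b s _ => norm1_fst (w1 i b s)) (fun i b s _ => norm1_snd (w1 i b s))
  (fun i s h => le_trans (nrm_fst E (w i true s - w i false s)) (diff i s h))
  (fun i s h => le_trans (nrm_snd E (w i true s - w i false s)) (diff i s h))
  (fun i s h => let: And4 _ _ e _ := pz s (lt_le_trans ltr01 (dom_ge1 i s h)) in e)
  (fun i s e h e0 => let: ex_intro2 T a (conj b c) := lim i s e h e0 in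
     ex_intro2 _ _ T a (conj b (fun k => le_trans (nrm_fst E (w i k T - z T)) (c k)))).
have end_2 : terminal dom D (nrm E) 1 (fun i b s => (w i b s).2 - (z s).2).
  exists 0 => // i s h e e0; have e2 : 0 < e / 2 by rewrite divr_gt0.
  have [T sT [_ hT]] := lim i s _ h e2; exists T => //.
  have hT2 b : nrm E ((w i b T).2 - (z T).2) <= e / 2.
    exact: le_trans (nrm_snd E (w i b T - z T)) (hT b).
  rewrite !mul0r add0r; split=> [b|]; first by apply: le_trans (hT2 b) _; lra.
  by rewrite (le_trans (nrmB _ _ _)) // (le_trans (lerD (hT2 _) (hT2 _))) // -splitr.
have [[C1 C10 h1] [C2 C20 h2]] := flow_asymptotics dom_ge1 dom_K D_ge0 dom_conv
  (fun=> nw01) (fun=> pz) fw w1 diff end_M end_1 end_2.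
(* Beyond [2 (C1 + C2)] the factor [(C1 + C2) / s] is at most 1/2. *)
pose s1 := Num.max s0 (2 * (C1 + C2)).
have s1_gt0 : 0 < s1 by rewrite !lt_max ltr01.
have halve d : 0 <= d -> (forall s, s1 <= s -> nrm PE (u s - v s) <= d) ->
    forall s, s1 <= s -> nrm PE (u s - v s) <= d / 2.
  move=> d0 hd s ss.
  have hi : [/\ 0 <= (d, s1).1, s0 <= (d, s1).2 &
     forall s, (d, s1).2 <= s -> nrm PE (u s - v s) <= (d, s1).1].
    by split=> //=; rewrite le_max lexx.
  have [_ g1] := h1 (exist _ _ hi) s ss; have [_ g2] := h2 (exist _ _ hi) s ss.
  have e1 : (u s).1 - (z s).1 - ((v s).1 - (z s).1) = (u s - v s).1.
    by rewrite opprB addrA subrK.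
  have e2 : (u s).2 - (z s).2 - ((v s).2 - (z s).2) = (u s - v s).2.
    by rewrite opprB addrA subrK.
  rewrite /= e1 expr1 in g1; rewrite /= e2 expr1 in g2.
  rewrite (le_trans (nrm_pair _ _)) // (le_trans (lerD g1 g2)) // -mulrDl /D /= -mulrDl.
  have sp : 0 < s by exact: lt_le_trans ss.
  have : 2 * (C1 + C2) <= s by apply: le_trans ss; rewrite le_max lexx orbT.
  by move=> /(ler_wpM2l d0); rewrite ler_pdivrMr //; lra.
(* The iteration starts from 2, the largest distance of two unit vectors. *)
have small k s : s1 <= s -> nrm PE (u s - v s) <= 2 * 2 ^- k.
  elim: k s => [|k IH] s ss.
    by rewrite expr0 invr1 mulr1 (le_trans (nrmB _ _ _)) // u1 v1.
  by rewrite exprSr invfM mulrA; apply: halve => //; rewrite mulr_ge0.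
have us1 : nrm PE (u s1 - v s1) = 0.
  by apply/eqP; rewrite eq_le nrm_ge0 andbT (@le_half_pow _ _ 2) // => k; exact: small.
move=> s; apply/eqP; rewrite -subr_eq0; apply/eqP/(@ip_eq0 _ _ PE)/eqP.
rewrite eq_le ip_ge0 andbT /=.
have := flow_dependence J_skew J_sq GsJ G_adj cF1 cF2 s1 s fu fv u1 v1.
have -> : prod_ip E (u s1 - v s1) (u s1 - v s1) = nrm PE (u s1 - v s1) ^+ 2 by rewrite sqr_nrm.
by rewrite us1 expr0n mul0r.
Qed.

(* Two equal solutions on the bounded domain [s0, T], prescribed at time [T]. *)
Lemma flow_approx : exists C s0 : R, [/\ 0 <= C, 0 < s0 &
  forall nw z T, 0 <= nw <= 1 -> profile nw z -> s0 <= T ->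
  exists u, [/\ flow E J G Gs F1 F2 u, forall s, nrm PE (u s) = 1 &
    forall s, s0 <= s <= T -> nrm E ((u s).1 - (z s).1) <= C * s^-1 /\
      nrm E ((u s).2 - (z s).2) <= C * s^-1]].
Proof.
have K4 : 0 <= 4 * K by rewrite mulr_ge0.
have [C0 C00 hC0] := initial_data G_adj K4.
pose s0 := Num.max 1 (2 * K).
have s01 : 1 <= s0 by rewrite le_max lexx.
have s0K : 2 * K <= s0 by rewrite le_max lexx orbT.
pose M nw (v : V * V) T := ip v.1 v.1 - nw + 2 * (ip v.1 (G v.2)
  * (2 * 1 * T + (F1 (ip v.1 v.1) - F2 (ip v.1 v.1)))^-1).
(* Every admissible end state, profile, final time and solution is an index, so the constants depend
   on none of them. *)
pose I := {p : (R * (R -> V * V)) * (R * (R -> V * V)) |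
  [/\ 0 <= p.1.1 <= 1, profile p.1.1 p.1.2, flow E J G Gs F1 F2 p.2.2,
      forall s, nrm PE (p.2.2 s) = 1 &
   [/\ s0 <= p.2.1, nrm E ((p.2.2 p.2.1).1 - (p.1.2 p.2.1).1) <= C0 * p.2.1^-1,
       nrm E ((p.2.2 p.2.1).2 - (p.1.2 p.2.1).2) <= C0 * p.2.1^-1
    & `|M p.1.1 (p.2.2 p.2.1) p.2.1| <= C0 * p.2.1 ^- 2]]}.
pose nw (i : I) := (sval i).1.1; pose z (i : I) := (sval i).1.2.
pose T (i : I) := (sval i).2.1; pose w (i : I) (b : bool) := (sval i).2.2.
pose D (i : I) : R := 0.
pose dom (i : I) (s : R) := s0 <= s <= T i.
have dom_ge1 i s : dom i s -> 1 <= s by move=> /andP[h _]; exact: le_trans h.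
have dom_K i s : dom i s -> 2 * K <= s by move=> /andP[h _]; exact: le_trans h.
have D_ge0 i : 0 <= D i by [].
have dom_conv i s t x : dom i s -> dom i t -> s <= x <= t -> dom i x.
  move=> /andP[hs _] /andP[_ ht] /andP[sx xt].
  by rewrite /dom (le_trans hs sx) (le_trans xt ht).
have domT i : dom i (T i) by have [_ _ _ _ [h _ _ _]] := svalP i; rewrite /dom h lexx.
have diff i s : dom i s -> nrm PE (w i true s - w i false s) <= D i.
  by rewrite subrr nrm0.
have at_end (X : zmodType) (N : X -> R) k (f : I -> bool -> R -> X) :
    N 0 = 0 -> (forall i s, f i true s = f i false s) ->
    (forall i, N (f i false (T i)) <= C0 * T i ^- k) -> terminal dom D N k f.
  move=> N0 ff fT; exists C0 => // i s h e e0; exists (T i).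
    by have /andP[_ sT] := h; split.
  have fT' b : N (f i b (T i)) <= C0 * T i ^- k + e.
    by rewrite (le_trans _ (_ : C0 * T i ^- k <= _)) ?lerDl ?(ltW e0) //; case: b; rewrite ?ff.
  by split=> //; rewrite ff subrr N0 mulr0 mul0r add0r ltW.
have [|||[C1 C10 h1] [C2 C20 h2]] := @flow_asymptotics I dom D dom_ge1 dom_K D_ge0 dom_conv
  w z nw (fun i => let: And5 a _ _ _ _ := svalP i in a)
  (fun i => let: And5 _ a _ _ _ := svalP i in a)
  (fun i b => let: And5 _ _ a _ _ := svalP i in a)
  (fun i b => let: And5 _ _ _ a _ := svalP i in a) diff.
- apply: at_end => //; first exact: normr0.
  by move=> i; have [_ _ _ _ [_ _ _ h]] := svalP i.
- apply: at_end => //; first exact: nrm0.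
  by move=> i; have [_ _ _ _ [_ h _ _]] := svalP i; rewrite expr1.
- apply: at_end => //; first exact: nrm0.
  by move=> i; have [_ _ _ _ [_ _ h _]] := svalP i; rewrite expr1.
exists (C1 + C2), s0; split; [exact: addr_ge0|exact: lt_le_trans s01|].
move=> nw' z' T' nw01 pz sT; have T1 : 1 <= T' by exact: le_trans sT.
have T0 : 0 < T' by exact: lt_le_trans T1.
(* [h] is the leading part of [a^-1] at the final time; the error is at most [4 K h^2], the form
   [initial_data] was instantiated for. *)
pose h := (2 * T')^-1.
have h0 : 0 < h by rewrite invr_gt0 mulr_gt0.
have h2T : 2 * h = T'^-1 by rewrite /h; field; rewrite gt_eqF.
have iT1 : T'^-1 <= 1 by rewrite invf_le1.
have hT : h <= T'^-1 by rewrite -h2T mulr_natl mulr2n lerDl ltW.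
have h01 : 0 < h <= 1 by rewrite h0 (le_trans hT).
have [_ _ z1E z2E] := pz T' T0.
have [u0 [u01 u0z1 u0z2 u0M]] := hC0 nw' h (z' T').1 (z' T').2 nw01 h01 z1E z2E.
have [u [fu uT u1]] := global_flow J_skew J_sq GsJ G_adj cF1 cF2 T' u01.
have [_ bF1 _ _ _] := cF1; have [_ bF2 _ _ _] := cF2.
have hi : [/\ 0 <= ((nw', z'), (T', u)).1.1 <= 1, profile nw' z', flow E J G Gs F1 F2 u,
      forall s, nrm PE (u s) = 1 &
   [/\ s0 <= T', nrm E ((u T').1 - (z' T').1) <= C0 * T'^-1,
       nrm E ((u T').2 - (z' T').2) <= C0 * T'^-1
    & `|M nw' (u T') T'| <= C0 * T' ^- 2]].
  split=> //; rewrite uT; split=> //.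
  - by rewrite (le_trans u0z1) // ler_wpM2l.
  - by rewrite (le_trans u0z2) // ler_wpM2l.
  rewrite (@le_trans _ _ (C0 * h ^+ 2)) //; last first.
    by rewrite ler_wpM2l // -exprVn lerXn2r ?nnegrE ?(ltW h0) // ltW // invr_gt0.
  have n01 : 0 <= ip u0.1 u0.1 <= 1 by rewrite ip_ge0 norm1_fst.
  have [b1 _] := bF1 _ n01; have [b2 _] := bF2 _ n01.
  rewrite /M; set f := F1 _ - F2 _.
  have fK : `|f| <= 2 * K by rewrite (le_trans (ler_normB _ _)) // mulr_natl mulr2n lerD.
  have aT : T' <= 2 * 1 * T' + f.
    rewrite mulr1 mulr_natl mulr2n -addrA lerDl -[f]opprK subr_ge0.
    by rewrite (le_trans (ler_norm _)) // normrN (le_trans fK) // (le_trans s0K).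
  have a0 : 0 < 2 * 1 * T' + f by exact: lt_le_trans aT.
  have ia : `|(2 * 1 * T' + f)^-1| <= 2 * h.
    by rewrite h2T ger0_norm ?invr_ge0 ?(ltW a0) // lef_pV2.
  apply: u0M => //.
  have -> : (2 * 1 * T' + f)^-1 - h = - f * (h * (2 * 1 * T' + f)^-1).
    set a := 2 * 1 * T' + f; have -> : f = a - 2 * T' by rewrite /a; ring.
    by rewrite /h; field; rewrite !gt_eqF.
  rewrite !normrM normrN (gtr0_norm h0).
  have -> : 4 * K * h ^+ 2 = 2 * K * (h * (2 * h)) by ring.
  by rewrite ler_pM // ?mulr_ge0 ?(ltW h0) // ler_wpM2l // ltW.
exists u; split=> // s hs; have [g1 _] := h1 (exist _ _ hi) s hs.
have [g2 _] := h2 (exist _ _ hi) s hs.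
have s0' : 0 <= s^-1.
  by have /andP[ss _] := hs; rewrite invr_ge0 (le_trans _ ss) // (le_trans _ s01).
split; [apply: le_trans (g1 true) _|apply: le_trans (g2 true) _];
  by rewrite expr1 ler_wpM2r // ?lerDl ?lerDr.
Qed.

(** Approximants prescribed at [s0 + n] have unit norm at [s0], where a cluster point is taken.
    Continuous dependence carries closeness at [s0] to any fixed later time, and the uniform bounds
    pass to the limit. *)
Theorem flow_exists_at_infinity : exists C s0 : R, [/\ 0 <= C, 0 < s0 &
  forall nw z, 0 <= nw <= 1 -> profile nw z ->
  exists u, [/\ flow E J G Gs F1 F2 u, forall s, nrm PE (u s) = 1 &
    forall s, s0 <= s -> nrm E ((u s).1 - (z s).1) <= C * s^-1 /\
      nrm E ((u s).2 - (z s).2) <= C * s^-1]].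
Proof.
have [C [s0 [C0 s00 hC]]] := flow_approx.
exists C, s0; split=> // nw z nw01 pz.
have hn (n : nat) := hC nw z (s0 + n%:R) nw01 pz.
have le_n (n : nat) : s0 <= s0 + n%:R by rewrite lerDl.
pose a n := projT1 (cid (hn n (le_n n))).
have aP n := projT2 (cid (hn n (le_n n))).
rewrite -/(a _) in aP.
have [|p hp] := @unit_cluster _ _ PE (fun n => a n s0).
  by move=> n; have [_ -> _] := aP n.
have p1 : nrm PE p = 1.
  apply/eqP; rewrite -subr_eq0 -normr_le0; apply/ler_addgt0Pr => e e0.
  have [n _ hne] := hp e 0%N e0; have [_ a1 _] := aP n.
  by rewrite add0r -(a1 s0) (le_trans (nrm_dist _ _ _)) // nrm_distC.
have [u [fu us0 u1]] := global_flow J_skew J_sq GsJ G_adj cF1 cF2 s0 p1.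
exists u; split=> // s ss.
have key e : 0 < e -> exists v : V * V, [/\ nrm PE (u s - v) <= e,
    nrm E (v.1 - (z s).1) <= C * s^-1 & nrm E (v.2 - (z s).2) <= C * s^-1].
  move=> e0; pose c := expR (4 * K * `|s - s0|).
  have c0 : 0 < c by exact: expR_gt0.
  have [N sN] : exists N : nat, s <= s0 + N%:R.
    by exists (Num.truncn (s - s0)).+1; rewrite -lerBlDl; apply/ltW; rewrite truncnS_gt.
  (* [c] is the square root of the Gronwall factor for squared norms on [[s0, s]], so a distance
     [e / c] at [s0] stays below [e] at [s]; [N] makes the interval of the approximant reach [s]. *)
  have [n Nn hne] := hp (e / c) N (divr_gt0 e0 c0); have [fa a1 ha] := aP n.
  exists (a n s); have sn : s0 <= s <= s0 + n%:R.
    by rewrite ss (le_trans sN) // lerD2l ler_nat.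
  have [g1 g2] := ha s sn; split=> //.
  have := flow_dependence J_skew J_sq GsJ G_adj cF1 cF2 s0 s fu fa u1 a1.
  have pE q : prod_ip E q q = nrm PE q ^+ 2 by rewrite sqr_nrm.
  rewrite !pE us0.
  have -> : expR (2 * (4 * K) * `|s - s0|) = c ^+ 2.
    by rewrite /c expr2 -expRD; congr expR; ring.
  rewrite -exprMn ler_pXn2r ?nnegrE ?mulr_ge0 ?nrm_ge0 ?(ltW c0) // => /le_trans; apply.
  by rewrite -ler_pdivlMr // nrm_distC.
split; apply/ler_addgt0Pr => e /key [v [hv v1 v2]].
  have -> : (u s).1 - (z s).1 = (v.1 - (z s).1) + (u s - v).1.
    by rewrite (_ : (u s - v).1 = (u s).1 - v.1) // [RHS]addrC addrA subrK.
  by rewrite (le_trans (nrmD _ _ _)) // lerD // (le_trans (nrm_fst E _)).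
have -> : (u s).2 - (z s).2 = (v.2 - (z s).2) + (u s - v).2.
  by rewrite (_ : (u s - v).2 = (u s).2 - v.2) // [RHS]addrC addrA subrK.
by rewrite (le_trans (nrmD _ _ _)) // lerD // (le_trans (nrm_snd E _)).
Qed.

End Infinity.

(** * The nonlinearity *)

Section Nonlinearity.
Variable R : realType.

(** The difference quotient with step [h] differs from [d] by at most [K |h|]. *)
Lemma derive_taylor (F : R -> R) (x d K : R) :
  (forall y, `|F y - F x - d * (y - x)| <= K * (y - x) ^+ 2) -> is_derive x 1 F d.
Proof.
move=> FK; have K0 : 0 <= K.
  have := FK (x + 1); rewrite [x + 1]addrC addrK expr1n !mulr1; exact: le_trans (normr_ge0 _).
suff h : h^-1 *: (F (h *: 1 + x) - F x) @[h --> 0^'] --> d.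
  by split; [apply/cvg_ex; exists d|exact/cvg_lim].
apply/cvgrPdist_le => /= e e0; near=> h.
have h0 : h != 0 by near: h; exact: nbhs_dnbhs_neq.
have hK : K * `|h| <= e.
  have : `|h| <= e / (1 + K).
    near: h; apply: dnbhs0_le; rewrite divr_gt0 // ltr_pwDl //.
  rewrite ler_pdivlMr ?ltr_pwDl // => /(le_trans _); apply.
  by rewrite mulrC ler_wpM2l // lerDr.
have := FK (h *: 1 + x); rewrite /GRing.scale /= mulr1 addrK => Fh.
rewrite distrC.
have -> : h^-1 * (F (h + x) - F x) - d = h^-1 * (F (h + x) - F x - d * h).
  by field.
rewrite normrM normfV ler_pdivrMl ?normr_gt0 // (le_trans Fh) //.
by rewrite -real_normK ?num_real // expr2 mulrCA ler_wpM2l.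
Unshelve. all: by end_near. Qed.

Lemma c11_taylor (F dF : R -> R) (K : R) : 0 <= K ->
  (forall x y, `|dF x - dF y| <= K * `|x - y|) ->
  (forall x y, `|F x - F y - dF y * (x - y)| <= K * (x - y) ^+ 2) ->
  c11 (`|F 0| + `|dF 0| + 2 * K) F dF.
Proof.
move=> K0 h1 h2; set L := _ + 2 * K.
have F0 := normr_ge0 (F 0); have dF0 := normr_ge0 (dF 0).
have KL : K <= L by rewrite /L; lra.
have bd x : 0 <= x <= 1 -> `|dF x| <= `|dF 0| + K.
  move=> /andP[x0 x1]; have := h1 x 0; rewrite subr0 (ger0_norm x0) => h.
  have := ler_normD (dF x - dF 0) (dF 0); rewrite subrK => h'.
  have : K * x <= K * 1 by rewrite ler_wpM2l.
  by lra.
split.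
- by move=> x; apply: derive_taylor => y; exact: h2.
- move=> x x01; have /andP[x0 x1] := x01; split; last first.
    by rewrite (le_trans (bd x x01)) // /L; lra.
  have := h2 x 0; rewrite subr0 => h.
  have : K * x ^+ 2 <= K * 1 by rewrite ler_wpM2l // expr_le1.
  have : `|dF 0 * x| <= `|dF 0| * 1 by rewrite normrM ler_wpM2l // ger0_norm.
  have -> : F x = (F x - F 0 - dF 0 * x) + F 0 + dF 0 * x by ring.
  move=> h3 h4; rewrite (le_trans (ler_normD _ _)) //.
  have := ler_normD (F x - F 0 - dF 0 * x) (F 0); rewrite /L; lra.
- by move=> x y; rewrite (le_trans (h1 x y)) // ler_wpM2r.
- by move=> x y; rewrite (le_trans (h2 x y)) // ler_wpM2r // sqr_ge0.
move=> x y /andP[x0 x1] /andP[y0 y1].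
have -> : F x - F y = (F x - F y - dF y * (x - y)) + dF y * (x - y) by ring.
have xy : `|x - y| <= 1 by rewrite ler_norml; apply/andP; split; lra.
rewrite (le_trans (ler_normD _ _)) //.
have : `|dF y * (x - y)| <= (`|dF 0| + K) * `|x - y|.
  by rewrite normrM ler_wpM2r // bd // y0.
have : K * (x - y) ^+ 2 <= K * `|x - y|.
  by rewrite ler_wpM2l // -real_normK ?num_real // expr2 ler_piMl.
have := h2 x y; have : 0 <= `|F 0| * `|x - y| by rewrite mulr_ge0.
by rewrite /L; lra.
Qed.

Lemma c11_le (K L : R) F dF : K <= L -> c11 K F dF -> c11 L F dF.
Proof.
move=> KL [h1 h2 h3 h4 h5]; split=> //.
- by move=> x /h2 [a b]; split; exact: le_trans KL.
- by move=> x y; rewrite (le_trans (h3 x y)) // ler_wpM2r.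
- by move=> x y; rewrite (le_trans (h4 x y)) // ler_wpM2r // sqr_ge0.
- by move=> x y hx hy; rewrite (le_trans (h5 x y hx hy)) // ler_wpM2r.
Qed.

Lemma derive_e1 (g : R * R -> R) (x y : R) : derivable g (x, y) (e1 R) ->
  is_derive x 1 (fun t => g (t, y)) ('D_(e1 R) g (x, y)).
Proof.
move=> dg; have E : (fun h => h^-1 *: (g (h *: e1 R + (x, y)) - g (x, y))) =
    (fun h => h^-1 *: (g (h *: (1 : R) + x, y) - g (x, y))).
  apply/funext => h; congr (_ *: (g _ - _)).
  by congr (_, _); rewrite /= /GRing.scale /= ?mulr0 ?add0r.
split; first by move: dg; rewrite /derivable E.
by rewrite /derive E.
Qed.

Lemma derive_e2 (g : R * R -> R) (x y : R) : derivable g (x, y) (e2 R) ->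
  is_derive y 1 (fun t => g (x, t)) ('D_(e2 R) g (x, y)).
Proof.
move=> dg; have E : (fun h => h^-1 *: (g (h *: e2 R + (x, y)) - g (x, y))) =
    (fun h => h^-1 *: (g (x, h *: (1 : R) + y) - g (x, y))).
  apply/funext => h; congr (_ *: (g _ - _)).
  by congr (_, _); rewrite /= /GRing.scale /= ?mulr0 ?add0r.
split; first by move: dg; rewrite /derivable E.
by rewrite /derive E.
Qed.

Lemma mvt_abs (f f' : R -> R) (L x y : R) : (forall t : R, is_derive t 1 f (f' t)) ->
  (forall t, minr x y <= t <= maxr x y -> `|f' t| <= L) -> `|f x - f y| <= L * `|x - y|.
Proof.
move=> df fL; have key a b : a <= b -> (forall t, a <= t <= b -> `|f' t| <= L) ->
    `|f b - f a| <= L * `|b - a|.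
  move=> ab h.
  have := @mvt_le R f f' (fun t => L * t) (fun=> L) a b ab (fun t _ => df t)
    (fun t _ => der_eq (derZ L (der_id t)) (mulr1 L)).
  rewrite -mulrBr [`|b - a|]ger0_norm ?subr_ge0 //; exact.
have [xy|/ltW yx] := leP x y.
  by rewrite distrC [`|x - y|]distrC; apply: key => // t h; apply: fL; rewrite min_l // max_r.
by apply: key => // t h; apply: fL; rewrite min_r // max_l.
Qed.

(** Only partial derivatives are at hand, so increments along the line [(x, 1 - x)] are split into a
    horizontal and a vertical move. This proves the Taylor bound directly, and differentiability
    follows from it. *)
Lemma C2_c11 (f : R * R -> R) (delta : R) : C2 f -> bounded_hessian f ->
  exists K dF, c11 K (fun x => delta * f (x, 1 - x)) dF.
Proof.
move=> [_ hf hf1 hf2] [M hM].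
have M0 : 0 <= M by apply: le_trans (hM (e1 R) (e1 R) 0 (or_introl erefl) (or_introl erefl)).
have i1 : e1 R = e1 R \/ e1 R = e2 R by left.
have i2 : e2 R = e1 R \/ e2 R = e2 R by right.
pose D1 : R * R -> R := 'D_(e1 R) f; pose D2 : R * R -> R := 'D_(e2 R) f.
have lip (g : R * R -> R) : has_continuous_partials g ->
    (forall v x, v = e1 R \/ v = e2 R -> `|'D_v g x| <= M) ->
    forall x y x' y', `|g (x, y) - g (x', y')| <= M * (`|x - x'| + `|y - y'|).
  move=> hg gM x y x' y'.
  have -> : g (x, y) - g (x', y') = (g (x, y) - g (x', y)) + (g (x', y) - g (x', y')) by ring.
  rewrite (le_trans (ler_normD _ _)) // mulrDr lerD //.
    apply: (mvt_abs (f := fun t => g (t, y)) (f' := fun t => 'D_(e1 R) g (t, y))) => t; last by move=> _; exact: gM i1.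
    by apply: derive_e1; have [d _] := hg _ i1; exact: d.
  apply: (mvt_abs (f := fun t => g (x', t)) (f' := fun t => 'D_(e2 R) g (x', t))) => t; last by move=> _; exact: gM i2.
  by apply: derive_e2; have [d _] := hg _ i2; exact: d.
have lip1 := lip D1 hf1 (fun v x hv => hM _ _ x i1 hv).
have lip2 := lip D2 hf2 (fun v x hv => hM _ _ x i2 hv).
pose h x := f (x, 1 - x); pose h' x := D1 (x, 1 - x) - D2 (x, 1 - x).
have dist1 (x y : R) : `|1 - x - (1 - y)| = `|x - y|.
  by rewrite distrC; congr `|_|; ring.
have lip' x y : `|h' x - h' y| <= 4 * M * `|x - y|.
  have := lip1 x (1 - x) y (1 - y); have := lip2 x (1 - x) y (1 - y).
  rewrite dist1 /h' => a1 a2.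
  have -> : D1 (x, 1 - x) - D2 (x, 1 - x) - (D1 (y, 1 - y) - D2 (y, 1 - y)) =
    (D1 (x, 1 - x) - D1 (y, 1 - y)) - (D2 (x, 1 - x) - D2 (y, 1 - y)) by ring.
  rewrite (le_trans (ler_normB _ _)) // (le_trans (lerD a2 a1)) //.
  by rewrite le_eqVlt; apply/orP; left; apply/eqP; ring.
have between (x y t : R) : minr x y <= t <= maxr x y -> `|t - y| <= `|x - y|.
  have [xy|/ltW yx] := leP x y; move=> /andP[t1 t2].
    by rewrite ![`|_ - y|]distrC !ger0_norm; lra.
  by rewrite !ger0_norm; lra.
have tay x y : `|h x - h y - h' y * (x - y)| <= 4 * M * (x - y) ^+ 2.
  (* The linear part is subtracted before applying the mean value bound, so the derivative met is a
     variation of [D1], itself of first order. The horizontal move runs at height [1 - x], hence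
     [2 M] here against [M] in [T2]. *)
  have T1 : `|f (x, 1 - x) - D1 (y, 1 - y) * x - (f (y, 1 - x) - D1 (y, 1 - y) * y)|
      <= 2 * M * `|x - y| * `|x - y|.
    apply: (mvt_abs (f := fun t => f (t, 1 - x) - D1 (y, 1 - y) * t)
       (f' := fun t => D1 (t, 1 - x) - D1 (y, 1 - y) * 1)) => t.
      apply: (derB _ (derZ _ (der_id t))).
      by apply: derive_e1; have [d _] := hf _ i1; exact: d.
    move=> /between ty; rewrite mulr1; have := lip1 t (1 - x) y (1 - y).
    rewrite dist1 => /le_trans; apply.
    by rewrite -mulrA mulrCA ler_wpM2l //; lra.
  have T2 : `|f (y, 1 - x) - D2 (y, 1 - y) * (1 - x) - (f (y, 1 - y) - D2 (y, 1 - y) * (1 - y))|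
      <= M * `|x - y| * `|x - y|.
    have -> : M * `|x - y| * `|x - y| = M * `|x - y| * `|1 - x - (1 - y)| by rewrite dist1.
    apply: (mvt_abs (f := fun t => f (y, t) - D2 (y, 1 - y) * t)
       (f' := fun t => D2 (y, t) - D2 (y, 1 - y) * 1)) => t.
      apply: (derB _ (derZ _ (der_id t))).
      by apply: derive_e2; have [d _] := hf _ i2; exact: d.
    move=> /between ty; rewrite mulr1; have := lip2 y t y (1 - y).
    rewrite subrr normr0 add0r => /le_trans; apply.
    by rewrite ler_wpM2l // -(dist1 x y).
  rewrite /h /h'.
  have -> : f (x, 1 - x) - f (y, 1 - y) - (D1 (y, 1 - y) - D2 (y, 1 - y)) * (x - y) =
     (f (x, 1 - x) - D1 (y, 1 - y) * x - (f (y, 1 - x) - D1 (y, 1 - y) * y)) +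
     (f (y, 1 - x) - D2 (y, 1 - y) * (1 - x) - (f (y, 1 - y) - D2 (y, 1 - y) * (1 - y))) by ring.
  rewrite (le_trans (ler_normD _ _)) // (le_trans (lerD T1 T2)) //.
  rewrite -(real_normK (num_real (x - y))).
  have := mulr_ge0 M0 (sqr_ge0 `|x - y|); lra.
exists (`|delta * h 0| + `|delta * h' 0| + 2 * (`|delta| * (4 * M))), (fun x => delta * h' x).
apply: (@c11_taylor (fun x => delta * h x) (fun x => delta * h' x)).
- by rewrite !mulr_ge0.
- by move=> x y; rewrite -mulrBr normrM -mulrA ler_wpM2l.
move=> x y; rewrite -mulrBr -mulrA -mulrBr normrM -mulrA ler_wpM2l //.
Qed.

End Nonlinearity.

(** * Functional calculus *)

Local Open Scope complex_scope.

Section Spectral.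
Variables (R : realType) (H : vectType R[i]) (dot : {dot H for conjC}).

Lemma dotC u v : dot u v = conjC (dot v u).
Proof. by rewrite hermC /= expr0 mul1r. Qed.

Lemma dotZl a u v : dot (a *: u) v = a * dot u v.
Proof. by rewrite linearZl_LR. Qed.

Lemma dotZr a u v : dot u (a *: v) = conjC a * dot u v.
Proof. by rewrite linearZr_LR. Qed.

Lemma dotDl u v w : dot (u + v) w = dot u w + dot v w.
Proof. by rewrite linearDl. Qed.

Lemma dotBl u v w : dot (u - v) w = dot u w - dot v w.
Proof. by rewrite linearBl. Qed.

Lemma dot_suml (I : finType) (F : I -> H) w :
  dot (\sum_i F i) w = \sum_i dot (F i) w.
Proof.
apply: (big_morph (fun u => dot u w)) => [u v|]; first exact: dotDl.
by rewrite -(scale0r (0 : H)) dotZl mul0r.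
Qed.

Lemma conjC_real (x : R) : conjC (x%:C) = x%:C.
Proof. by apply/CrealP/complex_realP; exists x. Qed.

Lemma dot_real u : exists x : R, dot u u = x%:C /\ 0 <= x.
Proof.
have := dnorm_ge0 dot u; case: (dot u u) => a b.
by rewrite lecE /= => /andP[/eqP -> a0]; exists a.
Qed.

Definition eigenbasis n (e : 'I_n -> H) (l : 'I_n -> R) (A : 'End(H)) :=
  [/\ forall i j, dot (e i) (e j) = (i == j)%:R,
      forall i, A (e i) = (l i)%:C *: e i
    & forall v, v = \sum_i dot v (e i) *: e i].

(** Algebraic closedness gives an eigenvalue of the matrix of [A] in a basis of [U]. Images are
    stored as rows, so row eigenvectors are the coordinates sought. *)
Lemma eigenvector_in (A : 'End(H)) (U : {vspace H}) :
  (A @: U <= U)%VS -> U != 0%VS ->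
  exists2 v, v \in U & v != 0 /\ exists a, A v = a *: v.
Proof.
move=> AU U0; have dU : (0 < \dim U)%N by rewrite lt0n dimv_eq0.
pose X := vbasis U; pose M := \matrix_(i < \dim U, j < \dim U) coord X j (A X`_i).
have [a /eigenvalueP[v vM v0]] := eigenvalue_closed M dU.
have XU i : X`_i \in U.
  have [lt|ge] := ltnP i (size X); first exact/vbasis_mem/mem_nth.
  by rewrite nth_default // mem0v.
have AX (i : 'I_(\dim U)) : A X`_i = \sum_j M i j *: X`_j.
  have AXU : A X`_i \in U by apply: (subvP AU); exact: memv_img.
  rewrite {1}(coord_vbasis AXU).
  by apply: eq_bigr => j _; rewrite mxE.
pose w := \sum_i v ord0 i *: X`_i.
exists w; first by apply: memv_suml => i _; exact: memvZ.
split.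
  apply: contra_neq v0 => w0; apply/rowP => i; rewrite mxE.
  have fX : free X := basis_free (vbasisP U).
  by rewrite -(coord_sum_free (fun i => v ord0 i) i fX) -/w w0 linear0.
exists a; rewrite /w linear_sum scaler_sumr.
under eq_bigr do rewrite linearZ /= AX scaler_sumr.
rewrite exchange_big; apply: eq_bigr => j _.
transitivity ((v *m M) ord0 j *: X`_j).
  by rewrite mxE scaler_suml; apply: eq_bigr => i _; rewrite scalerA.
by rewrite vM mxE scalerA.
Qed.

Section SelfAdjoint.
Variable A : 'End(H).
Hypothesis A_sa : forall u v, dot (A u) v = dot u (A v).

Lemma eigenvalue_real v a : v != 0 -> A v = a *: v -> exists x : R, a = x%:C.
Proof.
move=> v0 Av; have := A_sa v v; rewrite Av dotZl dotZr.
have vv : dot v v != 0 by rewrite dnorm_eq0.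
by move=> /(mulIf vv) aE; apply/complex_realP/CrealP.
Qed.

(** The spectral theorem by induction on the dimension: a normalized eigenvector is split off, and
    its orthogonal complement in [U] stays invariant because [A] is self-adjoint. *)
Lemma eigenbasis_in (m : nat) (U : {vspace H}) : (\dim U <= m)%N -> (A @: U <= U)%VS ->
  exists n (e : 'I_n -> H) (l : 'I_n -> R),
  [/\ forall i j, dot (e i) (e j) = (i == j)%:R,
      forall i, A (e i) = (l i)%:C *: e i, forall i, e i \in U
    & forall v, v \in U -> v = \sum_i dot v (e i) *: e i].
Proof.
elim: m U => [|m IH] U dU AU.
  exists 0%N, (fun=> 0), (fun=> 0); split; try by case.
  move=> v; rewrite big_ord0; move: dU; rewrite leqn0 dimv_eq0 => /eqP ->.
  by rewrite memv0 => /eqP.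
have [U0|U0] := eqVneq U 0%VS.
  by apply: IH => //; rewrite U0 dimv0.
have [v vU [v0 [a Av]]] := eigenvector_in AU U0.
have [x ax] := eigenvalue_real v0 Av.
have [y [vv y0]] := dot_real v.
have yp : 0 < y.
  by rewrite lt0r y0 andbT; apply: contra_neq v0 => y00;
     apply/eqP; rewrite -(dnorm_eq0 dot) vv y00.
pose w := ((Num.sqrt y)^-1)%:C *: v.
have wU : w \in U by exact: memvZ.
have Aw : A w = x%:C *: w by rewrite /w linearZ /= Av ax scalerA mulrC -scalerA.
have ww : dot w w = 1.
  rewrite /w dotZl dotZr conjC_real vv -!rmorphM /= mulrA -invfM -expr2 sqr_sqrtr //.
  by rewrite mulVf // gt_eqF.
pose U' := (U :&: orthov dot <[w]>)%VS.
have memU' u : (u \in U') = (u \in U) && (dot u w == 0).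
  by rewrite memv_cap mem_orthov1.
have AU' : (A @: U' <= U')%VS.
  apply/subvP => _ /memv_imgP[u + ->]; rewrite !memU' => /andP[uU /eqP uw].
  rewrite (subvP AU) ?memv_img //= A_sa Aw dotZr uw mulr0 eqxx //.
have dU' : (\dim U' <= m)%N.
  have wU' : w \notin U' by rewrite memU' ww oner_eq0 andbF.
  rewrite -ltnS (leq_trans _ dU) // ltn_neqAle dimvS ?capvSl // andbT.
  apply: contra wU' => /eqP dE; suff -> : U' = U by [].
  by apply/eqP; rewrite eqEdim capvSl dE leqnn.
have [n [e [l [ee Ae eU' eE]]]] := IH U' dU' AU'.
have ew i : dot (e i) w = 0 by have := eU' i; rewrite memU' => /andP[_ /eqP].
have we i : dot w (e i) = 0 by rewrite dotC ew rmorph0.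
exists n.+1, (fun i => if unlift ord0 i is Some j then e j else w),
  (fun i => if unlift ord0 i is Some j then l j else x); split.
- move=> i j; case: (unliftP ord0 i) => [i' ->|->]; case: (unliftP ord0 j) => [j' ->|->];
    rewrite /=.
  + by rewrite ee (inj_eq lift_inj).
  + by rewrite ew.
  + by rewrite we.
  + by rewrite ww.
- by move=> i; case: (unliftP ord0 i).
- move=> i; case: (unliftP ord0 i) => [i' _|_] //.
  by have := eU' i'; rewrite memU' => /andP[].
move=> u uU; rewrite big_ord_recl unlift_none.
under eq_bigr do rewrite liftK.
have u'U : u - dot u w *: w \in U'.
  by rewrite memU' memvB ?memvZ //= dotBl dotZl ww mulr1 subrr.
rewrite -{1}[u](subrK (dot u w *: w)) addrC; congr (_ + _).
rewrite {1}(eE _ u'U); apply: eq_bigr => i _.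
by rewrite dotBl dotZl we mulr0 subr0.
Qed.

Lemma self_adjoint_eigenbasis : exists n (e : 'I_n -> H) (l : 'I_n -> R), eigenbasis e l A.
Proof.
have [n [e [l [ee Ae _ eE]]]] := eigenbasis_in (leqnn (\dim {:H})) (subvf _).
by exists n, e, l; split=> // v; apply: eE; exact: memvf.
Qed.

End SelfAdjoint.

Lemma eigenbasis_dotl n (e : 'I_n -> H) (l : 'I_n -> R) (A : 'End(H)) v k :
  eigenbasis e l A -> dot (A v) (e k) = (l k)%:C * dot v (e k).
Proof.
move=> [ee Ae eE]; rewrite {1}(eE v) linear_sum dot_suml (bigD1 k) //=.
rewrite linearZ /= Ae !dotZl ee eqxx mulr1 mulrC big1 ?addr0 // => j jk.
by rewrite linearZ /= Ae !dotZl ee (negPf jk) !mulr0.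
Qed.

Lemma orthoproj_id (U : {vspace H}) v : v \in U -> orthoproj dot U v = v.
Proof.
apply: daddv_pi_id; apply/eqP; rewrite -subv0; apply/subvP => w.
rewrite memv_cap => /andP[wU /mem_orthovP/(_ _ wU) /eqP].
by rewrite dnorm_eq0 memv0.
Qed.

Lemma orthoproj_eq0 (U : {vspace H}) v : v \in orthov dot U -> orthoproj dot U v = 0.
Proof.
move=> vU; have UU : (U :&: orthov dot U = 0)%VS.
  apply/eqP; rewrite -subv0; apply/subvP => w.
  rewrite memv_cap => /andP[wU /mem_orthovP/(_ _ wU) /eqP].
  by rewrite dnorm_eq0 memv0.
have := daddv_pi_add UU (subvP (addvSr U _) _ vU).
rewrite [X in _ + X]daddv_pi_id // 1?capvC // => /eqP.
by rewrite -subr_eq0 addrK => /eqP.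
Qed.

(** Eigenspaces for distinct eigenvalues are orthogonal, so of all the spectral projections only the
    one for [l k] sees [e k]. *)
Lemma fcalc_eigenvector n (e : 'I_n -> H) (l : 'I_n -> R) (A : 'End(H)) g k :
  eigenbasis e l A -> fcalc dot g A (e k) = g (l k) *: e k.
Proof.
move=> eA; have [ee Ae eE] := eA.
have memE x v : (v \in passmx.leigenspace A x%:C) = (A v == x%:C *: v).
  by rewrite memv_ker !lfun_simp subr_eq0.
have e0 i : e i != 0 by rewrite -(dnorm_eq0 dot) ee eqxx oner_eq0.
have sub x v i : A v = x%:C *: v -> l i != x -> dot v (e i) = 0.
  move=> Av lx; have := eigenbasis_dotl v i eA; rewrite Av dotZl => /eqP.
  rewrite -subr_eq0 -mulrBl mulf_eq0 -rmorphB => /orP[|/eqP //].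
  by rewrite fmorph_eq0 subr_eq0 eq_sym (negPf lx).
(* The spectrum as a list without repetition: [l] may take a value several times, whereas the
   spectral sum counts it once. *)
pose r := undup [seq l i | i <- enum 'I_n].
have inr_ x : passmx.leigenvalue A x%:C -> x \in r.
  move=> xA; rewrite mem_undup; apply: contraT => xr.
  move: xA; rewrite /passmx.leigenvalue => /negP; case.
  rewrite -subv0; apply/subvP => v; rewrite memE => /eqP Av; rewrite memv0.
  rewrite (eE v) big1 // => i _; rewrite (sub x) ?scale0r //.
  by apply: contra xr => /eqP <-; apply: map_f; rewrite mem_enum.
have eig i : passmx.leigenvalue A (l i)%:C.
  apply: contraNneq (e0 i) => E0.
  by rewrite -memv0 -E0 memE Ae.
have rE : [set x : R | passmx.leigenvalue A x%:C] = [set` r].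
  apply/seteqP; split=> x /=; first exact: inr_.
  by rewrite mem_undup => /mapP[i _ ->]; exact: eig.
have lr : l k \in r by rewrite mem_undup; apply: map_f; rewrite mem_enum.
have Ek : e k \in passmx.leigenspace A (l k)%:C by rewrite memE Ae.
have PZ x v : (g x *: orthoproj dot (passmx.leigenspace A x%:C)) v
   = g x *: orthoproj dot (passmx.leigenspace A x%:C) v.
  exact: scale_lfunE.
have Pk : orthoproj dot (passmx.leigenspace A (l k)%:C) (e k) = e k by exact: orthoproj_id.
rewrite /fcalc rE -fsbig_seq ?undup_uniq // sum_lfunE.
transitivity (\sum_(x <- r) if x == l k then g x *: e k else 0).
  apply: eq_bigr => x _; rewrite PZ; case: eqP => [->|/eqP xk]; first by rewrite Pk.
  rewrite orthoproj_eq0 ?scaler0 //; apply/mem_orthovP => v; rewrite memE => /eqP Av.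
  suff : dot (e k) v = 0 by [].
  by rewrite dotC (sub x) ?rmorph0 // eq_sym.
rewrite (bigD1_seq (l k)) ?undup_uniq //= eqxx big1_seq ?addr0 // => x /andP[xk _].
by rewrite (negPf xk).
Qed.

(** With its companions below, this diagonalizes every term of the exponents in one basis, so their
    exponential is read off the eigenvalues. *)
Lemma eigenbasis_fcalcR n (e : 'I_n -> H) (l : 'I_n -> R) (A : 'End(H)) g :
  eigenbasis e l A -> eigenbasis e (g \o l) (fcalcR dot g A).
Proof.
by move=> eA; have [ee _ eE] := eA; split=> // i; exact: fcalc_eigenvector eA.
Qed.

Lemma eigenbasisD n (e : 'I_n -> H) (l l' : 'I_n -> R) (A B : 'End(H)) :
  eigenbasis e l A -> eigenbasis e l' B -> eigenbasis e (fun i => l i + l' i) (A + B).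
Proof.
move=> [ee Ae eE] [_ Be _]; split=> // i.
by rewrite add_lfunE Ae Be -scalerDl -rmorphD.
Qed.

Lemma eigenbasisN n (e : 'I_n -> H) (l : 'I_n -> R) (A : 'End(H)) :
  eigenbasis e l A -> eigenbasis e (fun i => - l i) (- A).
Proof. by move=> [ee Ae eE]; split=> // i; rewrite opp_lfunE Ae -scaleNr -rmorphN. Qed.

Lemma eigenbasis_scalar n (e : 'I_n -> H) (l : 'I_n -> R) (A : 'End(H)) c :
  eigenbasis e l A -> eigenbasis e (fun=> c) (c%:C *: \1%VF).
Proof. by move=> [ee _ eE]; split=> // i; rewrite scale_lfunE id_lfunE. Qed.

Lemma expi_sum n (e : 'I_n -> H) (l : 'I_n -> R) (A : 'End(H)) v :
  eigenbasis e l A -> expi dot A v = \sum_i (dot v (e i) * cis (l i)) *: e i.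
Proof.
move=> eA; have [_ _ eE] := eA; rewrite {1}(eE v) linear_sum /=.
apply: eq_bigr => i _; rewrite linearZ /= /expi (fcalc_eigenvector _ _ eA).
by rewrite scalerA.
Qed.

End Spectral.

(** * The complex Hilbert space *)

(** An alias of the carrier on which a real module structure can be declared without clashing with
    the complex one. *)
Definition realify (R : realType) (H : vectType R[i]) : Type := H.

Section Realify.
Variables (R : realType) (H : vectType R[i]).

HB.instance Definition _ := GRing.Zmodule.copy (realify H) H.

Let rscale (a : R) (v : realify H) : realify H := a%:C *: (v : H).

Let rscaleA a b v : rscale a (rscale b v) = rscale (a * b) v.
Proof. by rewrite /rscale scalerA rmorphM. Qed.

Let rscale1 : left_id 1 rscale.
Proof. by move=> v; rewrite /rscale rmorph1 scale1r. Qed.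

Let rscaleDr : right_distributive rscale +%R.
Proof. by move=> a u v; rewrite /rscale scalerDr. Qed.

Let rscaleDl v : {morph rscale^~ v : a b / a + b}.
Proof. by move=> a b; rewrite /rscale rmorphD scalerDl. Qed.

HB.instance Definition _ := GRing.Zmodule_isLmodule.Build R (realify H)
  rscaleA rscale1 rscaleDr rscaleDl.

Lemma realifyZ (a : R) (v : H) : a *: (v : realify H) = (a%:C *: v) :> H.
Proof. by []. Qed.

Definition real_op (A : 'End(H)) (v : realify H) : realify H := A v.

Lemma real_op_linear A : linear (real_op A).
Proof. by move=> a u v; rewrite /real_op !realifyZ linearP. Qed.

HB.instance Definition _ A :=
  GRing.isLinear.Build R (realify H) (realify H) _ (real_op A) (real_op_linear A).

Definition mul_i (v : realify H) : realify H := 'i *: (v : H).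

Lemma mul_i_linear : linear mul_i.
Proof. by move=> a u v; rewrite /mul_i !realifyZ scalerDr !scalerA mulrC. Qed.

HB.instance Definition _ :=
  GRing.isLinear.Build R (realify H) (realify H) _ mul_i mul_i_linear.

End Realify.

Section RealEuclid.
Variables (R : realType) (H : vectType R[i]) (dot : {dot H for conjC}).
Variables (n : nat) (e : 'I_n -> H).
Hypothesis e_sum : forall v, v = \sum_i dot v (e i) *: e i.

Local Notation V := (realify H).

Definition real_dot (u v : V) : R := complex.Re (dot u v).

(** The vectors [e k] and [i e k] pick out the real and imaginary parts of [dot v (e k)], so they
    form a Parseval frame for the real part of [dot]. *)
Definition real_frame (p : bool * 'I_n) : V := if p.1 then e p.2 else 'i *: e p.2.

Lemma Re_conjC (z : R[i]) : complex.Re (conjC z) = complex.Re z.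
Proof. by case: z. Qed.

Lemma real_dotC u v : real_dot u v = real_dot v u.
Proof. by rewrite /real_dot dotC Re_conjC. Qed.

Lemma ReZ (a : R) (z : R[i]) : complex.Re (a%:C * z) = a * complex.Re z.
Proof. by case: z => x y /=; rewrite mul0r subr0. Qed.

Lemma ReD (z w : R[i]) : complex.Re (z + w) = complex.Re z + complex.Re w.
Proof. by case: z; case: w. Qed.

Lemma real_dot_linear a (u v w : V) :
  real_dot (a *: u + v) w = a * real_dot u w + real_dot v w.
Proof. by rewrite /real_dot dotDl dotZl ReD ReZ. Qed.

Lemma Re_conj_i (z : R[i]) : complex.Re (conjC 'i * z) = complex.Im z.
Proof. by case: z => x y; rewrite /conjC /=; simpc; rewrite /=; ring. Qed.

Lemma real_frame_sum (v : V) : v = \sum_p real_dot v (real_frame p) *: real_frame p.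
Proof.
rewrite -(pair_bigA _ (fun b k => real_dot v (real_frame (b, k)) *: real_frame (b, k))) /=.
rewrite big_bool /= -big_split /= {1}(e_sum v); apply: eq_bigr => k _.
rewrite /real_dot /real_frame /= dotZr Re_conj_i.
suff : dot v (e k) *: e k = (complex.Re (dot v (e k)))%:C *: e k
    + (complex.Im (dot v (e k)))%:C *: ('i *: e k) :> H by [].
rewrite scalerA -scalerDl; congr (_ *: _).
by case: (dot v (e k)) => x y; simpc.
Qed.

Definition real_euclid : euclid V :=
  Euclid real_dotC real_dot_linear real_frame_sum.

Lemma mul_i_skew (u v : V) : ip real_euclid (mul_i u) v = - ip real_euclid u (mul_i v).
Proof.
rewrite /= /real_dot /mul_i dotZl dotZr; case: (dot u v) => x y.
by rewrite /conjC /=; simpc; rewrite /=; ring.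
Qed.

Lemma mul_i_sq (u : V) : mul_i (mul_i u) = - u.
Proof. by rewrite /mul_i scalerA -expr2 sqr_i scaleN1r. Qed.

Lemma real_op_mul_i (A : 'End(H)) (u : V) : real_op A (mul_i u) = mul_i (real_op A u).
Proof. by rewrite /real_op /mul_i linearZ. Qed.

Lemma real_op_adj (A B : 'End(H)) : is_adjoint dot A B -> forall u v : V,
  ip real_euclid (real_op A u) v = ip real_euclid u (real_op B v).
Proof. by move=> AB u v; rewrite /= /real_dot /real_op AB. Qed.

Local Notation E := real_euclid.
Local Notation PE := (prod_euclid real_euclid).

Lemma hnorm2E (u : V * V) : hnorm2 dot u = nrm PE u.
Proof. by rewrite /hnorm2 /nrm /= /prod_ip -!(sqr_nrm E). Qed.

Let quotient_ip (u : R -> V * V) (d f : V * V) (h s t : R) :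
  prod_ip E (h^-1 *: (u t - u s) - d) f =
  h^-1 * (prod_ip E (u t) f - prod_ip E (u s) f) - prod_ip E d f.
Proof.
have e1 := ipBl PE (h^-1 *: (u t - u s)) d f.
have e2 := ipZl PE h^-1 (u t - u s) f; have e3 := ipBl PE (u t) (u s) f.
by rewrite e2 e3 in e1.
Qed.

Lemma H2derivative_wder (u : R -> V * V) (s : R) (d : V * V) :
  H2derivative dot u s d -> wder PE u s d.
Proof.
move=> hd f; pose g t := prod_ip E (u t) f.
suff h : h^-1 *: (g (h *: 1 + s) - g s) @[h --> 0^'] --> prod_ip E d f.
  by split; [apply/cvg_ex; exists (prod_ip E d f)|exact/cvg_lim].
apply/cvgrPdist_le => /= eps eps0.
have c0 : 0 < 1 + nrm PE f by rewrite ltr_pwDl ?nrm_ge0.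
have := hd; rewrite /H2derivative => /cvgrPdist_le /= /(_ (eps / (1 + nrm PE f))).
rewrite divr_gt0 // => /(_ isT) hd'.
near=> h.
have hh : `|0 - hnorm2 dot ((h^-1)%:C *: (u (s + h) - u s) - d)| <= eps / (1 + nrm PE f).
  by near: h.
rewrite sub0r normrN hnorm2E ger0_norm ?nrm_ge0 // in hh.
have key : prod_ip E (((h^-1)%:C *: (u (s + h) - u s) - d) : V * V) f =
    h^-1 * (g (h + s) - g s) - prod_ip E d f.
  by rewrite [s + h]addrC; exact: quotient_ip.
rewrite /GRing.scale /= mulr1 distrC -key.
rewrite (le_trans (cauchy_schwarz PE _ f)) //.
rewrite (le_trans (ler_wpM2r (nrm_ge0 PE f) hh)) //.
rewrite mulrAC ler_pdivrMr // ler_wpM2l ?(ltW eps0) // lerDr //.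
Unshelve. all: by end_near. Qed.

(** Finiteness of the frame upgrades weak differentiability to differentiability in norm. *)
Lemma wder_H2derivative (u : R -> V * V) (s : R) (d : V * V) :
  wder PE u s d -> H2derivative dot u s d.
Proof.
move=> du; apply/cvgrPdist_le => /= eps eps0.
pose b := frame PE; pose S := \sum_k nrm PE (b k).
have S0 : 0 <= S by apply: sumr_ge0 => k _; exact: nrm_ge0.
have c0 : 0 < 1 + S by rewrite ltr_pwDl.
have hk k : \forall h \near 0^', `|prod_ip E d (b k) -
    h^-1 *: (prod_ip E (u (h *: 1 + s)) (b k) - prod_ip E (u s) (b k))| <= eps / (1 + S).
  have [dk dE] := du (b k).
  have : h^-1 *: (prod_ip E (u (h *: 1 + s)) (b k) - prod_ip E (u s) (b k)) @[h --> 0^']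
     --> prod_ip E d (b k) by move: dE => /= <-; exact: dk.
  by move=> /cvgrPdist_le; apply; rewrite divr_gt0.
near=> h.
have hk' : forall k, `|prod_ip E d (b k) -
    h^-1 *: (prod_ip E (u (h *: 1 + s)) (b k) - prod_ip E (u s) (b k))| <= eps / (1 + S).
  near: h; apply: filter_forall; exact: hk.
rewrite sub0r normrN hnorm2E ger0_norm ?nrm_ge0 //.
rewrite (le_trans (nrm_le_frame PE _)) //.
apply: (@le_trans _ _ (\sum_k (eps / (1 + S)) * nrm PE (b k))).
  apply: ler_sum => k _; rewrite ler_wpM2r ?nrm_ge0 //; apply: le_trans (hk' k).
  rewrite distrC /GRing.scale /= mulr1 [h + s]addrC -quotient_ip.
  exact: lexx.
rewrite -mulr_sumr -/S mulrAC ler_pdivrMr //.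
by apply: ler_wpM2l; [exact: ltW|rewrite lerDr].
Unshelve. all: by end_near. Qed.

Lemma wder_H2continuous (u d : R -> V * V) :
  (forall s, wder PE u s (d s)) -> H2continuous dot u.
Proof.
move=> du s; have cu : forall f, continuous (fun t => prod_ip E (u t) f).
  by move=> f; exact: (@wder_cont _ _ PE u d du f).
apply/cvgrPdist_le => /= eps eps0.
pose b := frame PE; pose S := \sum_k nrm PE (b k).
have S0 : 0 <= S by apply: sumr_ge0 => k _; exact: nrm_ge0.
have c0 : 0 < 1 + S by rewrite ltr_pwDl.
near=> t.
have ht : forall k, `|prod_ip E (u s) (b k) - prod_ip E (u t) (b k)| <= eps / (1 + S).
  near: t; apply: filter_forall => k.
  by have /cvgrPdist_le := cu (b k) s; apply; rewrite divr_gt0.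
rewrite sub0r normrN hnorm2E ger0_norm ?nrm_ge0 //.
rewrite (le_trans (nrm_le_frame PE _)) //.
apply: (@le_trans _ _ (\sum_k (eps / (1 + S)) * nrm PE (b k))).
  apply: ler_sum => k _; rewrite ler_wpM2r ?nrm_ge0 //; apply: le_trans (ht k).
  by have := ipBl PE (u t) (u s) (b k); rewrite distrC => <-; exact: lexx.
rewrite -mulr_sumr -/S mulrAC ler_pdivrMr //.
by apply: ler_wpM2l; [exact: ltW|rewrite lerDr].
Unshelve. all: by end_near. Qed.

End RealEuclid.

(** * The explicit asymptotic profile *)

Section Phase.
Variable R : realType.

(** The term [lambda / (2 s)] is an eigenvalue of the correction [G Gs / (2 s)] in [free_flow]; its
    integral is the logarithm. *)
Lemma der_phase (s lambda : R) : 0 < s ->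
  is_derive s 1 (fun t => phase t lambda) (s + lambda * (2^-1 * s^-1)).
Proof.
move=> s0; have d := derD (derZ 2^-1 (derX 2 (der_id s)))
  (derZ (lambda / 2) (is_derive1_ln s0)).
apply: (@near_eq_is_derive _ _ _ (fun t : R => 2^-1 * t ^+ 2 + lambda / 2 * ln t)).
  near=> t; rewrite /phase gtr0_norm; first by rewrite mulrC.
  by near: t; exact: lt_nbhsr.
by apply: (der_eq d); rewrite /=; field; rewrite gt_eqF.
Unshelve. all: by end_near. Qed.

Lemma der_Re_cis (w : R[i]) (th : R -> R) (th' s : R) : is_derive s 1 th th' ->
  is_derive s 1 (fun t => complex.Re (w * cis (th t)))
    (complex.Re ('i * (th'%:C * (w * cis (th s))))).
Proof.
move=> dth; case: w => x y.
have E (t : R) : complex.Re ((x +i* y) * cis (th t)) = x * cos (th t) - y * sin (th t) by [].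
under eq_fun do rewrite E.
have dc := is_derive1_comp (is_derive_cos (th s)) dth.
have ds := is_derive1_comp (is_derive_sin (th s)) dth.
apply: (der_eq (derB (derZ x dc) (derZ y ds))).
by rewrite /cis; simpc; rewrite /=; ring.
Qed.

Lemma cis_conj (x : R) : cis x * conjC (cis x) = 1.
Proof.
rewrite /cis /conjC /=; simpc; congr (_ +i* _); last by ring.
by rewrite -[RHS](cos2Dsin2 x); ring.
Qed.

End Phase.

Section Profile.
Variables (R : realType) (H : vectType R[i]) (dot : {dot H for conjC}).
Variables (n m : nat) (e : 'I_n -> H) (b : 'I_m -> H) (l : 'I_m -> R) (A : 'End(H)).
Hypothesis e_sum : forall v, v = \sum_i dot v (e i) *: e i.
Hypothesis bA : eigenbasis dot b l A.

Local Notation V := (realify H).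
Local Notation E := (real_euclid e_sum).

Lemma dot_eigen_sum (c d : 'I_m -> R[i]) :
  dot (\sum_k c k *: b k) (\sum_k d k *: b k) = \sum_k c k * conjC (d k).
Proof.
have [bb _ _] := bA; rewrite dot_suml; apply: eq_bigr => k _.
rewrite dotZl; congr (_ * _); rewrite dotC; congr conjC.
rewrite dot_suml (bigD1 k) //= dotZl bb eqxx mulr1 big1 ?addr0 // => j jk.
by rewrite dotZl bb (negPf jk) mulr0.
Qed.

(** On [b k] the operator [x + y A] is the scalar [x + l k * y], which is the rotation rate of the
    phase [th k]. *)
Lemma wder_eigen_sum (c : 'I_m -> R[i]) (th : 'I_m -> R -> R) (x y s : R) :
  (forall k, is_derive s 1 (th k) (x + l k * y)) ->
  let z t : V := \sum_k (c k * cis (th k t)) *: b k in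
  wder E z s (mul_i (x *: z s + y *: real_op A (z s))).
Proof.
move=> dth z f; have [_ Ab _] := bA.
have zf t : ip E (z t) f = \sum_k complex.Re (c k * dot (b k) f * cis (th k t)).
  rewrite /= /real_dot /z dot_suml.
  rewrite (big_morph (fun w : R[i] => complex.Re w) (@ReD R) (erefl : complex.Re 0 = 0)).
  by apply: eq_bigr => k _; rewrite dotZl mulrAC.
under eq_fun do rewrite zf.
have -> : ip E (mul_i (x *: z s + y *: real_op A (z s))) f =
    \sum_k complex.Re ('i * ((x + l k * y)%:C * (c k * dot (b k) f * cis (th k s)))).
  have -> : mul_i (x *: z s + y *: real_op A (z s)) =
      \sum_k ('i * (x + l k * y)%:C * (c k * cis (th k s))) *: b k :> H.
    transitivity ('i *: (x%:C *: (z s : H) + y%:C *: A (z s))); first by [].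
    have -> : A (z s) = \sum_k A ((c k * cis (th k s)) *: b k) by rewrite /z linear_sum.
    rewrite !scaler_sumr -big_split scaler_sumr; apply: eq_bigr => k _ /=.
    have AZ a v : A (a *: v) = a *: A v by exact: linearZ.
    rewrite AZ Ab !scalerA -scalerDl scalerA; congr (_ *: _).
    by rewrite rmorphD rmorphM /=; ring.
  rewrite /= /real_dot dot_suml.
  rewrite (big_morph (fun w : R[i] => complex.Re w) (@ReD R) (erefl : complex.Re 0 = 0)).
  by apply: eq_bigr => k _; rewrite dotZl; congr complex.Re; ring.
by apply: is_derive_fsum => k; exact: der_Re_cis.
Qed.

Lemma norm_eigen_sum (v : H) (th : 'I_m -> R) :
  let z : V := \sum_k (dot v (b k) * cis (th k)) *: b k in
  ip E z z = ip E (v : V) (v : V).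
Proof.
have [_ _ bE] := bA; rewrite /= /real_dot dot_eigen_sum.
rewrite [in RHS](bE v) dot_eigen_sum; congr complex.Re; apply: eq_bigr => k _.
by rewrite rmorphM mulrACA cis_conj mulr1.
Qed.

End Profile.

(** * Translation between the complex equation and the real system *)

Section Assembly.
Variables (R : realType) (H : vectType R[i]) (dot : {dot H for conjC}).
Variables (G Gs : 'End(H)) (delta : R) (f1 f2 : R * R -> R).
Hypothesis hadj : is_adjoint dot G Gs.
Variables (n : nat) (e : 'I_n -> H).
Hypothesis e_sum : forall v, v = \sum_i dot v (e i) *: e i.

Local Notation V := (realify H).
Local Notation E := (real_euclid e_sum).
Local Notation PE := (prod_euclid E).
Local Notation J := (@mul_i R H).
Local Notation F1 := (fun x => delta * f1 (x, 1 - x)).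
Local Notation F2 := (fun x => delta * f2 (x, 1 - x)).

Lemma adjoint_sym u v : dot (Gs u) v = dot u (G v).
Proof. by rewrite dotC -hadj -dotC. Qed.

Lemma hnorm_sq (v : H) : hnorm dot v ^+ 2 = ip E (v : V) (v : V).
Proof. exact: (sqr_nrm E v). Qed.

(** Kept in terms of [nonlin]: the reduction to [f (n, 1 - n)] needs unit norm, which for an
    arbitrary solution is itself deduced from these equations in [tends_to_norm]. *)
Lemma solution_wder (u : R -> V * V) : solution dot G Gs delta f1 f2 u -> forall s,
  wder E (fun t => (u t).1) s
    (J ((s + delta * nonlin dot f1 (u s)) *: (u s).1 + real_op G (u s).2)) /\
  wder E (fun t => (u t).2) s
    (J ((delta * nonlin dot f2 (u s) - s) *: (u s).2 + real_op Gs (u s).1)).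
Proof.
move=> [_ hu] s; have [d /(H2derivative_wder e_sum) hd dE] := hu s.
have d1 : d.1 = 'i *: (rhs dot G Gs delta f1 f2 s (u s)).1.
  by rewrite -dE /= scalerA mulrN -expr2 sqr_i opprK scale1r.
have d2 : d.2 = 'i *: (rhs dot G Gs delta f1 f2 s (u s)).2.
  by rewrite -dE /= scalerA mulrN -expr2 sqr_i opprK scale1r.
split; [apply: (wder_eq (wder_fst hd)); rewrite d1|apply: (wder_eq (wder_snd hd)); rewrite d2].
  congr ('i *: _); rewrite /rhs /real_op /= addrAC -scalerDl -rmorphD.
  by [].
congr ('i *: _); rewrite /rhs /real_op /= -addrA addrC; congr (_ + _).
by rewrite addrC -scalerBl -rmorphB.
Qed.

Lemma nonlin_unit (f : R * R -> R) (v : V * V) : nrm PE v = 1 ->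
  nonlin dot f v = f (ip E v.1 v.1, 1 - ip E v.1 v.1).
Proof.
move=> v1; rewrite /nonlin !hnorm_sq.
have := sqr_nrm PE v; rewrite v1 expr1n /= /prod_ip => -> /=.
by congr (f (_, _)); rewrite addrAC subrr add0r.
Qed.

Lemma solution_flow (u : R -> V * V) : (forall s, nrm PE (u s) = 1) ->
  solution dot G Gs delta f1 f2 u -> flow E J (real_op G) (real_op Gs) F1 F2 u.
Proof.
move=> u1 su s; have [h1 h2] := solution_wder su s.
by rewrite !nonlin_unit // in h1 h2.
Qed.

Lemma flow_solution (u : R -> V * V) : (forall s, nrm PE (u s) = 1) ->
  flow E J (real_op G) (real_op Gs) F1 F2 u -> solution dot G Gs delta f1 f2 u.
Proof.
move=> u1 fu.
pose r s : V * V := ((s + F1 (ip E (u s).1 (u s).1)) *: (u s).1 + real_op G (u s).2,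
             (F2 (ip E (u s).1 (u s).1) - s) *: (u s).2 + real_op Gs (u s).1).
have du s : wder PE u s (J (r s).1, J (r s).2) by have [h1 h2] := fu s; exact: wder_pair.
split; first exact: wder_H2continuous du.
move=> s; exists (J (r s).1, J (r s).2); first exact: wder_H2derivative.
have Ji (v : V) : - 'i *: (J v : H) = v.
  by rewrite /mul_i scalerA mulNr -expr2 sqr_i opprK scale1r.
rewrite /rhs !nonlin_unit //.
have -> : - 'i *: ((J (r s).1, J (r s).2) : H * H) = (r s : H * H).
  by rewrite [RHS]surjective_pairing; congr (_, _); exact: Ji.
rewrite /r; congr (_, _).
  by rewrite realifyZ rmorphD scalerDl addrAC.
by rewrite realifyZ rmorphB scalerBl addrC addrA addrAC.
Qed.


Variables (m1 m2 : nat) (b1 : 'I_m1 -> H) (b2 : 'I_m2 -> H).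
Variables (l1 : 'I_m1 -> R) (l2 : 'I_m2 -> R).
Hypothesis eb1 : eigenbasis dot b1 l1 (G \o Gs)%VF.
Hypothesis eb2 : eigenbasis dot b2 l2 (Gs \o G)%VF.

Definition asymptotic_profile (omega : V * V) (phi s : R) : V * V :=
  (expi dot ((delta * nonlin dot f1 omega * s)%:C *: \1%VF
      + fcalcR dot (phase s) (G \o Gs)%VF + phi%:C *: \1%VF) omega.1,
   expi dot ((delta * nonlin dot f2 omega * s)%:C *: \1%VF
      - fcalcR dot (phase s) (Gs \o G)%VF - phi%:C *: \1%VF) omega.2).

(** In the eigenbases each coefficient carries an explicit phase whose derivative is the rate
    prescribed by [free_flow]; [phi] is constant and disappears on differentiation. *)
Lemma asymptotic_profileP (omega : V * V) phi : nrm PE omega = 1 ->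
  profile E J (real_op G) (real_op Gs) F1 F2 (ip E omega.1 omega.1)
    (asymptotic_profile omega phi).
Proof.
move=> o1 s s0; set nw := ip E omega.1 omega.1.
pose th1 k t := delta * nonlin dot f1 omega * t + phase t (l1 k) + phi.
pose th2 k t := delta * nonlin dot f2 omega * t - phase t (l2 k) - phi.
have z1 t : (asymptotic_profile omega phi t).1
    = \sum_k (dot omega.1 (b1 k) * cis (th1 k t)) *: b1 k.
  have h := eigenbasisD (eigenbasisD (eigenbasis_scalar
    (delta * nonlin dot f1 omega * t) eb1) (eigenbasis_fcalcR (phase t) eb1))
    (eigenbasis_scalar phi eb1).
  by rewrite /asymptotic_profile /= (expi_sum _ h).
have z2 t : (asymptotic_profile omega phi t).2
    = \sum_k (dot omega.2 (b2 k) * cis (th2 k t)) *: b2 k.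
  have h := eigenbasisD (eigenbasisD (eigenbasis_scalar
    (delta * nonlin dot f2 omega * t) eb2) (eigenbasisN (eigenbasis_fcalcR (phase t) eb2)))
    (eigenbasisN (eigenbasis_scalar phi eb2)).
  by rewrite /asymptotic_profile /= (expi_sum _ h).
have n1 : nonlin dot f1 omega = f1 (nw, 1 - nw) by exact: nonlin_unit.
have n2 : nonlin dot f2 omega = f2 (nw, 1 - nw) by exact: nonlin_unit.
have nw2 : ip E omega.2 omega.2 = 1 - nw.
  have := sqr_nrm PE omega; rewrite o1 expr1n /= /prod_ip => ->.
  by rewrite addrAC subrr add0r.
split.
- under eq_fun do rewrite z1.
  have dth k : is_derive s 1 (th1 k) (1 * s + F1 nw + l1 k * (1 / 2 * s^-1)).
    have d := derD (derD (derZ (delta * nonlin dot f1 omega) (der_id s))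
      (der_phase (l1 k) s0)) (der_cst phi s).
    by apply: (der_eq d); rewrite n1; ring.
  apply: (wder_eq (wder_eigen_sum e_sum eb1 (fun k => dot omega.1 (b1 k)) dth)).
  by rewrite z1 /free_flow /real_op comp_lfunE.
- under eq_fun do rewrite z2.
  have dth k : is_derive s 1 (th2 k) (-1 * s + F2 (1 - (1 - nw)) + l2 k * (-1 / 2 * s^-1)).
    have d := derB (derB (derZ (delta * nonlin dot f2 omega) (der_id s))
      (der_phase (l2 k) s0)) (der_cst phi s).
    by apply: (der_eq d); rewrite n2 subKr; ring.
  apply: (wder_eq (wder_eigen_sum e_sum eb2 (fun k => dot omega.2 (b2 k)) dth)).
  by rewrite z2 /free_flow /real_op comp_lfunE.
- by rewrite z1; exact: (norm_eigen_sum e_sum eb1 omega.1 (fun k => th1 k s)).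
- by rewrite z2 -nw2; exact: (norm_eigen_sum e_sum eb2 omega.2 (fun k => th2 k s)).
Qed.

Lemma asymptotics_tends_to (C s0 : R) (omega : V * V) phi (u : R -> V * V) : 0 < s0 ->
  asymptotics dot G Gs delta f1 f2 C s0 omega phi u ->
  tends_to E u (asymptotic_profile omega phi).
Proof.
move=> s00 [h1 h2] eps eps0; exists (Num.max s0 (2 * `|C| / eps)) => T.
rewrite ge_max => /andP[sT CT]; have T0 : 0 < T by exact: lt_le_trans sT.
have bd : C * `|1 / T| <= eps / 2.
  rewrite (@le_trans _ _ (`|C| * `|1 / T|)) //; first by rewrite ler_wpM2r ?ler_norm.
  have -> : `|1 / T| = T^-1 by rewrite div1r ger0_norm // invr_ge0 ltW.
  rewrite ler_pdivrMr //.
  have : 2 * `|C| <= T * eps by rewrite -ler_pdivrMr.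
  by lra.
rewrite (le_trans (nrm_pair E _)) // [leRHS]splitr lerD //.
  exact: le_trans (h1 T sT) bd.
exact: le_trans (h2 T sT) bd.
Qed.

(** The norm is conserved, so it equals its limit at infinity, which is that of the profile. *)
Lemma tends_to_norm (u z : R -> V * V) : tends_to E u z ->
  (forall s, 0 < s -> nrm PE (z s) = 1) -> solution dot G Gs delta f1 f2 u ->
  forall s, nrm PE (u s) = 1.
Proof.
move=> uz z1 su s; apply/eqP; rewrite -subr_eq0 -normr_le0; apply/ler_addgt0Pr => eps eps0.
have [T0 hT] := uz eps eps0; pose T := Num.max T0 1.
have T1 : 0 < T by rewrite lt_max ltr01 orbT.
have -> : nrm PE (u s) = nrm PE (u T).
  apply: (norm_conserved (J := J) (G := real_op G) (Gs := real_op Gs) (E := E)) => //.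
  - exact: mul_i_skew.
  - exact: real_op_mul_i.
  - exact: real_op_adj.
  - by move=> x; have [h _] := solution_wder su x; exact: h.
  - by move=> x; have [_ h] := solution_wder su x; exact: h.
rewrite add0r -(z1 T T1) (le_trans (nrm_dist _ _ _)) // hT //.
by rewrite le_max lexx.
Qed.

End Assembly.

Local Close Scope complex_scope.
Unset Implicit Arguments.

Theorem proposition1p6
  (R : realType) (H : vectType R[i]) (dot : {dot H for conjC})
  (G Gs : 'End(H)) (hadj : is_adjoint dot G Gs)
  (hcalc : forall chi : R -> R, continuous chi ->
     (fcalcR dot chi (G \o Gs) \o G)%VF = (G \o fcalcR dot chi (Gs \o G))%VF /\
     (fcalcR dot chi (Gs \o G) \o Gs)%VF = (Gs \o fcalcR dot chi (G \o Gs))%VF)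
  (delta : R) (f1 f2 : R * R -> R)
  (hf1 : C2 f1) (hf1b : bounded_hessian f1)
  (hf2 : C2 f2) (hf2b : bounded_hessian f2)
  (theta : R -> R) (htheta : cutoff theta)
  (r : R) (hr : 0 < r) :
  exists C s0 : R, 0 < s0 /\
  forall omega : H * H,
    hnorm2 dot omega = 1 -> omega = Theta dot G Gs theta r omega ->
    [/\ exists phi : R, exists u : R -> H * H,
          [/\ 0 <= phi < 2 * pi,
              solution dot G Gs delta f1 f2 u,
              forall s, hnorm2 dot (u s) = 1
            & asymptotics dot G Gs delta f1 f2 C s0 omega phi u],
        forall phi : R, 0 <= phi < 2 * pi ->
          forall u v : R -> H * H,
            solution dot G Gs delta f1 f2 u ->
            solution dot G Gs delta f1 f2 v ->
            (exists C' s0' : R, 0 < s0' /\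
               asymptotics dot G Gs delta f1 f2 C' s0' omega phi u) ->
            (exists C' s0' : R, 0 < s0' /\
               asymptotics dot G Gs delta f1 f2 C' s0' omega phi v) ->
            forall s, u s = v s
      & (forall w : H * H, nonlin dot f1 w = nonlin dot f2 w) ->
        exists u : R -> H * H,
          [/\ solution dot G Gs delta f1 f2 u,
              forall s, hnorm2 dot (u s) = 1
            & asymptotics dot G Gs delta f1 f2 C s0 omega 0 u]].
Proof.
have sa1 u v : dot ((G \o Gs)%VF u) v = dot u ((G \o Gs)%VF v).
  by rewrite !comp_lfunE hadj (adjoint_sym hadj).
have sa2 u v : dot ((Gs \o G)%VF u) v = dot u ((Gs \o G)%VF v).
  by rewrite !comp_lfunE (adjoint_sym hadj) hadj.
have [m1 [b1 [l1 eb1]]] := self_adjoint_eigenbasis sa1.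
have [m2 [b2 [l2 eb2]]] := self_adjoint_eigenbasis sa2.
have [_ _ e_sum] := eb1.
have [K1 [dF1 cF1']] := C2_c11 delta hf1 hf1b.
have [K2 [dF2 cF2']] := C2_c11 delta hf2 hf2b.
(* The component estimates use a single constant for both nonlinearities. *)
pose K := Num.max K1 K2.
have K1K : K1 <= K by rewrite le_max lexx.
have K2K : K2 <= K by rewrite le_max lexx orbT.
have cF1 := c11_le K1K cF1'; have cF2 := c11_le K2K cF2'.
pose E := real_euclid e_sum.
have skew : forall u v, ip E (mul_i u) v = - ip E u (mul_i v) := mul_i_skew e_sum.
have adj : forall u v, ip E (real_op G u) v = ip E u (real_op Gs v) :=
  real_op_adj e_sum hadj.
have [C [s0 [C0 s00 hex]]] := flow_exists_at_infinity skew (@mul_i_sq R H)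
  (real_op_mul_i G) (real_op_mul_i Gs) adj cF1 cF2.
exists C, s0; split=> // omega o1 _.
have o1' : nrm (prod_euclid E) omega = 1 by rewrite -o1 (hnorm2E e_sum).
have nw01 : 0 <= ip E omega.1 omega.1 <= 1.
  rewrite ip_ge0 -(sqr_nrm E omega.1) exprn_ile1 ?nrm_ge0 //.
  rewrite -o1'; exact: (nrm_fst E omega).
have pz phi := asymptotic_profileP delta f1 f2 eb1 eb2 phi o1'.
(* One solution with [phi = 0] serves both existence clauses. *)
have exists0 : exists u : R -> H * H, [/\ solution dot G Gs delta f1 f2 u,
    forall s, hnorm2 dot (u s) = 1 & asymptotics dot G Gs delta f1 f2 C s0 omega 0 u].
  have [u [fu u1 hu]] := hex _ _ nw01 (pz 0).
  exists u; split.
  - exact: (flow_solution (e_sum := e_sum)).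
  - by move=> s; rewrite (hnorm2E e_sum).
  have inv s : s0 <= s -> `|1 / s| = s^-1.
    by move=> ss; rewrite div1r ger0_norm // invr_ge0 ltW // (lt_le_trans s00).
  by split=> s ss; have [h1 h2] := hu s ss; rewrite inv //; first [exact: h1|exact: h2].
split; last by move=> _.
  have [u [su u1 au]] := exists0; exists 0, u; split=> //.
  by rewrite lexx mulr_gt0 // pi_gt0.
move=> phi _ u v su sv [C1 [s1 [s10 au]]] [C2 [s2 [s20 av]]].
have tu := asymptotics_tends_to e_sum s10 au.
have tv := asymptotics_tends_to e_sum s20 av.
(* The profile has norm 1, hence so does every solution tending to it; this is what puts [u] and [v]
   in the form [flow]. *)
have z1 s : 0 < s -> nrm (prod_euclid E) (asymptotic_profile dot G Gs delta f1 f2 omega phi s) = 1.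
  move=> sp; have [_ _ h1 h2] := pz phi s sp.
  by rewrite /nrm /= /prod_ip h1 h2 addrC subrK sqrtr1.
have u1 := tends_to_norm hadj (e_sum := e_sum) tu z1 su.
have v1 := tends_to_norm hadj (e_sum := e_sum) tv z1 sv.
exact: (flow_unique_at_infinity skew (@mul_i_sq R H)
  (real_op_mul_i G) (real_op_mul_i Gs) adj cF1 cF2 nw01 (pz phi)
  (solution_flow u1 su) (solution_flow v1 sv) u1 v1 tu tv).
Qed.
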